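(* Let $M$ be a Riemannian manifold, and $f:M\to\mathbb{R}$ a convex and locally bounded function. Then $f$ is differentiable on a dense subset of $M$ (whose complement has measure zero if $M$ is finite-dimensional).
   Context: A Riemannian manifold is a $C^\infty$ manifold modelled on a Hilbert space (possibly infinite-dimensional) with a $C^\infty$ assignment of scalar products on the tangent spaces inducing equivalent norms. A function $f:M\to\mathbb{R}$ is convex if $f\circ\sigma:I\subseteq\mathbb{R}\to\mathbb{R}$ is convex for every geodesic $\sigma:I\to M$ (parameterized by arc length). Differentiable means Fréchet differentiable. *)

(* Defs.v *)
From HB Require Import structures.
From mathcomp Require Import all_boot all_order all_algebra.
From mathcomp Require Import sesquilinear.
From mathcomp Require Import all_classical all_reals all_analysis.

Set Implicit Arguments.
Unset Strict Implicit.
Unset Printing Implicit Defensive.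

Import Order.TTheory GRing.Theory Num.Theory.
Import numFieldNormedType.Exports.

Local Open Scope classical_set_scope.
Local Open Scope ring_scope.

(* The complete norm of H is the one induced by the scalar product dot. *)
Definition hilbert_product (R : realType) (H : completeNormedModType R)
    (dot : {dot H for idfun}) : Prop :=
  forall u : H, `|u| ^+ 2 = dot u u.

(* A k-linear map E^k -> F is encoded as a function on lists, of which only the
   values on lists of size k matter. *)
Definition bounded_multilinear (R : realType) (E F : normedModType R)
    (k : nat) (T : seq E -> F) : Prop :=
  (forall (s t : seq E) (a : R) (u v : E), (size s + size t).+1 = k ->
     T (s ++ (a *: u + v) :: t) = a *: T (s ++ u :: t) + T (s ++ v :: t)) /\
  (exists C : R, forall w : seq E, size w = k ->
     `|T w| <= C * \prod_(v <- w) `|v|).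

(* G is a C^oo map from the open set U to the space of bounded m-linear maps
   E^m -> F with the operator norm: D x w, for w of size m + j, is the value
   on w of the j-th iterated Frechet derivative of G at x, the directions of
   differentiation coming first, the last one being the head of w. *)
Definition smooth_multilinear_on (R : realType) (E F : normedModType R)
    (m : nat) (U : set E) (G : E -> seq E -> F) : Prop :=
  exists D : E -> seq E -> F,
    [/\ forall (x : E) (w : seq E), U x -> size w = m -> D x w = G x w,
        forall (k : nat) (x : E), (m <= k)%N -> U x ->
          bounded_multilinear k (D x)
      & forall (k : nat) (x : E) (e : R), (m <= k)%N -> U x -> 0 < e ->
          \forall y \near x, forall w : seq E, size w = k ->
            `|D y w - D x w - D x (y - x :: w)|
              <= e * `|y - x| * \prod_(v <- w) `|v|].

Definition smooth_on (R : realType) (E F : normedModType R)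
    (U : set E) (f : E -> F) : Prop :=
  smooth_multilinear_on 0 U (fun x _ => f x).

(* A tangent vector at p is a class of pairs (chart i around p, component in H),
   two pairs being identified when the derivative of the transition map sends
   one component to the other. The scalar product on the tangent space at p is
   given on representatives: rm_metric i p u v is the product of the vectors
   with components u and v in the chart i, and rm_metric_transition says that
   it depends only on the classes. Values of rm_chart i, rm_param i and
   rm_metric i outside the domain of the chart i are irrelevant. *)
Record riemannian_manifold (R : realType) (H : completeNormedModType R) := {
  rm_space :> topologicalType;
  rm_hausdorff : hausdorff_space rm_space;
  rm_index : Type;
  rm_dom : rm_index -> set rm_space;
  rm_chart : rm_index -> rm_space -> H;
  rm_param : rm_index -> H -> rm_space;
  rm_cover : forall p, exists i, rm_dom i p;
  rm_dom_open : forall i, open (rm_dom i);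
  rm_image_open : forall i, open (rm_chart i @` rm_dom i);
  rm_chartK : forall i p, rm_dom i p -> rm_param i (rm_chart i p) = p;
  rm_chart_continuous : forall i p, rm_dom i p ->
    {for p, continuous (rm_chart i)};
  rm_param_continuous : forall i p, rm_dom i p ->
    {for rm_chart i p, continuous (rm_param i)};
  rm_transition_smooth : forall i j,
    smooth_on (rm_chart i @` (rm_dom i `&` rm_dom j))
      (rm_chart j \o rm_param i);
  rm_metric : rm_index -> rm_space -> {dot H for idfun};
  rm_metric_transition : forall i j p (u v : H), rm_dom i p -> rm_dom j p ->
    rm_metric j p ('d (rm_chart j \o rm_param i) (rm_chart i p) u)
                  ('d (rm_chart j \o rm_param i) (rm_chart i p) v)
    = rm_metric i p u v;
  rm_metric_equivalent : forall i p, rm_dom i p ->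
    exists c C : R, 0 < c /\ forall u : H,
      c * `|u| ^+ 2 <= rm_metric i p u u <= C * `|u| ^+ 2;
  rm_metric_smooth : forall i,
    @smooth_multilinear_on R H R^o 2 (rm_chart i @` rm_dom i)
      (fun x w => rm_metric i (rm_param i x) w`_0 w`_1)
}.

Section Manifold.
Context (R : realType) (H : completeNormedModType R)
  (M : riemannian_manifold H).

Definition local_metric (i : rm_index M) (v w : H) (x : H) : R :=
  rm_metric i (rm_param i x) v w.

(* z is the Christoffel symbol Gamma_x(u, v) of the Levi-Civita connection in
   the chart i (Koszul formula for constant local vector fields); it is unique
   since the metric is nondegenerate. *)
Definition is_christoffel (i : rm_index M) (x u v z : H) : Prop :=
  forall w : H, local_metric i z w x =
    2^-1 * ('D_u (local_metric i v w) x + 'D_v (local_metric i u w) x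
            - 'D_w (local_metric i u v) x).

(* Geodesics parameterized by arc length. The interval I need not be open: as
   usual, smoothness at an end point is that of an extension to a
   neighbourhood, here given by the values of sigma outside I. The geodesic
   equation is c'' + Gamma_c(c', c') = 0 for the local expression c. *)
Definition unit_geodesic (I : set R) (sigma : R -> M) : Prop :=
  forall t : R, I t -> exists (i : rm_index M) (J : set R),
    let c : R -> H := rm_chart i \o sigma in
    let c' : R -> H := derive1 c in
    [/\ open J, J t, (forall s, J s -> rm_dom i (sigma s)),
        @smooth_on R R^o H J c
      & forall s, J s ->
          is_christoffel i (c s) (c' s) (c' s) (- derive1 c' s) /\
          local_metric i (c' s) (c' s) (c s) = 1].

Definition geodesically_convex (f : M -> R) : Prop :=
  forall (I : set R) (sigma : R -> M), is_interval I ->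
    unit_geodesic I sigma ->
    @convex_function R R^o I (f \o sigma).

Definition locally_bounded (f : M -> R) : Prop :=
  forall p : M, bounded_near f (nbhs p).

Definition frechet_differentiable_at (f : M -> R) (p : M) : Prop :=
  forall i : rm_index M, rm_dom i p ->
    differentiable (f \o rm_param i : H -> R^o) (rm_chart i p).

End Manifold.

(* The index set K of the covering family is a part of nat so that finite, and
   in particular empty, coverings are allowed: for n = 0 every box has
   volume 1. *)
Definition lebesgue_null (R : realType) (n : nat) (A : set 'rV[R]_n) : Prop :=
  forall e : R, 0 < e ->
    exists (K : pred nat) (a b : nat -> 'rV[R]_n),
      [/\ forall k j, a k 0 j <= b k 0 j,
          A `<=` \bigcup_(k in [set k | K k])
                   [set x | forall j, a k 0 j <= x 0 j <= b k 0 j]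
        & (\sum_(0 <= k <oo | K k) (\prod_(j < n) (b k 0 j - a k 0 j))%:E
             <= e%:E)%E].

(* L identifies R^n with the model space H. *)
Definition measure_zero (R : realType) (H : completeNormedModType R)
    (M : riemannian_manifold H) (n : nat) (L : {linear 'rV[R]_n -> H})
    (A : set M) : Prop :=
  forall i : rm_index M,
    lebesgue_null (L @^-1` (rm_chart i @` (rm_dom i `&` A))).

(* Main.v *)
Require Import Defs.
From HB Require Import structures.
From mathcomp Require Import all_boot all_order all_algebra.
From mathcomp Require Import sesquilinear.
From mathcomp Require Import all_classical all_reals all_analysis.
From mathcomp Require Import ring lra.

Set Implicit Arguments.
Unset Strict Implicit.
Unset Printing Implicit Defensive.

Import Order.TTheory GRing.Theory Num.Theory.
Import numFieldNormedType.Exports.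

Local Open Scope classical_set_scope.
Local Open Scope ring_scope.

(* In a chart, a geodesic from x to y is obtained as the solution of a boundary
   value problem, by a fixed point argument; it stays within O(|y - x|^2) of the
   segment. Convexity along these geodesics and local boundedness make f locally
   Lipschitz in the chart, and then semiconvex: h = f + C |.|^2 is convex and
   Lipschitz on small balls. For such an h, Frechet differentiability at x
   follows from h(x + v) + h(x - v) - 2 h(x) <= e d on a ball |v| <= d, with d
   depending on e. The points where this holds for a given e contain a dense
   open set, because at an almost maximizer of h - lambda |. - x1|^2 the second
   difference is at most 2 lambda |v|^2 up to a small error; Baire's theorem
   gives density. In R^n it is enough to consider v along the coordinate axes,
   since the second difference of a convex function is convex; the points with
   a kink along the j-th axis are covered by countably many sets on which x_j is
   a Lipschitz function of the other coordinates. Differentiability does not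
   depend on the chart, the transition maps being smooth. *)

(** * Linear identities *)

Section Lmod.
Context (R : pzRingType) (V : lmodType R).

Inductive lexpr : Type :=
  | LVar of nat | LZero | LAdd of lexpr & lexpr | LOpp of lexpr | LScale of R & lexpr.

Fixpoint leval (vs : seq V) (e : lexpr) : V :=
  match e with
  | LVar i => vs`_i
  | LZero => 0
  | LAdd a b => leval vs a + leval vs b
  | LOpp a => - leval vs a
  | LScale k a => k *: leval vs a
  end.

Fixpoint lcoef (e : lexpr) (i : nat) : R :=
  match e with
  | LVar j => if eqn i j then 1 else 0
  | LZero => 0
  | LAdd a b => lcoef a i + lcoef b i
  | LOpp a => - lcoef a i
  | LScale k a => k * lcoef a i
  end.

Lemma leval_coef (vs : seq V) (e : lexpr) :
  leval vs e = \sum_(i < size vs) lcoef e i *: vs`_i.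
Proof.
elim: e => [j| |a IHa b IHb|a IHa|k a IHa] /=.
- have [jn|nj] := ltnP j (size vs).
    rewrite (bigD1 (Ordinal jn)) //= eqnE eqxx scale1r big1 ?addr0 // => i ij.
    rewrite ifN ?scale0r //; by move: ij; rewrite -val_eqE /= -eqnE.
  rewrite nth_default // big1 // => i _.
  by rewrite (_ : eqn i j = false) ?scale0r // eqnE ltn_eqF // (leq_trans (ltn_ord i)).
- by rewrite big1 // => i _; rewrite scale0r.
- by rewrite IHa IHb -big_split /=; apply: eq_bigr => i _; rewrite scalerDl.
- by rewrite IHa -sumrN; apply: eq_bigr => i _; rewrite scaleNr.
- by rewrite IHa scaler_sumr; apply: eq_bigr => i _; rewrite scalerA.
Qed.

Fixpoint lcoef_eq (n : nat) (a b : lexpr) : Prop :=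
  if n is m.+1 then lcoef a m = lcoef b m /\ lcoef_eq m a b else True.

Lemma leval_eq (vs : seq V) (a b : lexpr) :
  lcoef_eq (size vs) a b -> leval vs a = leval vs b.
Proof.
move=> ab; rewrite !leval_coef; apply: eq_bigr => -[i /= ilt] _; congr (_ *: _).
elim: (size vs) ab ilt => //= n IH [en /IH{}IH].
by rewrite ltnS leq_eqVlt => /orP[/eqP->//|/IH].
Qed.

End Lmod.

Ltac lmod_index x vs :=
  lazymatch vs with
  | cons x _ => constr:(O)
  | cons _ ?t => let n := lmod_index x t in constr:(S n)
  end.

Ltac lmod_mem x vs :=
  lazymatch vs with
  | nil => constr:(false)
  | cons x _ => constr:(true)
  | cons _ ?t => lmod_mem x t
  end.

Ltac lmod_vars t vs :=
  lazymatch t with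
  | Algebra.add ?a ?b => let v := lmod_vars a vs in lmod_vars b v
  | Algebra.opp ?a => lmod_vars a vs
  | GRing.scale _ ?a => lmod_vars a vs
  | Algebra.zero => vs
  | _ => lazymatch lmod_mem t vs with
         | true => vs
         | false => constr:(cons t vs)
         end
  end.

Ltac lmod_reify R t vs :=
  lazymatch t with
  | Algebra.add ?a ?b =>
      let x := lmod_reify R a vs in let y := lmod_reify R b vs in
      constr:(@LAdd R x y)
  | Algebra.opp ?a => let x := lmod_reify R a vs in constr:(@LOpp R x)
  | GRing.scale ?k ?a => let x := lmod_reify R a vs in constr:(@LScale R k x)
  | Algebra.zero => constr:(@LZero R)
  | _ => let n := lmod_index t vs in constr:(@LVar R n)
  end.

(* Reduces an equality of linear combinations to the equalities, in [R], of the
   coefficients of each atom. *)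
Ltac lmodule R :=
  lazymatch goal with
  | |- @eq ?T ?a ?b =>
      let vs := lmod_vars a (@nil T) in
      let vs := lmod_vars b vs in
      let x := lmod_reify R a vs in
      let y := lmod_reify R b vs in
      refine (@leval_eq R _ vs x y _);
      cbn [size lcoef_eq lcoef eqn];
      repeat (split; [| try exact I])
  end.

(** * Hilbert spaces *)

Lemma le_of_eq (R : realType) (x y : R) : x = y -> x <= y.
Proof. by move=> ->. Qed.

Lemma cauchy_norm_cvg (R : realType) (H : completeNormedModType R)
    (u : nat -> H) :
  (forall e : R, 0 < e -> exists N, forall m n,
     (N <= m)%N -> (N <= n)%N -> `|u m - u n| <= e) ->
  exists l, forall e : R, 0 < e -> exists N, forall n,
     (N <= n)%N -> `|u n - l| <= e.
Proof.
move=> uC; have : cvg (u @ \oo).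
  apply: cauchy_cvg; apply/cauchy_ballP => e e0.
  have [N uN] := uC (e / 2) (divr_gt0 e0 (ltr0n _ 2)).
  exists (u @` [set n | (N <= n)%N], u @` [set n | (N <= n)%N]) => /=.
    by split; exists N => // n Nn; exists n.
  move=> [_ _] [/= [m Nm <-] [n Nn <-]]; rewrite -ball_normE /=.
  by rewrite (le_lt_trans (uN _ _ Nm Nn)) // ltr_pdivrMr // ltr_pMr // ltr1n.
move=> /cvg_ex[l /cvgrPdist_le ul]; exists l => e e0.
have [N _ uN] := ul e e0; exists N => n Nn.
by rewrite distrC; apply: uN.
Qed.

Lemma geometric_cvg (R : realType) (H : completeNormedModType R)
    (u : nat -> H) (K : R) :
  (forall n, `|u n.+1 - u n| <= K * 2^-1 ^+ n) ->
  exists l, forall n, `|u n - l| <= K * 2 * 2^-1 ^+ n.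
Proof.
move=> uK.
have K0 : 0 <= K by have := le_trans (normr_ge0 _) (uK 0%N); rewrite expr0 mulr1.
have uT m n : `|u (n + m)%N - u n| <= K * 2 * 2^-1 ^+ n.
  suff : `|u (n + m)%N - u n| <= K * 2 * 2^-1 ^+ n * (1 - 2^-1 ^+ m).
    move=> /le_trans; apply; apply: ler_piMr.
      by rewrite !mulr_ge0 ?exprn_ge0.
    by rewrite lerBlDr lerDl exprn_ge0.
  elim: m => [|m IH]; first by rewrite addn0 subrr normr0 expr0 subrr mulr0.
  rewrite addnS (_ : _ - _ = (u (n + m).+1 - u (n + m)%N) + (u (n + m)%N - u n));
    last by rewrite subrKA.
  apply: (le_trans (ler_normD _ _)); apply: (le_trans (lerD (uK _) IH)).
  rewrite exprD exprS le_eqVlt; apply/orP; left; apply/eqP; by field.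
have [l ul] : exists l, forall e : R, 0 < e -> exists N, forall n,
     (N <= n)%N -> `|u n - l| <= e.
  apply: cauchy_norm_cvg => e e0.
  have : 2^-1 ^+ n @[n --> \oo] --> (0 : R).
    by apply: cvg_expr; rewrite ger0_norm // invf_lt1 // ltr1n.
  have e'0 : 0 < e / (4 * K + 1) by rewrite divr_gt0 // ltr_wpDl // mulr_ge0.
  move=> /cvgrPdist_le /(_ _ e'0)[N _ HN].
  have {}HN : 2^-1 ^+ N <= e / (4 * K + 1).
    by have := HN N (leqnn N); rewrite sub0r normrN ger0_norm // exprn_ge0.
  exists N => m n Nm Nn.
  rewrite -(subnKC Nm) -(subnKC Nn).
  set a := u _; set b := u _.
  rewrite (_ : a - b = (a - u N) - (b - u N)); last by lmodule R; ring.
  apply: (le_trans (ler_normB _ _)); apply: (le_trans (lerD (uT _ _) (uT _ _))).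
  move: HN; rewrite ler_pdivlMr ?ltr_wpDl ?mulr_ge0 // => HN.
  have : 0 <= 2^-1 ^+ N :> R by rewrite exprn_ge0.
  by nra.
exists l => n; apply/ler_addgt0Pl => e e0.
have [N uN] := ul e e0.
rewrite (_ : _ - l = (u (n + N)%N - l) - (u (n + N)%N - u n)); last first.
  by lmodule R; ring.
apply: (le_trans (ler_normB _ _)); apply: lerD (uT _ _).
by apply: uN; exact: leq_addl.
Qed.

Section ScalarProduct.
Context (R : realType).

Definition scalar_product (E : lmodType R) (b : E -> E -> R) : Prop :=
  (forall a u v w, b (a *: u + v) w = a * b u w + b v w) /\
  (forall u v, b u v = b v u).

Section Algebra.
Context (E : lmodType R) (b : E -> E -> R) (hb : scalar_product b).

Lemma sp_sym u v : b u v = b v u. Proof. exact: hb.2. Qed.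

Lemma spDl u v w : b (u + v) w = b u w + b v w.
Proof. by rewrite -[u]scale1r hb.1 mul1r scale1r. Qed.

Lemma sp0l w : b 0 w = 0.
Proof. by apply: (addrI (b 0 w)); rewrite addr0 -spDl addr0. Qed.

Lemma spZl a u w : b (a *: u) w = a * b u w.
Proof. by rewrite -[a *: u]addr0 hb.1 sp0l addr0. Qed.

Lemma spNl u w : b (- u) w = - b u w.
Proof. by rewrite -scaleN1r spZl mulN1r. Qed.

Lemma spDr w u v : b w (u + v) = b w u + b w v.
Proof. by rewrite sp_sym spDl !(sp_sym w). Qed.

Lemma sp0r w : b w 0 = 0. Proof. by rewrite sp_sym sp0l. Qed.

Lemma spZr a w u : b w (a *: u) = a * b w u.
Proof. by rewrite sp_sym spZl (sp_sym w). Qed.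

Lemma spNr w u : b w (- u) = - b w u.
Proof. by rewrite sp_sym spNl (sp_sym w). Qed.

Definition spE := (spDl, spDr, spZl, spZr, spNl, spNr, sp0l, sp0r).

End Algebra.

Lemma dot_scalar_product (E : lmodType R) (dot : {dot E for idfun}) :
  scalar_product dot.
Proof.
have dsym u v : dot u v = dot v u.
  by rewrite hermitian_subproof expr0 mul1r.
split=> // a u v w.
by rewrite dsym linearPr /= !(dsym w).
Qed.

Lemma sp_bound (E : normedModType R) (b : E -> E -> R) (C : R) :
  scalar_product b -> (forall u, 0 <= b u u <= C * `|u| ^+ 2) ->
  forall u v, `|b u v| <= C * `|u| * `|v|.
Proof.
move=> hb bC.
have b1 u v : 0 <= C -> `|u| <= 1 -> `|v| <= 1 -> `|b u v| <= C.
  move=> C0 u1 v1.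
  have [p1 p2] := andP (bC (u + v)); have [m1 m2] := andP (bC (u - v)).
  have n1 : `|u + v| ^+ 2 <= 4.
    have : `|u + v| <= 2 by apply: (le_trans (ler_normD _ _)); lra.
    have := normr_ge0 (u + v); nra.
  have n2 : `|u - v| ^+ 2 <= 4.
    have : `|u - v| <= 2 by apply: (le_trans (ler_normB _ _)); lra.
    have := normr_ge0 (u - v); nra.
  have s1 := sqr_ge0 (`|u + v|); have s2 := sqr_ge0 (`|u - v|).
  move: p1 p2 m1 m2; rewrite !(spE hb) (sp_sym hb v u) => p1 p2 m1 m2.
  have := ler_wpM2l C0 n1; have := ler_wpM2l C0 n2.
  by rewrite ler_norml => *; apply/andP; split; lra.
move=> u v.
have [->|u0] := eqVneq u 0; first by rewrite (sp0l hb) !normr0 mulr0 mul0r.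
have [->|v0] := eqVneq v 0; first by rewrite (sp0r hb) !normr0 mulr0.
have nu : 0 < `|u| by rewrite normr_gt0.
have nv : 0 < `|v| by rewrite normr_gt0.
have C0 : 0 <= C.
  have /andP[h1 h2] := bC u; have := le_trans h1 h2.
  by rewrite pmulr_lge0 // exprn_gt0.
have := b1 (`|u|^-1 *: u) (`|v|^-1 *: v) C0.
rewrite !normrZ !normfV !normr_id !mulVf ?gt_eqF // => /(_ (lexx _) (lexx _)).
rewrite (spZl hb) (spZr hb) !normrM !normfV !normr_id.
by rewrite !ler_pdivrMl // (_ : C * _ * _ = `|v| * (`|u| * C)) //; ring.
Qed.

(* The minimizing sequences of [b u u - 2 phi u] are Cauchy by the
   parallelogram identity. *)
Lemma lax_milgram (H : completeNormedModType R) (b : H -> H -> R) (c C K : R)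
    (phi : H -> R) :
  scalar_product b -> 0 < c -> (forall u, c * `|u| ^+ 2 <= b u u) ->
  (forall u v, `|b u v| <= C * `|u| * `|v|) ->
  (forall a u v, phi (a *: u + v) = a * phi u + phi v) ->
  (forall u, `|phi u| <= K * `|u|) ->
  exists z, forall w, b z w = phi w.
Proof.
move=> hb c0 bc bC phiL phiK.
have phi0 : phi 0 = 0.
  by have := phiL 1 0 0; rewrite scaler0 addr0 mul1r => h; lra.
have phiZ a u : phi (a *: u) = a * phi u by have := phiL a u 0; rewrite phi0 !addr0.
have phiD u v : phi (u + v) = phi u + phi v.
  by have := phiL 1 u v; rewrite scale1r mul1r.
pose J u := b u u - 2 * phi u.
have Jlb u : - (K ^+ 2 / c) <= J u.
  have := bc u; have := phiK u; rewrite ler_norml => /andP[_ h] h2.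
  rewrite lerNl ler_pdivlMr // /J.
  have : 0 <= (c * `|u| - K) ^+ 2 by exact: sqr_ge0.
  by nra.
pose S := [set J u | u in [set: H]].
have hS : has_inf S.
  split; first by exists (J 0), 0.
  by exists (- (K ^+ 2 / c)) => _ [u _ <-].
pose m := inf S.
have mJ u : m <= J u by apply: ge_inf; [exact: hS.2|exists u].
have Sinv0 n : 0 < n.+1%:R^-1 :> R by rewrite invr_gt0 ltr0n.
have /choice[u uP] : forall n : nat, exists u, J u < m + n.+1%:R^-1.
  by move=> n; have [_ [u _ <-] ?] := inf_adherent (Sinv0 n) hS; exists u.
have par x y : c / 2 * `|x - y| ^+ 2 <= J x + J y - 2 * m.
  have h := mJ (2^-1 *: (x + y)); have h2 := bc (x - y).
  move: h h2; rewrite /J !(spE hb) phiZ phiD (sp_sym hb y x) => h h2.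
  by lra.
have uC (e : R) : 0 < e -> exists N, forall m n, (N <= m)%N -> (N <= n)%N -> `|u m - u n| <= e.
  move=> e0.
  have d0 : 0 < c * e ^+ 2 / 4 by rewrite divr_gt0 // mulr_gt0 // exprn_gt0.
  have [N _ HN] := near_infty_natSinv_lt (PosNum d0).
  exists N => k l Nk Nl; have := par (u k) (u l).
  have := uP k; have := uP l; have /= := HN _ Nk; have /= := HN _ Nl.
  move: (k.+1%:R^-1) (l.+1%:R^-1) => p q h1 h2 h3 h4 h5.
  have : c * `|u k - u l| ^+ 2 <= c * e ^+ 2 by lra.
  by rewrite ler_pM2l // ler_pXn2r // ?nnegrE ?normr_ge0 ?ltW.
have [z uz] := cauchy_norm_cvg uC.
exists z => w.
have key t : 0 <= t ^+ 2 * b w w + 2 * t * (b z w - phi w).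
  apply/ler_addgt0Pl => e e0; move: (e : R) e0 => {}e e0.
  pose B := 2 * `|t| * (C * `|w|).
  have [C0|C0] := lerP 0 (C * `|w|); last first.
    have w0 : w != 0 by apply: contraTneq C0 => ->; rewrite normr0 mulr0 ltxx.
    have := le_trans (normr_ge0 _) (bC w w).
    by rewrite pmulr_lge0 ?normr_gt0 // leNgt C0.
  have B0 : 0 <= B by rewrite /B; apply: mulr_ge0 => //; exact: mulr_ge0.
  have d0 : 0 < e / 2 / (B + 1) by rewrite !divr_gt0 // ltr_wpDl.
  have [N1 HN1] := uz _ d0.
  have e20 : 0 < e / 2 by rewrite divr_gt0.
  have [N2 _ HN2] := near_infty_natSinv_lt (PosNum e20).
  pose N := maxn N1 N2.
  have h1 := HN1 N (leq_maxl _ _); have /= h2 := HN2 N (leq_maxr _ _).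
  have h3 := mJ (u N + t *: w); have h4 := uP N.
  have h5 := bC (u N - z) w.
  have h6 : `|2 * t * b (u N - z) w| <= e / 2.
    rewrite !normrM (ger0_norm (_ : 0 <= 2)) //.
    move: h1; rewrite ler_pdivlMr ?ltr_wpDl // => h1.
    apply: le_trans h1; rewrite mulrDr mulr1.
    apply: (@le_trans _ _ (2 * `|t| * (C * `|u N - z| * `|w|))).
      by rewrite ler_wpM2l // mulr_ge0.
    by rewrite /B; have := normr_ge0 (u N - z); lra.
  move: h6; rewrite ler_norml => /andP[_ h6].
  move: (N.+1%:R^-1) h2 (h4) => q h2 {}h4.
  move: h3 h4 h6; rewrite /J !(spE hb) phiD phiZ (sp_sym hb w (u N)) => h3 h4 h6.
  by lra.
apply/eqP; rewrite -subr_eq0; apply/eqP; set D := b z w - phi w in key *.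
have [B0|B0] := lerP (b w w) 0.
  have := key 1; have := key (-1); nra.
have := key (- D / b w w).
have : (- D / b w w) ^+ 2 * b w w + 2 * (- D / b w w) * D = - (D ^+ 2 / b w w).
  by field; rewrite gt_eqF.
move=> ->; rewrite oppr_ge0 => h.
have : D ^+ 2 <= 0 by move: h; rewrite pmulr_lle0 // invr_gt0.
by move=> ?; apply/eqP; rewrite -sqrf_eq0 eq_le sqr_ge0 andbT.
Qed.

End ScalarProduct.

(** * Curves *)

Section Deriv.
Context (R : realType).

Definition has_deriv (E : normedModType R) (c : R -> E) (t : R) (d : E) : Prop :=
  forall e : R, 0 < e ->
    \forall s \near t, `|c s - c t - (s - t) *: d| <= e * `|s - t|.

Section Rules.
Context (E : normedModType R).
Implicit Types (c : R -> E) (t : R) (d : E).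

Lemma near_lt_dist t (e : R) : 0 < e -> \forall s \near t, `|s - t| < e.
Proof.
by move=> e0; apply/nbhs_ballP; exists e => //= s; rewrite -ball_normE /= distrC.
Qed.

Lemma has_deriv_ext c c' t d :
  (\forall s \near t, c s = c' s) -> has_deriv c t d -> has_deriv c' t d.
Proof.
move=> cc' ct e e0; have ctt := nbhs_singleton cc'.
by near=> s; rewrite -ctt -(near cc' s) //; near: s; exact: ct.
Unshelve. all: by end_near. Qed.

Lemma has_deriv_cst (x : E) t : has_deriv (fun=> x) t 0.
Proof.
move=> e e0; near=> s; rewrite subrr scaler0 subrr normr0.
by rewrite mulr_ge0 // ltW.
Unshelve. all: by end_near. Qed.

Lemma has_deriv_affine (x p : E) t : has_deriv (fun s => x + s *: p) t p.
Proof.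
move=> e e0; near=> s; rewrite (_ : _ - _ = 0); last by lmodule R; ring.
by rewrite normr0 mulr_ge0 // ltW.
Unshelve. all: by end_near. Qed.

Lemma has_derivD c c' t d d' : has_deriv c t d -> has_deriv c' t d' ->
  has_deriv (fun s => c s + c' s) t (d + d').
Proof.
move=> ct ct' e e0; near=> s.
rewrite (_ : _ - _ = (c s - c t - (s - t) *: d) + (c' s - c' t - (s - t) *: d'));
  last by lmodule R; ring.
apply: (le_trans (ler_normD _ _)).
rewrite [e]splitr mulrDl; apply: lerD.
  by near: s; apply: ct; rewrite divr_gt0.
by near: s; apply: ct'; rewrite divr_gt0.
Unshelve. all: by end_near. Qed.

Lemma has_deriv_blin (F : normedModType R) (l : E -> F) (K : R) c t d :
  (forall a u v, l (a *: u + v) = a *: l u + l v) ->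
  (forall u, `|l u| <= K * `|u|) ->
  has_deriv c t d -> has_deriv (l \o c) t (l d).
Proof.
move=> lL lK ct e e0.
have lB u v a w : l u - l v - a *: l w = l (u - v - a *: w).
  rewrite (_ : u - v - a *: w = (- a) *: w + ((-1) *: v + u)); last first.
    by lmodule R; ring.
  by rewrite !lL; lmodule R; ring.
near=> s; rewrite /= lB; apply: (le_trans (lK _)).
have h : `|c s - c t - (s - t) *: d| <= e / (`|K| + 1) * `|s - t|.
  by near: s; apply: ct; rewrite divr_gt0 // ltr_wpDl.
apply: (@le_trans _ _ (`|K| * `|c s - c t - (s - t) *: d|)).
  by rewrite ler_wpM2r // ler_norm.
apply: (@le_trans _ _ ((`|K| + 1) * `|c s - c t - (s - t) *: d|)).
  by rewrite ler_wpM2r // lerDl.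
by rewrite -ler_pdivlMl ?ltr_wpDl // mulrA [_^-1 * _]mulrC.
Unshelve. all: by end_near. Qed.

Lemma has_derivZ (a : R) c t d : has_deriv c t d ->
  has_deriv (fun s => a *: c s) t (a *: d).
Proof.
move=> ct e e0; near=> s.
rewrite (_ : _ - _ = a *: (c s - c t - (s - t) *: d)); last by lmodule R; ring.
have h : `|c s - c t - (s - t) *: d| <= e / (`|a| + 1) * `|s - t|.
  by near: s; apply: ct; rewrite divr_gt0 // ltr_wpDl.
rewrite normrZ.
apply: (@le_trans _ _ ((`|a| + 1) * `|c s - c t - (s - t) *: d|)).
  by rewrite ler_wpM2r // lerDl.
by rewrite -ler_pdivlMl ?ltr_wpDl // mulrA [_^-1 * _]mulrC.
Unshelve. all: by end_near. Qed.

Lemma has_derivN c t d : has_deriv c t d -> has_deriv (fun s => - c s) t (- d).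
Proof.
move=> /(@has_derivZ (-1)); rewrite scaleN1r; apply: has_deriv_ext.
by near=> s; rewrite scaleN1r.
Unshelve. all: by end_near. Qed.

Lemma has_derivB c c' t d d' : has_deriv c t d -> has_deriv c' t d' ->
  has_deriv (fun s => c s - c' s) t (d - d').
Proof. by move=> ct /has_derivN; exact: has_derivD. Qed.

Lemma has_deriv_rescale (k : R) c t d : has_deriv c (k * t) d ->
  has_deriv (fun s => c (k * s)) t (k *: d).
Proof.
move=> ct e e0.
have k1 : 0 < `|k| + 1 by rewrite ltr_wpDl.
have /ct/nbhs_ballP[r /= r0 H] : 0 < e / (`|k| + 1) by rewrite divr_gt0.
near=> s.
rewrite (_ : _ - _ = c (k * s) - c (k * t) - (k * s - k * t) *: d); last first.
  by lmodule R; ring.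
have ks : `|k * s - k * t| <= (`|k| + 1) * `|s - t|.
  by rewrite -mulrBr normrM ler_wpM2r // lerDl.
apply: (le_trans (H _ _)); last first.
  by rewrite -mulrA ler_pM2l // ler_pdivrMl.
rewrite -ball_normE /= distrC (le_lt_trans ks) // -ltr_pdivlMl //.
by near: s; apply: near_lt_dist; rewrite mulr_gt0 // invr_gt0.
Unshelve. all: by end_near. Qed.

Lemma has_deriv_lip c t d : has_deriv c t d ->
  \forall s \near t, `|c s - c t| <= (`|d| + 1) * `|s - t|.
Proof.
move=> ct; near=> s.
rewrite (_ : _ - _ = (c s - c t - (s - t) *: d) + (s - t) *: d); last first.
  by lmodule R; ring.
apply: (le_trans (ler_normD _ _)); rewrite addrC mulrDl mul1r normrZ mulrC.
by rewrite lerD2l -[leRHS]mul1r; near: s; exact: ct.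
Unshelve. all: by end_near. Qed.

Lemma has_deriv_cvg c t d : has_deriv c t d ->
  forall e : R, 0 < e -> \forall s \near t, `|c s - c t| <= e.
Proof.
move=> ct e e0; near=> s.
have d1 : 0 < `|d| + 1 by rewrite ltr_wpDl.
apply: (@le_trans _ _ ((`|d| + 1) * `|s - t|)).
  by near: s; exact: has_deriv_lip.
rewrite -ler_pdivlMl // ltW //.
by near: s; apply: near_lt_dist; rewrite mulr_gt0 // invr_gt0.
Unshelve. all: by end_near. Qed.

Lemma has_derivP c t d : has_deriv c t d <-> is_derive t 1 c d.
Proof.
split=> [ct|[dct dE]].
  have cvd : (fun h : R => h^-1 *: ((c \o shift t) (h *: 1) - c t)) @ 0^' --> d.
    apply/cvgrPdist_le => e e0.
    have /nbhs_ballP[r /= r0 H] := ct e e0.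
    near=> h.
    have h0 : h != 0 by near: h; exact: nbhs_dnbhs_neq.
    have hr : `|h| < r by near: h; exact: dnbhs0_lt.
    have := H (h + t); rewrite -ball_normE /= distrC addrK => /(_ hr).
    rewrite mulrC -ler_pdivrMl ?normr_gt0 //; apply: le_trans.
    rewrite -normfV -normrZ -normrN.
    rewrite (_ : c (h%:A + t) = c (h + t)); last first.
      by rewrite /= [h%:A]mulr1.
    apply/le_of_eq; by congr (`|_|); lmodule R; field.
  split; first by apply/cvg_ex; exists d.
  exact/cvg_lim.
move=> e e0; move: dct; rewrite /derivable => /cvgrPdist_le /(_ e e0).
rewrite -/(derive c t 1) dE => /nbhs_ballP[r /= r0 H].
near=> s.
have [->|st] := eqVneq s t; first by rewrite !subrr scale0r subrr !normr0 mulr0.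
have st0 : s - t != 0 by rewrite subr_eq0.
have := H (s - t); rewrite -ball_normE /= sub0r normrN.
have h1 : `|s - t| < r by near: s; exact: near_lt_dist.
move=> /(_ h1 st0); rewrite [(s - t) *: 1]mulr1 subrK => h2.
rewrite mulrC -ler_pdivrMl ?normr_gt0 //; apply: le_trans h2.
rewrite -normfV -normrZ -normrN; apply/le_of_eq.
by congr (`|_|); lmodule R; field.
Unshelve. all: by end_near. Qed.

Lemma has_deriv1 c t d : has_deriv c t d -> derive1 c t = d.
Proof. by move=> /has_derivP[_ <-]; rewrite derive1E. Qed.

End Rules.

(* The mean value theorem for the pairing of [c] with [c t - c s]. *)
Lemma mean_value (H : normedModType R) (dot : H -> H -> R)
    (c c' : R -> H) (a b K : R) :
  scalar_product dot -> (forall u, `|u| ^+ 2 = dot u u) ->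
  (forall s, a <= s <= b -> has_deriv c s (c' s)) ->
  (forall s, a <= s <= b -> `|c' s| <= K) ->
  forall s t, a <= s <= b -> a <= t <= b -> `|c t - c s| <= K * `|t - s|.
Proof.
move=> hdot hn cd cK.
have dotC u v : `|dot u v| <= `|u| * `|v|.
  rewrite -[`|u|]mul1r; apply: (sp_bound hdot) => w.
  by rewrite mul1r -hn sqr_ge0 lexx.
suff W s t : a <= s <= b -> a <= t <= b -> s < t -> `|c t - c s| <= K * `|t - s|.
  move=> s t sab tab; have [st|ts|->] := ltgtP s t.
  - exact: W.
  - by rewrite distrC [X in _ * X]distrC; exact: W.
  - by rewrite !subrr !normr0 mulr0.
move=> /andP[as_ _] /andP[_ tb] st.
set w := c t - c s.
have inab x : s <= x <= t -> a <= x <= b.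
  by move=> /andP[sx xt]; rewrite (le_trans as_ sx) (le_trans xt tb).
have phid x : s <= x <= t -> has_deriv (fun x => dot (c x) w : R^o) x (dot (c' x) w).
  move=> xst; apply: (@has_deriv_blin _ _ (fun u => dot u w : R^o) `|w|).
  - by move=> *; rewrite hdot.1.
  - by move=> u; rewrite mulrC; exact: dotC.
  - exact/cd/inab.
have [||x xst E] := @MVT _ (fun x => dot (c x) w) (fun x => dot (c' x) w) s t st.
- by move=> x; rewrite in_itv /= => /andP[/ltW sx /ltW xt]; apply/has_derivP/phid/andP.
- apply: derivable_within_continuous => x; rewrite in_itv /= => xst.
  by have /has_derivP[] := phid x xst.
have [->|w0] := eqVneq w 0.
  rewrite normr0 mulr_ge0 //; apply: le_trans (cK s _) => //.
  by apply: inab; rewrite lexx ltW.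
have wp : 0 < `|w| by rewrite normr_gt0.
rewrite -(ler_pM2r wp) -expr2 hn -[X in dot X _]/(c t - c s) (spDl hdot) (spNl hdot) E.
rewrite (ger0_norm (_ : 0 <= t - s)) ?subr_ge0 ?(ltW st) // mulrAC.
rewrite ler_wpM2r ?subr_ge0 ?(ltW st) //.
apply: (le_trans (ler_norm _)); apply: (le_trans (dotC _ _)).
rewrite ler_wpM2r // cK // inab //.
by move: xst; rewrite in_itv /= => /andP[/ltW-> /ltW->].
Qed.

Lemma mean_value_real (f f' : R -> R) (a b K : R) :
  (forall s, a <= s <= b -> has_deriv (f : R -> R^o) s (f' s)) ->
  (forall s, a <= s <= b -> `|f' s| <= K) ->
  forall s t, a <= s <= b -> a <= t <= b -> `|f t - f s| <= K * `|t - s|.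
Proof.
apply: (@mean_value R^o (fun x y => x * y)).
  by split=> [k x y z|x y]; rewrite /GRing.scale /=; ring.
by move=> v; rewrite -normrX ger0_norm ?sqr_ge0 // expr2.
Qed.

Lemma deriv0_constant (f : R -> R) (a b : R) :
  (forall s, a <= s <= b -> has_deriv (f : R -> R^o) s 0) ->
  forall s t, a <= s <= b -> a <= t <= b -> f t = f s.
Proof.
move=> fd s t sab tab; apply/eqP; rewrite -subr_eq0 -normr_le0.
rewrite -[leRHS](mul0r `|t - s|).
by apply: (@mean_value_real f (fun=> 0) a b) => // x _; rewrite normr0.
Qed.

End Deriv.

Section Antiderivative.
Context (R : realType).

Lemma antiderivative_real (phi : R -> R) : continuous phi ->
  exists Phi : R -> R, Phi 0 = 0 /\ forall t, has_deriv (Phi : R -> R^o) t (phi t).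
Proof.
move=> cphi.
pose G (a t : R) : R := (\int[lebesgue_measure]_(x in `[a, t]) phi x)%R.
have Gd a t : a < t -> has_deriv (G a : R -> R^o) t (phi t).
  move=> at_.
  have [||||H1 H2] := @continuous_FTC1_closed R phi a t (t + 1).
  - by rewrite ltrDl.
  - apply: continuous_compact_integrable; first exact: segment_compact.
    exact: continuous_subspaceT.
  - exact: at_.
  - exact: cphi.
  have D : is_derive (t : R) (1 : R) (G a : R -> R^o) (phi t).
    apply: DeriveDef; first exact: H1.
    by rewrite -derive1E; exact: H2.
  exact: (proj2 (@has_derivP R R^o (G a) t (phi t)) D).
pose F (a t : R) : R := G a t - G a 0.
have Fd a t : a < t -> has_deriv (F a : R -> R^o) t (phi t).
  move=> /Gd h; rewrite -[phi t]subr0; apply: has_derivB h _; exact: has_deriv_cst.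
have FF a a' t : a < 0 -> a' < 0 -> a < t -> a' < t -> F a t = F a' t.
  move=> a0 a'0 at_ a't.
  pose m := Num.max a a'.
  have m0 : m < Num.min t 0 by rewrite lt_min !gt_max a0 a'0 at_ a't.
  pose l := Num.min t 0; pose u := Num.max t 0.
  have hd s : l <= s <= u -> has_deriv (fun t => F a t - F a' t : R^o) s 0.
    move=> /andP[ls _]; rewrite -[0](subrr (phi s)).
    by apply: has_derivB; apply: Fd; apply: lt_le_trans ls;
       apply: le_lt_trans m0; rewrite le_max lexx ?orbT.
  have := deriv0_constant hd (s := 0) (t := t).
  rewrite /F !subrr => /(_ _ _)/eqP; rewrite subr_eq0 => h; apply/eqP/h.
  - by rewrite ge_min le_max lexx !orbT.
  - by rewrite ge_min le_max lexx.
exists (fun t => F (- `|t| - 1) t); split; first by rewrite /F subrr.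
move=> t.
apply: (@has_deriv_ext _ _ (F (- `|t| - 2))); last first.
  by apply: Fd; have := ler_norm (- t); rewrite normrN; lra.
near=> s.
have st : `|s - t| < 1 by near: s; exact: near_lt_dist.
have h : `|s| <= `|t| + `|s - t|.
  by rewrite -[s in leLHS](subrK t) addrC; exact: ler_normD.
have := ler_norm (- s); rewrite normrN => h2.
have := normr_ge0 s; have := normr_ge0 t => t0 s0.
by apply: FF; lra.
Unshelve. all: by end_near. Qed.

Context (H : completeNormedModType R) (dot : H -> H -> R).
Hypotheses (hdot : scalar_product dot) (hn : forall u, `|u| ^+ 2 = dot u u).

Lemma dot_le u v : `|dot u v| <= `|u| * `|v|.
Proof.
rewrite -[`|u|]mul1r; apply: (sp_bound hdot) => w.
by rewrite mul1r -hn sqr_ge0 lexx.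
Qed.

Lemma riesz (K : R) (phi : H -> R) :
  (forall a u v, phi (a *: u + v) = a * phi u + phi v) ->
  (forall u, `|phi u| <= K * `|u|) ->
  exists z, forall w, dot z w = phi w.
Proof.
move=> h1 h2; apply: (@lax_milgram R H dot 1 1 K phi) => //.
- by move=> u; rewrite mul1r hn.
- by move=> u v; rewrite mul1r; exact: dot_le.
Qed.

Lemma norm_le_dot (z : H) (K : R) : 0 <= K ->
  (forall w, dot z w <= K * `|w|) -> `|z| <= K.
Proof.
move=> K0 h; have [->|z0] := eqVneq z 0; first by rewrite normr0.
have zp : 0 < `|z| by rewrite normr_gt0.
by rewrite -(ler_pM2r zp) -expr2 hn.
Qed.

Lemma antiderivative (phi : R -> H) : continuous phi ->
  exists Phi : R -> H, Phi 0 = 0 /\ forall t, has_deriv Phi t (phi t).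
Proof.
move=> cphi.
have dotx_le w (x : H) : `|dot x w| <= `|w| * `|x| by rewrite mulrC dot_le.
have cw w : continuous (fun t => dot (phi t) w : R).
  move=> t; apply/cvgrPdist_le => e e0.
  have /cvgrPdist_le/(_ (e / (`|w| + 1))) := cphi t.
  rewrite divr_gt0 ?ltr_wpDl // => /(_ isT); apply: filterS => s hs.
  rewrite -(spNl hdot) -(spDl hdot); apply: (le_trans (dotx_le _ _)).
  apply: (@le_trans _ _ ((`|w| + 1) * `|phi t - phi s|)).
    by rewrite ler_wpM2r // lerDl.
  by rewrite -ler_pdivlMl ?ltr_wpDl // mulrC.
have /choice[P PP] := fun w => antiderivative_real (cw w).
have PL t a u v : P (a *: u + v) t = a * P u t + P v t.
  pose D s := P (a *: u + v) s - (a * P u s + P v s) : R^o.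
  have hd s : Num.min 0 t <= s <= Num.max 0 t -> has_deriv D s 0.
    move=> _; rewrite -[0](subrr (dot (phi s) (a *: u + v))).
    apply: has_derivB; first exact: (PP _).2.
    rewrite (spDr hdot) (spZr hdot); apply: has_derivD; last exact: (PP _).2.
    exact: (has_derivZ a ((PP u).2 s)).
  have := deriv0_constant hd (s := 0) (t := t).
  rewrite /D !(PP _).1 mulr0 !addr0 subrr => h; apply/eqP; rewrite -subr_eq0; apply/eqP/h.
  - by rewrite ge_min le_max lexx.
  - by rewrite ge_min le_max lexx !orbT.
have bnd t0 t1 (K : R) x : 0 <= K ->
    (forall s, Num.min t0 t1 <= s <= Num.max t0 t1 -> `|phi s - x| <= K) ->
    forall w, `|P w t1 - P w t0 - (t1 - t0) * dot x w| <= K * `|t1 - t0| * `|w|.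
  move=> K0 hK w.
  pose D s := P w s - s * dot x w : R^o.
  have hd s : Num.min t0 t1 <= s <= Num.max t0 t1 ->
      has_deriv D s (dot (phi s) w - dot x w).
    move=> _; apply: has_derivB; first exact: (PP _).2.
    apply: (@has_deriv_ext _ _ (fun s => 0 + s *: (dot x w : R^o))).
      by near=> r; rewrite add0r.
    exact: has_deriv_affine.
  have := @mean_value_real R _ _ _ _ (K * `|w|) hd _ t0 t1.
  rewrite /D (_ : _ - _ - _ = P w t1 - P w t0 - (t1 - t0) * dot x w); last by ring.
  rewrite mulrAC; apply.
  - move=> s /hK h; rewrite -(spNl hdot) -(spDl hdot); apply: (le_trans (dot_le _ _)).
    by rewrite ler_wpM2r.
  - by rewrite ge_min le_max lexx.
  - by rewrite ge_min le_max lexx !orbT.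
have pb t : exists K, 0 <= K /\ forall s, Num.min 0 t <= s <= Num.max 0 t -> `|phi s - 0| <= K.
  have /compact_bounded[M [_ HM]] : compact (phi @` `[Num.min 0 t, Num.max 0 t]).
    apply: continuous_compact; first exact: continuous_subspaceT.
    exact: segment_compact.
  exists (`|M| + 1); split; first by rewrite addr_ge0.
  move=> s sI; rewrite subr0; apply: (HM (`|M| + 1)).
    by rewrite (le_lt_trans (ler_norm M)) // ltrDl.
  by exists s => //=; rewrite in_itv.
have /choice[Phi PhiP] : forall t, exists z, forall w, dot z w = P w t.
  move=> t; have [K [K0 hK]] := pb t.
  apply: (riesz (PL t)) => w; have := bnd 0 t K 0 K0 hK w.
  by rewrite (PP w).1 (sp0l hdot) mulr0 !subr0; exact.
exists Phi; split.
  apply/eqP; rewrite -normr_eq0 -sqrf_eq0 hn PhiP; apply/eqP; exact: (PP _).1.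
move=> t e e0.
have /cvgrPdist_le/(_ e e0)/nbhs_ballP[r /= r0 hr] := cphi t.
near=> s.
have st : `|s - t| < r by near: s; exact: near_lt_dist.
apply: norm_le_dot; first by rewrite mulr_ge0 // ltW.
move=> w; apply: (le_trans (ler_norm _)).
rewrite !(spE hdot) !PhiP; apply: (bnd t s) (ltW e0) _ w => x xts.
rewrite distrC; apply: hr; rewrite -ball_normE /= (le_lt_trans _ st) //.
move: xts; case: (leP t s) => ts /andP[h1 h2].
  by rewrite ler0_norm ?subr_le0 // ger0_norm ?subr_ge0 //; lra.
by rewrite ger0_norm ?subr_ge0 // ltr0_norm ?subr_lt0 //; lra.
Unshelve. all: by end_near. Qed.

End Antiderivative.

(** * A boundary value problem *)

Section BoundaryValue.
Context (R : realType) (H : completeNormedModType R) (dot : H -> H -> R).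
Hypotheses (hdot : scalar_product dot) (hn : forall u, `|u| ^+ 2 = dot u u).

Lemma lipschitz_continuous (a : R -> H) (L : R) :
  (forall s t, `|a s - a t| <= L * `|s - t|) -> continuous a.
Proof.
move=> aL t; apply/cvgrPdist_le => e e0; near=> s.
have L1 : 0 < `|L| + 1 by rewrite ltr_wpDl.
apply: (le_trans (aL _ _)).
apply: (@le_trans _ _ ((`|L| + 1) * `|t - s|)).
  by rewrite ler_wpM2r // (le_trans (ler_norm _)) // lerDl.
rewrite -ler_pdivlMl // distrC ltW //.
by near: s; apply: near_lt_dist; rewrite mulr_gt0 // invr_gt0.
Unshelve. all: by end_near. Qed.

Lemma antiderivative_operator : exists prim : (R -> H) -> R -> H,
  forall a : R -> H, continuous a ->
    prim a 0 = 0 /\ forall t, has_deriv (prim a) t (a t).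
Proof.
have : forall a : R -> H, exists A : R -> H, continuous a ->
    A 0 = 0 /\ forall t, has_deriv A t (a t).
  move=> a; have [ca|nca] := pselect (continuous a); last by exists a.
  by have [A HA] := antiderivative hdot hn ca; exists A.
by move=> /choice[prim primP]; exists prim.
Qed.

Lemma mean_value_global (c c' : R -> H) (K : R) :
  (forall s, has_deriv c s (c' s)) -> (forall s, `|c' s| <= K) ->
  forall s t, `|c t - c s| <= K * `|t - s|.
Proof.
move=> cd cK s t.
apply: (@mean_value R H dot c c' (Num.min s t) (Num.max s t) K) => //.
- by rewrite ge_min le_max lexx.
- by rewrite ge_min le_max lexx !orbT.
Qed.

Lemma le_geometric (x y C : R) : (forall n, x <= y + C * 2^-1 ^+ n) -> x <= y.
Proof.
move=> h; apply/ler_addgt0Pl => e e0.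
have : 2^-1 ^+ n @[n --> \oo] --> (0 : R).
  by apply: cvg_expr; rewrite ger0_norm // invf_lt1 // ltr1n.
have d0 : 0 < e / (`|C| + 1) by rewrite divr_gt0 // ltr_wpDl.
move=> /cvgrPdist_le /(_ _ d0)[N _ HN].
have := HN N (leqnn N); rewrite sub0r normrN ger0_norm ?exprn_ge0 //.
rewrite ler_pdivlMr ?ltr_wpDl // => h1.
have p0 : 0 <= 2^-1 ^+ N :> R by rewrite exprn_ge0.
apply: (le_trans (h N)); rewrite addrC lerD2r.
apply: le_trans h1; rewrite mulrDr mulr1 mulrC.
by rewrite ler_wpDr // ler_wpM2l // ler_norm.
Qed.

Let clamp (t : R) : R := Num.max (-2) (Num.min t 2).

Lemma clamp_le t : `|clamp t| <= 2.
Proof.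
rewrite /clamp ler_norml le_max ge_max lexx /= ge_min lexx orbT andbT; lra.
Qed.

Lemma clamp_id t : `|t| <= 2 -> clamp t = t.
Proof.
rewrite ler_norml => /andP[t1 t2]; rewrite /clamp.
by rewrite (min_idPl t2) (max_idPr t1).
Qed.

Lemma clamp_lip s t : `|clamp s - clamp t| <= `|s - t|.
Proof.
wlog st : s t / s <= t.
  move=> W; have [/W//|/ltW/W] := leP s t.
  by rewrite distrC [X in _ <= X]distrC.
rewrite [X in _ <= X]distrC [X in X <= _]distrC /clamp.
rewrite [X in _ <= X]ger0_norm ?subr_ge0 // /Num.max /Num.min.
by case: (ltP t 2) => t2; case: (ltP s 2) => s2; try case: (ltP (-2) t) => t3;
  try case: (ltP (-2) s) => s3; try case: (ltP (-2) 2) => h2;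
  rewrite ler_norml; apply/andP; split; lra.
Qed.

Section Picard.
Context (F : H -> H -> H) (x0 : H) (r K : R).
Hypotheses (K0 : 0 < K)
  (F_bound : forall x v, `|x - x0| < r -> `|F x v| <= K * `|v| ^+ 2)
  (F_lip : forall x y u v (B : R), `|x - x0| < r -> `|y - x0| < r ->
     `|u| <= B -> `|v| <= B ->
     `|F x u - F y v| <= K * (`|x - y| * B ^+ 2 + 2 * B * `|u - v|)).

(* The equation is solved for the acceleration [a]: if [A1' = a], [A2' = A1] on
   [-2, 2] and [A1 0 = A2 0 = 0], then
   [c t = x + t (p - A2 tau / tau) + A2 t] satisfies [c'' = a], [c 0 = x] and
   [c tau = x + tau p], and [a t = F (c t) (c' t)] is a fixed point problem for
   a contraction. Time is clamped to [-2, 2] so that suprema are over the line. *)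
Theorem second_order_bvp : 0 < r ->
  exists rho : R, 0 < rho /\ forall (x p : H) (tau : R),
    `|x - x0| <= rho -> `|p| <= rho -> 0 < tau <= 1 ->
    exists c c1 : R -> H, [/\ c 0 = x, c tau = x + tau *: p &
      forall t, `|t| <= 2 -> [/\ `|c t - x0| < r, has_deriv c t (c1 t),
        has_deriv c1 t (F (c t) (c1 t)) & `|c1 t - p| <= 4 * (25 * K * `|p| ^+ 2)]].
Proof.
move=> r0.
pose rho := Num.min 1 (Num.min (r / 12) (24 * (20 * K))^-1).
have rho0 : 0 < rho by rewrite !lt_min ltr01 divr_gt0 //= invr_gt0 !mulr_gt0.
exists rho; split=> // x p tau xr pr /andP[tau0 tau1].
pose m := `|p|; have m0 : 0 <= m by exact: normr_ge0.
have m1 : m <= 1 by apply: (le_trans pr); rewrite ge_min lexx.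
have mr : rho <= r / 12 by rewrite !ge_min lexx orbT.
have mK : 24 * (20 * K) * m <= 1.
  have : m <= (24 * (20 * K))^-1 by apply: (le_trans pr); rewrite !ge_min lexx !orbT.
  by rewrite -ler_pdivlMl ?mulr1 // !mulr_gt0.
pose eps := 25 * K * m ^+ 2; pose B := 5 * m.
have Km0 : 0 <= K * m by rewrite mulr_ge0 // ltW.
have eps0 : 0 <= eps by rewrite /eps !mulr_ge0 ?exprn_ge0 // ltW.
have epsm : eps <= m.
  rewrite /eps (_ : 25 * K * m ^+ 2 = 25 * (K * m) * m); last by ring.
  by rewrite -[leRHS]mul1r ler_wpM2r //; lra.
have epsB : K * B ^+ 2 = eps by rewrite /eps /B; ring.
have B0 : 0 <= B by rewrite mulr_ge0.
have BK : K * (8 * B ^+ 2 + 8 * B) <= 2^-1.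
  have h : K * m * m <= K * m by rewrite -[leRHS]mulr1 ler_wpM2l.
  by rewrite /B (_ : _ * _ = 200 * (K * m * m) + 40 * (K * m)); [lra|ring].
pose L := K * (5 * m * B ^+ 2 + 2 * B * eps).
have L0 : 0 <= L by rewrite /L; apply: mulr_ge0; [exact: ltW|apply: addr_ge0;
  [apply: mulr_ge0; [exact: mulr_ge0|exact: exprn_ge0]|
   apply: mulr_ge0 => //; exact: mulr_ge0]].
pose X (a : R -> H) := (forall t, `|a t| <= eps) /\
  (forall s t, `|a s - a t| <= L * `|s - t|).
have [prim primP] := antiderivative_operator.
pose A1 a := prim a.
pose b a t := A1 a (clamp t).
pose A2 a := prim (b a).
pose q a := tau^-1 *: A2 a tau.
pose c a t := x + t *: (p - q a) + A2 a t.
pose c1 a t := p - q a + A1 a t.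
pose T a t := F (c a (clamp t)) (c1 a (clamp t)).
have Xcont a : X a -> continuous a by move=> [_ /lipschitz_continuous].
have A1P a : X a -> A1 a 0 = 0 /\ forall t, has_deriv (A1 a) t (a t).
  by move=> /Xcont/primP.
have A1lip a s t : X a -> `|A1 a s - A1 a t| <= eps * `|s - t|.
  by move=> Xa; apply: mean_value_global; [exact: (A1P _ Xa).2|exact: Xa.1].
have A1le a t : X a -> `|t| <= 2 -> `|A1 a t| <= 2 * eps.
  move=> Xa t2; have := A1lip a t 0 Xa; rewrite (A1P _ Xa).1 !subr0.
  by move=> /le_trans; apply; rewrite mulrC ler_wpM2r.
have blip a s t : X a -> `|b a s - b a t| <= eps * `|s - t|.
  by move=> Xa; apply: (le_trans (A1lip _ _ _ Xa)); rewrite ler_wpM2l // clamp_lip.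
have ble a t : X a -> `|b a t| <= 2 * eps.
  by move=> Xa; apply: A1le => //; exact: clamp_le.
have bcont a : X a -> continuous (b a).
  by move=> Xa; apply: (@lipschitz_continuous _ eps) => s t; exact: blip.
have A2P a : X a -> A2 a 0 = 0 /\ forall t, has_deriv (A2 a) t (b a t).
  by move=> /bcont/primP.
have A2lip a s t : X a -> `|A2 a s - A2 a t| <= 2 * eps * `|s - t|.
  by move=> Xa; apply: mean_value_global; [exact: (A2P _ Xa).2|move=> u; exact: ble].
have A2le a t : X a -> `|A2 a t| <= 2 * eps * `|t|.
  by move=> Xa; have := A2lip a t 0 Xa; rewrite (A2P _ Xa).1 !subr0.
have qle a : X a -> `|q a| <= 2 * eps.
  move=> Xa; rewrite normrZ gtr0_norm ?invr_gt0 // ler_pdivrMl //.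
  by apply: (le_trans (A2le _ _ Xa)); rewrite gtr0_norm // mulrC.
have pq a : X a -> `|p - q a| <= m + 2 * eps.
  by move=> Xa; apply: (le_trans (ler_normB _ _)); rewrite lerD2l; exact: qle.
have cball a t : X a -> `|t| <= 2 -> `|c a t - x0| < r.
  move=> Xa t2; rewrite /c.
  rewrite (_ : _ - x0 = (x - x0) + (t *: (p - q a) + A2 a t)); last by lmodule R; ring.
  apply: (le_lt_trans (ler_normD _ _)).
  have h1 : `|t *: (p - q a)| <= 2 * (m + 2 * eps).
    by rewrite normrZ; apply: ler_pM => //; exact: pq.
  have h2 : `|A2 a t| <= 2 * eps * 2.
    by apply: (le_trans (A2le _ _ Xa)); rewrite ler_wpM2l // mulr_ge0.
  have h3 := ler_normD (t *: (p - q a)) (A2 a t).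
  have h4 : m <= rho by [].
  by lra.
have c1le a t : X a -> `|t| <= 2 -> `|c1 a t| <= B.
  move=> Xa t2; apply: (le_trans (ler_normD _ _)).
  by have := pq _ Xa; have := A1le _ _ Xa t2; rewrite /B; lra.
have clip a s t : X a -> `|c a s - c a t| <= 5 * m * `|s - t|.
  move=> Xa; rewrite /c.
  rewrite (_ : _ - _ = (s - t) *: (p - q a) + (A2 a s - A2 a t)); last by lmodule R; ring.
  apply: (le_trans (ler_normD _ _)); rewrite normrZ.
  have h1 := ler_wpM2l (normr_ge0 (s - t)) (pq _ Xa); have h2 := A2lip a s t Xa.
  have h3 := ler_wpM2l (normr_ge0 (s - t)) epsm.
  by lra.
have c1lip a s t : X a -> `|c1 a s - c1 a t| <= eps * `|s - t|.
  move=> Xa; rewrite (_ : _ - _ = A1 a s - A1 a t); first exact: A1lip.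
  by rewrite /c1; lmodule R; ring.
have TX a : X a -> X (T a).
  move=> Xa; split=> [t|s t].
    apply: (le_trans (F_bound _ _)); first exact/cball/clamp_le.
    rewrite -epsB ler_pM2l // ler_pXn2r ?nnegrE //; exact/c1le/clamp_le.
  apply: (le_trans (@F_lip _ _ _ _ B _ _ _ _)).
  - exact/cball/clamp_le.
  - exact/cball/clamp_le.
  - exact/c1le/clamp_le.
  - exact/c1le/clamp_le.
  rewrite /L -[leRHS]mulrA ler_pM2l // [leRHS]mulrDl; apply: lerD.
    rewrite [leRHS]mulrAC ler_wpM2r ?exprn_ge0 //; apply: (le_trans (clip _ _ _ Xa)).
    by rewrite ler_wpM2l ?mulr_ge0 // clamp_lip.
  rewrite -[leRHS]mulrA ler_wpM2l ?mulr_ge0 //; apply: (le_trans (c1lip _ _ _ Xa)).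
  by rewrite ler_wpM2l // clamp_lip.
have Tcontr a a' d : X a -> X a' -> (forall t, `|a t - a' t| <= d) ->
    forall t, `|T a t - T a' t| <= 2^-1 * d.
  move=> Xa Xa' ad; have d0 : 0 <= d by exact: le_trans (normr_ge0 _) (ad 0).
  have D1 t : `|t| <= 2 -> `|A1 a t - A1 a' t| <= 2 * d.
    move=> t2; have := @mean_value_global (fun t => A1 a t - A1 a' t)
      (fun t => a t - a' t) d _ ad 0 t.
    rewrite (A1P _ Xa).1 (A1P _ Xa').1 !subr0 => h.
    apply: (le_trans (h _)); last by rewrite mulrC ler_wpM2r.
    by move=> s; apply: has_derivB; [exact: (A1P _ Xa).2|exact: (A1P _ Xa').2].
  have D2 t : `|A2 a t - A2 a' t| <= 2 * d * `|t|.
    have := @mean_value_global (fun t => A2 a t - A2 a' t)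
      (fun t => b a t - b a' t) (2 * d) _ _ 0 t.
    rewrite (A2P _ Xa).1 (A2P _ Xa').1 !subr0; apply.
    - by move=> s; apply: has_derivB; [exact: (A2P _ Xa).2|exact: (A2P _ Xa').2].
    - by move=> s; exact/D1/clamp_le.
  have Dq : `|q a - q a'| <= 2 * d.
    rewrite /q -scalerBr normrZ gtr0_norm ?invr_gt0 // ler_pdivrMl //.
    by apply: (le_trans (D2 _)); rewrite gtr0_norm // mulrC.
  move=> t; have t2 := clamp_le t; set s := clamp t in t2 *.
  apply: (le_trans (@F_lip _ _ _ _ B _ _ _ _)).
  - exact: cball.
  - exact: cball.
  - exact: c1le.
  - exact: c1le.
  have Dc : `|c a s - c a' s| <= 8 * d.
    rewrite (_ : _ - _ = (A2 a s - A2 a' s) - s *: (q a - q a')); last first.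
      by rewrite /c; lmodule R; ring.
    apply: (le_trans (ler_normB _ _)); rewrite normrZ.
    have h1 : `|s| * `|q a - q a'| <= 2 * (2 * d) by exact: ler_pM.
    have h2 := ler_wpM2l (_ : 0 <= 2 * d) t2; have := D2 s.
    by have {}h2 := h2 (mulr_ge0 _ d0); lra.
  have Dc1 : `|c1 a s - c1 a' s| <= 4 * d.
    rewrite (_ : _ - _ = (A1 a s - A1 a' s) - (q a - q a')); last first.
      by rewrite /c1; lmodule R; ring.
    by apply: (le_trans (ler_normB _ _)); have := D1 s t2; lra.
  apply: (@le_trans _ _ (K * (8 * B ^+ 2 + 8 * B) * d)); last by rewrite ler_wpM2r.
  rewrite -[leRHS]mulrA ler_pM2l //.
  have h1 := ler_wpM2r (exprn_ge0 2 B0) Dc; have h2 := ler_wpM2l (_ : 0 <= 2 * B) Dc1.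
  by have {}h2 := h2 (mulr_ge0 _ B0); lra.
pose an n := iter n T (fun=> 0).
have Xn n : X (an n).
  elim: n => [|n IH]; last exact: TX.
  by split=> [t|s t]; rewrite ?subrr normr0 // mulr_ge0.
have an1 n t : `|an n.+1 t - an n t| <= eps * 2^-1 ^+ n.
  elim: n t => [|n IH] t.
    by rewrite /an /= subr0 expr0 mulr1; have [+ _] := Xn 1%N; apply.
  rewrite exprS mulrCA.
  by apply: (Tcontr (an n.+1) (an n)).
have /choice[a aP] := fun t => geometric_cvg (fun n => an1 n t).
have Xa : X a.
  split=> [t|s t].
    apply: (@le_geometric _ _ (eps * 2)) => n.
    rewrite (_ : a t = an n t - (an n t - a t)); last by rewrite subKr.
    by apply: (le_trans (ler_normB _ _)); apply: lerD (aP _ _); exact: (Xn n).1.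
  apply: (@le_geometric _ _ (2 * (eps * 2))) => n.
  rewrite (_ : _ - _ = (an n s - an n t) - (an n s - a s) + (an n t - a t)); last first.
    by lmodule R; ring.
  apply: (le_trans (ler_normD _ _)); rewrite -mulrA mulr2n mulrDl mul1r addrA.
  apply: lerD (aP _ _); apply: (le_trans (ler_normB _ _)); apply: lerD (aP _ _).
  exact: (Xn n).2.
have Ta t : a t = T a t.
  apply/eqP; rewrite -subr_eq0 -normr_le0; apply: (@le_geometric _ _ (2 * (eps * 2))) => n.
  rewrite add0r (_ : _ - _ = (T (an n) t - T a t) - (an n.+1 t - a t)); last first.
    by rewrite /an iterS; lmodule R; ring.
  apply: (le_trans (ler_normB _ _)).
  have h1 := Tcontr _ _ _ (Xn n) Xa (aP^~ n) t; have h2 := aP t n.+1.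
  move: h1 h2; rewrite exprS; have : 0 <= eps * 2^-1 ^+ n by rewrite mulr_ge0 ?exprn_ge0.
  by lra.
exists (c a), (c1 a); split.
- by rewrite /c scale0r addr0 (A2P _ Xa).1 addr0.
- rewrite /c /q; rewrite scalerBr scalerA divff ?gt_eqF // scale1r.
  by lmodule R; ring.
move=> t t2; split.
- exact: cball.
- rewrite /c /c1 -{2}(clamp_id t2); apply: has_derivD; last exact: (A2P _ Xa).2.
  exact: has_deriv_affine.
- have := Ta t; rewrite /T (clamp_id t2) => <-.
  rewrite -[a t]add0r; apply: has_derivD; last exact: (A1P _ Xa).2.
  exact: has_deriv_cst.
- rewrite /c1 (_ : _ - p = A1 a t - q a); last by lmodule R; ring.
  apply: (le_trans (ler_normB _ _)).
  by have := A1le _ _ Xa t2; have := qle _ Xa; rewrite /eps -/m; lra.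
Qed.

End Picard.
End BoundaryValue.

(** * Smooth fields of multilinear maps *)

Section Jets.
Context (R : realType).

Lemma prodn_ge0 (E : normedModType R) (w : seq E) : 0 <= \prod_(v <- w) `|v|.
Proof. by rewrite prodr_ge0. Qed.

Lemma near_lt_norm (E : normedModType R) (x : E) (e : R) : 0 < e ->
  \forall y \near x, `|y - x| < e.
Proof.
by move=> e0; apply/nbhs_ballP; exists e => //= s; rewrite -ball_normE /= distrC.
Qed.

Section Multilinear.
Context (E F : normedModType R).
Implicit Types (T : seq E -> F).

Lemma bml_bound k T : bounded_multilinear k T ->
  exists C, 0 <= C /\ forall w, size w = k -> `|T w| <= C * \prod_(v <- w) `|v|.
Proof.
move=> [_ [C HC]]; exists `|C|; split=> // w /HC /le_trans; apply.
by rewrite ler_wpM2r ?prodn_ge0 // ler_norm.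
Qed.

Lemma bml0 k T s t : bounded_multilinear k T -> (size s + size t).+1 = k ->
  T (s ++ 0 :: t) = 0.
Proof.
move=> [Tm _] stk; have := Tm s t 1 0 0 stk.
rewrite scale1r addr0 scale1r => h; apply: (addrI (T (s ++ 0 :: t))).
by rewrite addr0 -h.
Qed.

Lemma bmlZ k T s t a u : bounded_multilinear k T -> (size s + size t).+1 = k ->
  T (s ++ a *: u :: t) = a *: T (s ++ u :: t).
Proof.
move=> Tk stk; have := Tk.1 s t a u 0 stk.
by rewrite (bml0 Tk stk) !addr0.
Qed.

Lemma bmlD k T s t u v : bounded_multilinear k T -> (size s + size t).+1 = k ->
  T (s ++ (u + v) :: t) = T (s ++ u :: t) + T (s ++ v :: t).
Proof. by move=> Tk stk; rewrite -[u in LHS]scale1r Tk.1 // scale1r. Qed.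

Lemma bmlB k T s t u v : bounded_multilinear k T -> (size s + size t).+1 = k ->
  T (s ++ (u - v) :: t) = T (s ++ u :: t) - T (s ++ v :: t).
Proof.
by move=> Tk stk; rewrite (bmlD _ _ Tk) // -scaleN1r (bmlZ _ _ Tk) // scaleN1r.
Qed.

Lemma bml_cons k T a : bounded_multilinear k.+1 T ->
  bounded_multilinear k (fun w => T (a :: w)).
Proof.
move=> [Tm [C TC]]; split.
  by move=> s t c u v stk; apply: (Tm (a :: s)); rewrite /= -stk.
exists (C * `|a|) => w wk; have /TC : size (a :: w) = k.+1 by rewrite /= wk.
by rewrite big_cons mulrA.
Qed.

Fixpoint leibniz T (V V' : seq E) : F :=
  match V, V' with
  | v :: V, v' :: V' => T (v' :: V) + leibniz (fun w => T (v :: w)) V V'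
  | _, _ => 0
  end.

Fixpoint list_deriv (t : R) (W : seq (R -> E)) (V' : seq E) : Prop :=
  match W, V' with
  | c :: W, v' :: V' => has_deriv c t v' /\ list_deriv t W V'
  | [::], [::] => True
  | _, _ => False
  end.

Definition at_time (W : seq (R -> E)) (t : R) : seq E := [seq c t | c <- W].

Lemma list_deriv_bound t W V' : list_deriv t W V' ->
  exists M, 0 <= M /\ \forall s \near t, \prod_(v <- at_time W s) `|v| <= M.
Proof.
elim: W V' => [|c W IH] [|v V'] //=.
  by move=> _; exists 1; split=> //; near=> s; rewrite big_nil.
move=> [cv /IH[M [M0 HM]]]; exists ((`|c t| + 1) * M); split.
  by rewrite mulr_ge0 // addr_ge0.
near=> s; rewrite big_cons; apply: ler_pM => //.
- exact: prodn_ge0.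
- rewrite (_ : c s = c t + (c s - c t)); last by lmodule R; ring.
  apply: (le_trans (ler_normD _ _)); rewrite lerD2l.
  by near: s; exact: (has_deriv_cvg cv).
- by near: s.
Unshelve. all: by end_near. Qed.

Lemma has_deriv_small (c : R -> F) t : c t = 0 ->
  (forall e : R, 0 < e -> \forall s \near t, `|c s| <= e * `|s - t|) ->
  has_deriv c t 0.
Proof.
move=> ct cs e e0; near=> s; rewrite ct subr0 scaler0 subr0.
by near: s; exact: cs.
Unshelve. all: by end_near. Qed.

Lemma multilinear_curve k T t W V' : bounded_multilinear k T ->
  list_deriv t W V' -> size W = k ->
  has_deriv (fun s => T (at_time W s)) t (leibniz T (at_time W t) V').
Proof.
elim: W V' k T => [|c W IH] [|v V'] k T //=.
  by move=> _ _ _; exact: has_deriv_cst.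
move=> Tk [cv Wd] Wk; case: k => // k in Tk Wk *; case: Wk => Wk.
have IHa a := IH _ _ _ (bml_cons a Tk) Wd Wk.
have [C [C0 TC]] := bml_bound Tk.
have [M [M0 HM]] := list_deriv_bound Wd.
have szW s : size (at_time W s) = k by rewrite size_map.
pose g s := T ((c s - c t - (s - t) *: v) :: at_time W s).
pose h s := (s - t) *: (T (v :: at_time W s) - T (v :: at_time W t)).
have T0 w : size w = k -> T (0 :: w) = 0.
  by move=> wk; apply: (@bml0 _ _ [::] w Tk); rewrite /= wk.
have gd : has_deriv g t 0.
  apply: has_deriv_small => [|e e0]; first by rewrite /g !subrr scale0r subr0 T0.
  have CM : 0 < C * M + 1 by rewrite ltr_wpDl // mulr_ge0.
  near=> s; apply: (le_trans (TC _ _)); first by rewrite /= szW.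
  rewrite big_cons.
  have h1 : `|c s - c t - (s - t) *: v| <= e / (C * M + 1) * `|s - t|.
    by near: s; apply: cv; rewrite divr_gt0.
  have h2 : \prod_(v <- at_time W s) `|v| <= M by near: s.
  apply: (@le_trans _ _ (C * (e / (C * M + 1) * `|s - t| * M))).
    by rewrite ler_wpM2l // ler_pM // prodn_ge0.
  rewrite (_ : C * _ = (C * M) / (C * M + 1) * (e * `|s - t|)); last by ring.
  rewrite ler_piMl ?mulr_ge0 // ?(ltW e0) // ler_pdivrMr // mul1r.
  by rewrite lerDl.
have hd : has_deriv h t 0.
  apply: has_deriv_small => [|e e0]; first by rewrite /h subrr scale0r.
  near=> s; rewrite normrZ mulrC ler_wpM2r //.
  by near: s; exact: (has_deriv_cvg (IHa v)).
pose l s := T (c t :: at_time W t) + (s - t) *: T (v :: at_time W t).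
pose l2 s := T (c t :: at_time W s) - T (c t :: at_time W t).
have ET s : T (c s :: at_time W s) = l s + l2 s + (g s + h s).
  rewrite /l /l2 /g /h.
  rewrite (@bmlB _ _ [::] (at_time W s) _ _ Tk) /= ?szW //.
  rewrite (@bmlB _ _ [::] (at_time W s) _ _ Tk) /= ?szW //.
  rewrite (@bmlZ _ _ [::] (at_time W s) _ _ Tk) /= ?szW //.
  by lmodule R; ring.
apply: (@has_deriv_ext _ _ (fun s => l s + l2 s + (g s + h s))).
  by near=> s; rewrite ET.
rewrite -[_ + leibniz _ _ _]addr0 -[X in _ + X](addr0 0).
apply: has_derivD; last exact: has_derivD.
apply: has_derivD; last first.
  rewrite -[leibniz _ _ _]subr0; apply: has_derivB; last exact: has_deriv_cst.
  exact: IHa.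
apply: (@has_deriv_ext _ _ (fun s =>
  (T (c t :: at_time W t) - t *: T (v :: at_time W t)) + s *: T (v :: at_time W t))).
  by near=> s; rewrite /l; lmodule R; ring.
exact: has_deriv_affine.
Unshelve. all: by end_near. Qed.

Lemma leibniz0 V V' T : (forall w, size w = size V -> T w = 0) -> leibniz T V V' = 0.
Proof.
elim: V V' T => [|v V IH] [|v' V'] T T0 //=.
by rewrite T0 // IH ?addr0 // => w wV; rewrite T0 //= wV.
Qed.

(* [G x w], for [w] of size [m + j], stands for the [j]-th derivative at [x] of
   a field of [m]-linear maps, as in [smooth_multilinear_on]. *)
Definition jet (m : nat) (U : set E) (G : E -> seq E -> F) : Prop :=
  (forall (k : nat) (x : E), (m <= k)%N -> U x -> bounded_multilinear k (G x)) /\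
  (forall (k : nat) (x : E) (e : R), (m <= k)%N -> U x -> 0 < e ->
     \forall y \near x, forall w : seq E, size w = k ->
       `|G y w - G x w - G x (y - x :: w)| <= e * `|y - x| * \prod_(v <- w) `|v|).

Lemma jet_bounded m U G k x0 : jet m U G -> open U -> (m <= k)%N -> U x0 ->
  exists r K : R, [/\ 0 < r, 0 <= K & forall y, `|y - x0| < r ->
    U y /\ forall w, size w = k -> `|G y w| <= K * \prod_(v <- w) `|v|].
Proof.
move=> [Gb Gd] Uo mk Ux0.
have [C [C0 HC]] := bml_bound (Gb k x0 mk Ux0).
have [C' [C'0 HC']] := bml_bound (Gb k.+1 x0 (leqW mk) Ux0).
have : \forall y \near x0, U y /\ forall w, size w = k ->
    `|G y w| <= (C + C' + 1) * \prod_(v <- w) `|v|.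
  near=> y; split; first by near: y; exact: open_nbhs_nbhs.
  move=> w wk.
  have y1 : `|y - x0| <= 1.
    by rewrite ltW //; near: y; exact: near_lt_norm.
  have h : forall w : seq E, size w = k ->
       `|G y w - G x0 w - G x0 (y - x0 :: w)| <= 1 * `|y - x0| * \prod_(v <- w) `|v|.
    by near: y; exact: Gd.
  have {h} := h w wk; have := HC w wk; have := HC' (y - x0 :: w).
  rewrite /= wk big_cons => /(_ erefl) h1 h2 h3.
  have p0 := prodn_ge0 w; set p := \prod_(v <- w) `|v| in p0 h1 h2 h3 *.
  rewrite (_ : G y w = (G y w - G x0 w - G x0 (y - x0 :: w)) + G x0 (y - x0 :: w) + G x0 w);
    last by lmodule R; ring.
  apply: (le_trans (ler_normD _ _)).
  have h4 := ler_normD (G y w - G x0 w - G x0 (y - x0 :: w))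
    (G x0 (y - x0 :: w)).
  have h5 : `|y - x0| * p <= p by rewrite -[leRHS]mul1r ler_wpM2r.
  have h6 : C' * (`|y - x0| * p) <= C' * p by rewrite ler_wpM2l.
  by lra.
move=> /nbhs_ballP[r /= r0 H]; exists r, (C + C' + 1); split=> //.
  by rewrite !addr_ge0.
by move=> y yr; apply: H; rewrite -ball_normE /= distrC.
Unshelve. all: by end_near. Qed.

Lemma jet_curve m U G k c c' t W V' : jet m U G -> (m <= k)%N -> U (c t) ->
  has_deriv c t c' -> list_deriv t W V' -> size W = k ->
  has_deriv (fun s => G (c s) (at_time W s)) t
    (G (c t) (c' :: at_time W t) + leibniz (G (c t)) (at_time W t) V').
Proof.
move=> [Gb Gd] mk Ux cd Wd Wk; set x := c t in Ux *.
have szW s : size (at_time W s) = k by rewrite size_map.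
have Gk := Gb k x mk Ux; have Gk1 := Gb k.+1 x (leqW mk) Ux.
have [M [M0 HM]] := list_deriv_bound Wd.
pose rest s := G (c s) (at_time W s) - G x (at_time W s) - G x (c s - x :: at_time W s).
have G0 w : size w = k -> G x (0 :: w) = 0.
  by move=> wk; apply: (@bml0 _ _ [::] w Gk1); rewrite /= wk.
have rd : has_deriv rest t 0.
  apply: has_deriv_small => [|e e0]; first by rewrite /rest !subrr G0 // subrr.
  pose B := (`|c'| + 1) * M + 1.
  have B0 : 0 < B by rewrite ltr_wpDl // mulr_ge0 // addr_ge0.
  have eB0 : 0 < e / B by rewrite divr_gt0.
  have /nbhs_ballP[r /= r0 H] := Gd k x _ mk Ux eB0.
  near=> s.
  have cs : `|c s - x| < r.
    apply: le_lt_trans (_ : r / 2 < r); last by rewrite ltr_pdivrMr // ltr_pMr // ltr1n.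
    by near: s; apply: (has_deriv_cvg cd); rewrite divr_gt0.
  have := H (c s); rewrite -ball_normE /= distrC => /(_ cs _ (szW s)) /le_trans; apply.
  have h1 : `|c s - x| <= (`|c'| + 1) * `|s - t| by near: s; exact: has_deriv_lip.
  have h2 : \prod_(v <- at_time W s) `|v| <= M by near: s.
  rewrite -2!mulrA ler_pM2l // ler_pdivrMl //.
  apply: (@le_trans _ _ ((`|c'| + 1) * `|s - t| * M)).
    by apply: ler_pM => //; exact: prodn_ge0.
  by rewrite mulrAC /B [leRHS]mulrDl lerDl mul1r.
have h1 := multilinear_curve Gk Wd Wk.
have cxd : has_deriv (fun s => c s - x) t c'.
  by rewrite -[c']subr0; apply: has_derivB => //; exact: has_deriv_cst.
have h2 := @multilinear_curve _ _ t ((fun s => c s - x) :: W) (c' :: V') Gk1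
  (conj cxd Wd) (congr1 succn Wk).
move: h2; rewrite /= -/x subrr leibniz0 ?addr0; last by move=> w; rewrite szW => /G0.
move=> h2; rewrite addrC.
apply: (@has_deriv_ext _ _ (fun s => G x (at_time W s) + G x (c s - x :: at_time W s) + rest s)).
  by near=> s; rewrite /rest; lmodule R; ring.
rewrite -[_ + G _ _]addr0; apply: has_derivD => //; exact: has_derivD.
Unshelve. all: by end_near. Qed.

End Multilinear.

Lemma at_time_cst (E : normedModType R) (w : seq E) t : at_time [seq (fun=> v) | v <- w] t = w.
Proof. by rewrite /at_time -map_comp map_id. Qed.

Lemma list_deriv_cst (E : normedModType R) (w : seq E) t :
  list_deriv t [seq (fun=> v) | v <- w] [seq 0 | v <- w].
Proof. by elim: w => //= v w IH; split=> //; exact: has_deriv_cst. Qed.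

Lemma leibniz_cst (E F : normedModType R) (T : seq E -> F) (w : seq E) k :
  bounded_multilinear k T -> size w = k -> leibniz T w [seq 0 | v <- w] = 0.
Proof.
elim: w T k => //= v w IH T [//|k] Tk [wk].
rewrite (IH _ _ (bml_cons v Tk)) // addr0.
by apply: (@bml0 _ _ _ _ [::] w Tk); rewrite /= wk.
Qed.

Lemma jet_curve_cst (E F : normedModType R) m U (G : E -> seq E -> F) k c c' t w :
  jet m U G -> (m <= k)%N -> U (c t) -> has_deriv c t c' -> size w = k ->
  has_deriv (fun s => G (c s) w) t (G (c t) (c' :: w)).
Proof.
move=> Gj mk Ux cd wk.
have := jet_curve Gj mk Ux cd (list_deriv_cst w t); rewrite size_map => /(_ wk).
rewrite at_time_cst (leibniz_cst (Gj.1 k _ mk Ux)) // addr0.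
by apply: has_deriv_ext; near=> s; rewrite at_time_cst.
Unshelve. all: by end_near. Qed.

Context (H : completeNormedModType R) (dot : H -> H -> R).
Hypotheses (hdot : scalar_product dot) (hn : forall u, `|u| ^+ 2 = dot u u).

Lemma jet_lipschitz m U (G : H -> seq H -> H) k x0 :
  jet m U G -> open U -> (m <= k)%N -> U x0 ->
  exists r K : R, [/\ 0 < r, 0 <= K & forall y z, `|y - x0| < r -> `|z - x0| < r ->
    forall w, size w = k -> `|G y w - G z w| <= K * `|y - z| * \prod_(v <- w) `|v|].
Proof.
move=> Gj Uo mk Ux0.
have [r [K [r0 K0 HK]]] := jet_bounded Gj Uo (leqW mk) Ux0.
exists r, K; split=> // y z yr zr w wk.
pose c (s : R) := z + s *: (y - z).
have cb s : 0 <= s <= 1 -> `|c s - x0| < r.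
  move=> /andP[s0 s1].
  rewrite (_ : _ - x0 = (1 - s) *: (z - x0) + s *: (y - x0)); last first.
    by rewrite /c; lmodule R; ring.
  apply: (le_lt_trans (ler_normD _ _)); rewrite !normrZ !ger0_norm ?subr_ge0 //.
  have h1 : (1 - s) * `|z - x0| <= (1 - s) * Num.max `|z - x0| `|y - x0|.
    by rewrite ler_wpM2l ?subr_ge0 // le_max lexx.
  have h2 : s * `|y - x0| <= s * Num.max `|z - x0| `|y - x0|.
    by rewrite ler_wpM2l // le_max lexx orbT.
  have h3 : Num.max `|z - x0| `|y - x0| < r by rewrite gt_max zr yr.
  by lra.
have := @mean_value R H dot (fun s => G (c s) w) (fun s => G (c s) (y - z :: w)) 0 1
  (K * `|y - z| * \prod_(v <- w) `|v|) hdot hn _ _ 0 1.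
have -> : c 0 = z by rewrite /c scale0r addr0.
have -> : c 1 = y by rewrite /c; lmodule R; ring.
rewrite subr0 normr1 mulr1; apply.
- move=> s /cb /HK[Us _]; apply: (jet_curve_cst Gj mk Us) => //.
  exact: has_deriv_affine.
- move=> s /cb /HK[_ /(_ (y - z :: w))]; rewrite /= wk big_cons mulrA.
  exact.
- by rewrite lexx ler01.
- by rewrite lexx ler01.
Qed.

End Jets.

Section Smoothness.
Context (R : realType) (H : completeNormedModType R) (dot : H -> H -> R).
Hypotheses (hdot : scalar_product dot) (hn : forall u, `|u| ^+ 2 = dot u u).

Section Ck.
Context (J : set R) (Jo : open J).

Fixpoint Ck (E : normedModType R) (k : nat) (phi : R -> E) : Prop :=
  if k is k.+1 then
    exists phi', (forall t, J t -> has_deriv phi t (phi' t)) /\ Ck k phi'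
  else True.

Lemma Ck_ext (E : normedModType R) k (phi psi : R -> E) :
  (forall t, J t -> phi t = psi t) -> Ck k phi -> Ck k psi.
Proof.
case: k => //= k pp [phi' [pd pk]]; exists phi'; split=> // t Jt.
apply: has_deriv_ext (pd t Jt).
by near=> s; apply: pp; near: s; exact: open_nbhs_nbhs.
Unshelve. all: by end_near. Qed.

Lemma CkW (E : normedModType R) k (phi : R -> E) : Ck k.+1 phi -> Ck k phi.
Proof.
elim: k phi => //= k IH phi [phi' [pd pk]].
by exists phi'; split=> //; exact: IH.
Qed.

Lemma CkD (E : normedModType R) k (phi psi : R -> E) :
  Ck k phi -> Ck k psi -> Ck k (fun t => phi t + psi t).
Proof.
elim: k phi psi => //= k IH phi psi [phi' [pd pk]] [psi' [qd qk]].
exists (fun t => phi' t + psi' t); split; last exact: IH.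
by move=> t Jt; apply: has_derivD; [exact: pd|exact: qd].
Qed.

Lemma CkZ (E : normedModType R) k (a : R) (phi : R -> E) :
  Ck k phi -> Ck k (fun t => a *: phi t).
Proof.
elim: k phi => //= k IH phi [phi' [pd pk]].
exists (fun t => a *: phi' t); split; last exact: IH.
by move=> t Jt; apply: has_derivZ; exact: pd.
Qed.

Lemma CkB (E : normedModType R) k (phi psi : R -> E) :
  Ck k phi -> Ck k psi -> Ck k (fun t => phi t - psi t).
Proof.
move=> pk /(@CkZ _ _ (-1)) qk; apply: Ck_ext (CkD pk qk) => t _.
by rewrite scaleN1r.
Qed.

Lemma Ck_cst0 (E : normedModType R) k : Ck k (fun=> 0 : E).
Proof.
elim: k => //= k IH; exists (fun=> 0); split=> // t _; exact: has_deriv_cst.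
Qed.

Lemma Ck_derive1 (E : normedModType R) k (phi : R -> E) : Ck k.+1 phi ->
  (forall t, J t -> has_deriv phi t (derive1 phi t)) /\ Ck k (derive1 phi).
Proof.
move=> [phi' [pd pk]].
have E1 t : J t -> phi' t = derive1 phi t by move=> /pd/has_deriv1.
split=> [t Jt|]; first by rewrite -E1 //; exact: pd.
exact: Ck_ext pk.
Qed.

Lemma Ck_smooth (E : normedModType R) (phi : R -> E) :
  (forall k, Ck k phi) -> @smooth_on R R^o E J phi.
Proof.
move=> pk.
have it k j : Ck k (iter j (@derive1 R E) phi).
  elim: j k => [|j IH] k; first exact: pk.
  by rewrite iterS; apply: (Ck_derive1 (IH k.+1)).2.
exists (fun t w => (\prod_(v <- w) (v : R)) *: iter (size w) (@derive1 R E) phi t).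
have pn (w : seq R^o) : `|\prod_(v <- w) (v : R)| = \prod_(v <- w) `|v|.
  by elim: w => [|v w IH]; rewrite ?big_nil ?normr1 // !big_cons normrM IH.
split.
- by move=> t [|//] Jt _; rewrite big_nil scale1r.
- move=> k t _ Jt; split.
    move=> s r a u v _; rewrite !size_cat /= !big_cat /= !big_cons.
    rewrite !addnS /= scalerA -scalerDl; congr (_ *: _).
    by rewrite /GRing.scale /=; ring.
  exists `|iter k (@derive1 R E) phi t| => w <-.
  by rewrite normrZ pn mulrC.
- move=> k x e _ Jx e0.
  have h := (Ck_derive1 (it 1%N k)).1 x Jx.
  near=> y => w wk /=; rewrite big_cons wk.
  set f := iter k _ phi.
  rewrite (_ : _ - _ = (\prod_(v <- w) (v : R)) *: (f y - f x - (y - x) *: derive1 f x)).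
    rewrite normrZ pn mulrC ler_wpM2r ?prodn_ge0 //.
    by near: y; apply: h.
  by rewrite -/f; lmodule R; ring.
Unshelve. all: by end_near. Qed.

Fixpoint Ckl (E : normedModType R) (k : nat) (W : seq (R -> E)) : Prop :=
  if W is c :: W then Ck k c /\ Ckl k W else True.

Lemma Ckl_cat (E : normedModType R) k (W W' : seq (R -> E)) :
  Ckl k W -> Ckl k W' -> Ckl k (W ++ W').
Proof. by elim: W => //= c W IH [ck Wk] W'k; split=> //; exact: IH. Qed.

Lemma CklW (E : normedModType R) k (W : seq (R -> E)) : Ckl k.+1 W -> Ckl k W.
Proof. by elim: W => //= c W IH [/CkW ck /IH]. Qed.

Lemma Ckl_deriv (E : normedModType R) k (W : seq (R -> E)) : Ckl k.+1 W ->
  exists W', [/\ size W' = size W, Ckl k W' &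
    forall t, J t -> list_deriv t W (at_time W' t)].
Proof.
elim: W => [|c W IH] /=; first by exists [::].
move=> [[c' [cd ck]] /IH[W' [sW Wk Wd]]].
by exists (c' :: W'); split=> //=; [rewrite sW|move=> t Jt; split; [exact: cd|exact: Wd]].
Qed.

Lemma Ck_leibniz (E F : normedModType R) k n (G : R -> seq E -> F) pre W W' :
  (forall V, size V = n -> Ckl k V -> Ck k (fun t => G t (at_time V t))) ->
  (size pre + size W)%N = n -> size W' = size W ->
  Ckl k pre -> Ckl k W -> Ckl k W' ->
  Ck k (fun t => leibniz (fun w => G t (at_time pre t ++ w)) (at_time W t) (at_time W' t)).
Proof.
move=> GV; elim: W pre W' => [|c W IH] pre [|c' W'] //=.
  by move=> *; exact: Ck_cst0.
move=> sn [sW] prek [ck Wk] [c'k W'k]; apply: CkD.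
  apply: (@Ck_ext _ _ (fun t => G t (at_time (pre ++ c' :: W) t))).
    by move=> t _; rewrite /at_time map_cat.
  by apply: GV; [rewrite size_cat /= | exact: Ckl_cat].
have := IH (rcons pre c) W'; rewrite size_rcons addSnnS => /(_ sn sW).
rewrite -cats1 => /(_ _ Wk W'k) h.
apply: Ck_ext (h _); last exact: Ckl_cat.
by move=> t _; congr (leibniz _); apply/funext => w; rewrite /at_time map_cat -catA.
Qed.

Lemma Ck_jet (E F : normedModType R) m (U : set E) (G : E -> seq E -> F) k n c W :
  jet m U G -> (m <= n)%N -> size W = n -> (forall t, J t -> U (c t)) ->
  Ck k c -> Ckl k W -> Ck k (fun t => G (c t) (at_time W t)).
Proof.
move=> Gj; elim: k n c W => // k IH n c W mn Wn cU [c' [cd c'k]] Wk1.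
have ck : Ck k c by apply: CkW; exists c'.
have [W' [sW W'k Wd]] := Ckl_deriv Wk1; have Wk := CklW Wk1.
exists (fun t => G (c t) (c' t :: at_time W t) +
  leibniz (G (c t)) (at_time W t) (at_time W' t)); split.
  by move=> t Jt; exact: (jet_curve Gj mn (cU t Jt) (cd t Jt) (Wd t Jt) Wn).
apply: CkD.
  apply: (IH n.+1 c (c' :: W)) => //=; first exact: leqW.
  by rewrite Wn.
apply: (@Ck_leibniz _ _ k n (fun t => G (c t)) [::] W W') => //.
by move=> V Vn Vk; apply: (IH n).
Qed.

End Ck.

Section Solve.
Context (U : set H) (Uo : open U) (A : H -> seq H -> H).
Hypotheses (Aj : jet 1 U A)
  (A_below : forall x0, U x0 -> exists r c, [/\ 0 < r, 0 < c &
     forall x u, `|x - x0| < r -> c * `|u| <= `|A x [:: u]|])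
  (A_surj : forall x y, U x -> exists z, A x [:: z] = y).

Definition solve (x y : H) : H := xget 0 [set z | A x [:: z] = y].

Lemma solveP x y : U x -> A x [:: solve x y] = y.
Proof. by move=> /A_surj-/(_ y)[z Az]; rewrite /solve; case: xgetP => // /(_ z). Qed.

Let AB x u v : U x -> A x [:: u - v] = A x [:: u] - A x [:: v].
Proof. by move=> Ux; exact: (@bmlB _ _ _ 1 _ [::] [::] u v (Aj.1 1%N x (leqnn _) Ux)). Qed.

Let AZ x a u : U x -> A x [:: a *: u] = a *: A x [:: u].
Proof. by move=> Ux; exact: (@bmlZ _ _ _ 1 _ [::] [::] a u (Aj.1 1%N x (leqnn _) Ux)). Qed.

Lemma has_deriv_mulr_id (E : normedModType R) (g : R -> E) t d :
  has_deriv g t d -> has_deriv (fun s => (s - t) *: g s) t (g t).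
Proof.
move=> gd e e0; near=> s.
rewrite (_ : _ - _ = (s - t) *: (g s - g t)); last by lmodule R; ring.
rewrite normrZ mulrC ler_wpM2r //.
by near: s; exact: (has_deriv_cvg gd).
Unshelve. all: by end_near. Qed.

Lemma solve_deriv (c y : R -> H) t c' y' : U (c t) -> has_deriv c t c' ->
  has_deriv y t y' ->
  has_deriv (fun s => solve (c s) (y s)) t
    (solve (c t) (y' - A (c t) [:: c'; solve (c t) (y t)])).
Proof.
move=> Ux cd yd; set x := c t in Ux *; set z := solve x (y t).
set z' := solve x _.
pose psi s := y s - A (c s) [:: z] - (s - t) *: A (c s) [:: z'].
have psi0 : psi t = 0 by rewrite /psi subrr scale0r subr0 -/x solveP // subrr.
have psid : has_deriv psi t 0.
  have h1 := jet_curve_cst Aj (leqnn 1) Ux cd (erefl : size [:: z] = 1%N).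
  have h2 := jet_curve_cst Aj (leqnn 1) Ux cd (erefl : size [:: z'] = 1%N).
  have := has_derivB (has_derivB yd h1) (has_deriv_mulr_id h2).
  by rewrite /= -/x /z' solveP // subrr.
have [r [k [r0 k0 Hk]]] := A_below Ux.
have [r' [K' [r'0 _ HU]]] := jet_bounded Aj Uo (leqnn 1) Ux.
move=> e e0.
pose r2 := Num.min r r'.
have r20 : 0 < r2 by rewrite lt_min r0.
near=> s.
have cs : `|c s - x| < r2.
  apply: le_lt_trans (_ : r2 / 2 < r2); last by rewrite ltr_pdivrMr // ltr_pMr // ltr1n.
  by near: s; apply: (has_deriv_cvg cd); rewrite divr_gt0.
move: cs; rewrite lt_min => /andP[csr /HU[Us _]].
rewrite -(ler_pM2l k0); apply: (le_trans (Hk (c s) _ csr)).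
rewrite !AB // AZ // solveP //.
have : `|psi s - psi t - (s - t) *: 0| <= k * e * `|s - t|.
  by near: s; apply: psid; rewrite mulr_gt0.
by rewrite psi0 scaler0 !subr0 -mulrA.
Unshelve. all: by end_near. Qed.

Lemma Ck_solve (J : set R) k c y : (forall t, J t -> U (c t)) ->
  open J -> Ck J k c -> Ck J k y -> Ck J k (fun t => solve (c t) (y t)).
Proof.
move=> cU Jo; elim: k y => // k IH y [c' [cd c'k]] [y' [yd y'k]].
have ck : Ck J k c by apply: CkW; exists c'.
have yk : Ck J k y by apply: CkW; exists y'.
pose z t := solve (c t) (y t); have zk : Ck J k z by exact: IH.
exists (fun t => solve (c t) (y' t - A (c t) [:: c' t; z t])); split.
  by move=> t Jt; apply: solve_deriv; [exact: cU|exact: cd|exact: yd].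
apply: IH => //; apply: CkB => //.
exact: (@Ck_jet J Jo _ _ _ _ _ k 2 c [:: c'; z] Aj).
Qed.

Context (N : H -> seq H -> H) (Nj : jet 2 U N).

Definition acceleration (x u : H) : H := solve x (N x [:: u; u]).

Lemma acceleration_bounds x0 : U x0 -> exists r K : R, [/\ 0 < r, 0 < K,
  forall x, `|x - x0| < r -> U x,
  forall x v, `|x - x0| < r -> `|acceleration x v| <= K * `|v| ^+ 2 &
  forall x y u v (B : R), `|x - x0| < r -> `|y - x0| < r ->
     `|u| <= B -> `|v| <= B ->
     `|acceleration x u - acceleration y v|
       <= K * (`|x - y| * B ^+ 2 + 2 * B * `|u - v|)].
Proof.
move=> Ux0.
have [r1 [k [r10 k0 Hk]]] := A_below Ux0.
have [r2 [K2 [r20 K20 HN]]] := jet_bounded Nj Uo (leqnn 2) Ux0.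
have [r3 [K3 [r30 K30 HNl]]] := jet_lipschitz hdot hn Nj Uo (leqnn 2) Ux0.
have [r4 [K4 [r40 K40 HAl]]] := jet_lipschitz hdot hn Aj Uo (leqnn 1) Ux0.
pose r := Num.min (Num.min r1 r2) (Num.min r3 r4).
have rP x : `|x - x0| < r -> [/\ `|x - x0| < r1, `|x - x0| < r2, `|x - x0| < r3 & `|x - x0| < r4].
  by rewrite !lt_min => /andP[/andP[-> ->] /andP[-> ->]].
have RU x : `|x - x0| < r -> U x by move=> /rP[_ /HN[]].
have N2 x u v : `|x - x0| < r -> `|N x [:: u; v]| <= K2 * (`|u| * `|v|).
  move=> /rP[_ xr2 _ _]; have [_ /(_ [:: u; v] erefl)] := HN _ xr2.
  by rewrite !big_cons big_nil mulr1.
have F1 x v : `|x - x0| < r -> `|acceleration x v| <= K2 / k * `|v| ^+ 2.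
  move=> xr; have [xr1 _ _ _] := rP x xr.
  rewrite mulrAC ler_pdivlMr // mulrC; apply: (le_trans (Hk _ _ xr1)).
  by rewrite solveP; [rewrite expr2; exact: N2|exact: RU].
have Kp : 0 <= K2 / k by rewrite divr_ge0 // ltW.
pose K := K2 / k + (K3 + K4 * (K2 / k)) / k + 1.
have q0 : 0 <= (K3 + K4 * (K2 / k)) / k.
  by apply: divr_ge0; [apply: addr_ge0 => //; exact: mulr_ge0|exact: ltW].
exists r, K; split=> //.
- by rewrite !lt_min r10 r20 r30 r40.
- by rewrite ltr_wpDl // addr_ge0.
- move=> x v xr; apply: (le_trans (F1 _ _ xr)); rewrite ler_wpM2r ?exprn_ge0 //.
  by rewrite /K -addrA lerDl addr_ge0.
move=> x y u v B xr yr uB vB.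
have B0 : 0 <= B by exact: le_trans (normr_ge0 _) uB.
have [xr1 _ xr3 xr4] := rP x xr; have [_ _ yr3 yr4] := rP y yr.
have Ux := RU x xr; have Uy := RU y yr.
have uu : `|u| * `|u| <= B ^+ 2 by rewrite expr2; exact: ler_pM.
have vv : `|v| ^+ 2 <= B ^+ 2 by rewrite !expr2; exact: ler_pM.
have Ny2 := Nj.1 2%N y (leqnn _) Uy.
have E : A x [:: acceleration x u - acceleration y v] =
  (N x [:: u; u] - N y [:: u; u]) + (N y [:: u - v; u] + N y [:: v; u - v])
  - (A x [:: acceleration y v] - A y [:: acceleration y v]).
  rewrite AB // solveP // [A y _]solveP //.
  rewrite (@bmlB _ _ _ 2 _ [::] [:: u] u v Ny2) //.
  rewrite (@bmlB _ _ _ 2 _ [:: v] [::] u v Ny2) //=.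
  by lmodule R; ring.
have h1 := HNl x y xr3 yr3 [:: u; u] erefl.
have h2 := HAl x y xr4 yr4 [:: acceleration y v] erefl.
have h3 := N2 y (u - v) u yr; have h4 := N2 y v (u - v) yr.
have h5 := F1 y v yr.
move: h1 h2; rewrite !big_cons !big_nil !mulr1 => h1 h2.
have h := Hk x (acceleration x u - acceleration y v) xr1.
rewrite E in h.
have g1 : K3 * `|x - y| * (`|u| * `|u|) <= K3 * `|x - y| * B ^+ 2.
  by rewrite ler_wpM2l // mulr_ge0.
have g2 : K4 * `|x - y| * `|acceleration y v| <= K4 * `|x - y| * (K2 / k * B ^+ 2).
  rewrite ler_wpM2l ?mulr_ge0 //; apply: (le_trans h5).
  by rewrite ler_wpM2l.
have g3 : K2 * (`|u - v| * `|u|) <= K2 * (`|u - v| * B) by rewrite !ler_wpM2l.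
have g4 : K2 * (`|v| * `|u - v|) <= K2 * (B * `|u - v|).
  by rewrite ler_wpM2l // ler_wpM2r.
have {}h : k * `|acceleration x u - acceleration y v| <=
   (K3 + K4 * (K2 / k)) * (`|x - y| * B ^+ 2) + K2 * (2 * B * `|u - v|).
  apply: (le_trans h); apply: (le_trans (ler_normB _ _)).
  apply: (le_trans (lerD (ler_normD _ _) (lexx _))).
  have := ler_normD (N y [:: u - v; u]) (N y [:: v; u - v]).
  by lra.
rewrite -(ler_pM2l k0); apply: (le_trans h).
have p1 : 0 <= `|x - y| * B ^+ 2 by rewrite mulr_ge0 ?exprn_ge0.
have p2 : 0 <= 2 * B * `|u - v| by rewrite !mulr_ge0.
have kK : k * K = K2 + (K3 + K4 * (K2 / k)) + k by rewrite /K; field; rewrite gt_eqF.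
have K24 : 0 <= K3 + K4 * (K2 / k) by apply: addr_ge0 => //; exact: mulr_ge0.
rewrite [leRHS]mulrA kK [leRHS]mulrDr; apply: lerD; rewrite ler_wpM2r //.
  by have := ltW k0; lra.
by have := ltW k0; lra.
Qed.

End Solve.

End Smoothness.

(** * Geodesics in a chart *)

Section GeodesicEquation.
Context (R : realType) (H : completeNormedModType R) (dot : H -> H -> R).
Hypotheses (hdot : scalar_product dot) (hn : forall u, `|u| ^+ 2 = dot u u).
Context (U : set H) (Uo : open U) (D : H -> seq H -> R^o).
Hypotheses (Dj : jet 2 U D)
  (D_sym : forall x u v, U x -> D x [:: u; v] = D x [:: v; u])
  (D_coercive : forall x, U x -> exists c : R, 0 < c /\ forall u : H,
     c * `|u| ^+ 2 <= D x [:: u; u]).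

Let dotC := dot_le hdot hn.

Definition insert_at (q : nat) (V : seq H) (w : H) : seq H :=
  take (size V - q) V ++ w :: drop (size V - q) V.

Lemma size_insert_at q V w : size (insert_at q V w) = (size V).+1.
Proof. by rewrite size_cat /= addnS -size_cat cat_take_drop. Qed.

Lemma insert_at_cons q V d w : (q <= size V)%N ->
  insert_at q (d :: V) w = d :: insert_at q V w.
Proof. by move=> qV; rewrite /insert_at /= subSn. Qed.

Lemma prod_insert_at q V w :
  \prod_(v <- insert_at q V w) `|v| = `|w| * \prod_(v <- V) `|v|.
Proof.
rewrite /insert_at big_cat big_cons /= mulrCA -big_cat.
by rewrite cat_take_drop.
Qed.

Lemma insert_at_split q s t w : exists s1 t1,
  (size s1 + size t1 = size s + (size t).+1)%N /\
  forall u, insert_at q (s ++ u :: t) w = s1 ++ u :: t1.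
Proof.
have [qt|tq] := leqP q (size t).
  exists s, (insert_at q t w); split; first by rewrite size_insert_at.
  move=> u.
    rewrite /insert_at size_cat /= take_cat drop_cat.
    rewrite (_ : (size s + (size t).+1 - q < size s)%N = false); last first.
      by apply/negbTE; rewrite -leqNgt -addnBA ?leq_addr // leqW.
    rewrite (_ : (size s + (size t).+1 - q - size s = (size t - q).+1)%N).
      by rewrite -catA.
    by rewrite -addnBA ?leqW // addKn subSn.
exists (insert_at (q - (size t).+1) s w), t; split.
  by rewrite size_insert_at addSn addnS.
move=> u.
  rewrite /insert_at size_cat /= take_cat drop_cat subnBA //.
  have [h|h] := ltnP (size s + (size t).+1 - q) (size s).
    by rewrite -catA.
  have -> : (size s + (size t).+1 - q = size s)%N.
    by apply/eqP; rewrite eqn_leq h leq_subLR addnC leq_add2r tq.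
  by rewrite subnn take0 cats0 take_size drop_size -catA.
Qed.

(* The directions of differentiation coming first, [raise_index 2 x [:: u; u]] and
   [raise_index 0 x [:: u; u]] are dual to the derivatives of the metric
   [w |-> 'D_w g(u, u)] and [w |-> 'D_u g(u, w)]. *)
Definition raise_index (q : nat) (x : H) (V : seq H) : H :=
  xget 0 [set z | forall w, dot z w = D x (insert_at q V w)].

Lemma raise_indexP q x V w : U x -> (0 < size V)%N ->
  dot (raise_index q x V) w = D x (insert_at q V w).
Proof.
move=> Ux V0; have V2 : (2 <= (size V).+1)%N by [].
have [Dm _] := Dj.1 _ _ V2 Ux; have [C [C0 HC]] := bml_bound (Dj.1 _ _ V2 Ux).
have [|u|z Hz] := @riesz _ _ _ hdot hn (C * \prod_(v <- V) `|v|)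
  (fun w => D x (insert_at q V w)).
- move=> a u v; apply: Dm.
  by rewrite -size_cat cat_take_drop.
- by rewrite -mulrA [_ * `|u|]mulrC -(prod_insert_at q); apply: HC; rewrite size_insert_at.
rewrite /raise_index; case: xgetP => [y _ -> //|/(_ z)]; by case.
Qed.

Lemma dot_inj y z : (forall w, dot y w = dot z w) -> y = z.
Proof.
move=> yz; apply/eqP; rewrite -subr_eq0 -normr_eq0 -sqrf_eq0 hn.
by rewrite (spDl hdot) (spNl hdot) yz subrr.
Qed.

Lemma raise_index_jet m q : (0 < m)%N -> (q <= m)%N -> jet m U (raise_index q).
Proof.
move=> m0 qm; split=> [k x mk Ux|k x e mk Ux e0].
  have k0 : (0 < k)%N by exact: leq_trans mk.
  have k2 : (2 <= k.+1)%N by [].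
  have [Dm _] := Dj.1 _ _ k2 Ux.
  have [C [C0 HC]] := bml_bound (Dj.1 _ _ k2 Ux).
  split=> [s t a u v stk|].
    apply: dot_inj => w; rewrite (spDl hdot) (spZl hdot).
    rewrite !raise_indexP ?size_cat /= ?addnS // ?stk //.
    have [s1 [t1 [E1 E]]] := insert_at_split q s t w.
    by rewrite !E Dm // E1 addnS stk.
  exists C => w wk; apply: (norm_le_dot hn).
    by rewrite mulr_ge0 // prodn_ge0.
  move=> v; rewrite raise_indexP ?wk //.
  rewrite -mulrA [_ * `|v|]mulrC -(prod_insert_at q).
  by apply: (le_trans (ler_norm _)); apply: HC; rewrite size_insert_at wk.
have k0 : (0 < k)%N by exact: leq_trans mk.
have k2 : (2 <= k.+1)%N by [].
have g := Dj.2 _ _ e k2 Ux e0.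
near=> y => w wk.
have Uy : U y by near: y; exact: open_nbhs_nbhs.
apply: (norm_le_dot hn); first by rewrite !mulr_ge0 ?prodn_ge0 // ltW.
move=> v; rewrite !(spDl hdot) !(spNl hdot) !raise_indexP ?wk //=.
rewrite insert_at_cons ?wk ?(leq_trans qm) //.
rewrite -mulrA [_ * `|v|]mulrC -(prod_insert_at q).
apply: (le_trans (ler_norm _)).
have h : forall w, size w = k.+1 -> `|D y w - D x w - D x (y - x :: w)| <=
                         e * `|y - x| * \prod_(v <- w) `|v|.
  by near: y; exact: g.
by apply: h; rewrite size_insert_at wk.
Unshelve. all: by end_near. Qed.

Lemma jet_scaleB (E F : normedModType R) m (V : set E) (a : R) (G G' : E -> seq E -> F) :
  jet m V G -> jet m V G' -> jet m V (fun x w => a *: G x w - G' x w).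
Proof.
move=> [Gb Gd] [Gb' Gd']; split=> [k x mk Vx|k x e mk Vx e0].
  have [Gm _] := Gb k x mk Vx; have [Gm' _] := Gb' k x mk Vx.
  have [C [C0 HC]] := bml_bound (Gb k x mk Vx).
  have [C' [C'0 HC']] := bml_bound (Gb' k x mk Vx).
  split=> [s t b u v stk|]; first by rewrite Gm // Gm' //; lmodule R; ring.
  exists (`|a| * C + C') => w wk; rewrite mulrDl.
  apply: (le_trans (ler_normB _ _)); apply: lerD; last exact: HC'.
  by rewrite normrZ -mulrA ler_wpM2l // HC.
have ea : 0 < e / 2 / (`|a| + 1) by rewrite !divr_gt0 // ltr_wpDl.
have e2 : 0 < e / 2 by rewrite divr_gt0.
have g := Gd _ _ _ mk Vx ea; have g' := Gd' _ _ _ mk Vx e2.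
near=> y.
have h : forall w, size w = k -> `|G y w - G x w - G x (y - x :: w)|
    <= e / 2 / (`|a| + 1) * `|y - x| * \prod_(v <- w) `|v|.
  by near: y; exact: g.
have h' : forall w, size w = k -> `|G' y w - G' x w - G' x (y - x :: w)|
    <= e / 2 * `|y - x| * \prod_(v <- w) `|v|.
  by near: y; exact: g'.
move=> w wk; have {}h := h w wk; have {}h' := h' w wk.
rewrite (_ : _ - _ = a *: (G y w - G x w - G x (y - x :: w)) -
   (G' y w - G' x w - G' x (y - x :: w))); last by lmodule R; ring.
apply: (le_trans (ler_normB _ _)); rewrite [e in leRHS]splitr !mulrDl.
apply: lerD h'; rewrite normrZ.
have a1 : 0 < `|a| + 1 by rewrite ltr_wpDl.
apply: (@le_trans _ _ ((`|a| + 1) * `|G y w - G x w - G x (y - x :: w)|)).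
  by rewrite ler_wpM2r // lerDl.
by rewrite -ler_pdivlMl //; apply: (le_trans h); rewrite le_eqVlt; apply/orP; left; apply/eqP; ring.
Unshelve. all: by end_near. Qed.

Let A := raise_index 0.
Let N x V := 2^-1 *: raise_index 2 x V - raise_index 0 x V.

Let Aj : jet 1 U A. Proof. exact: raise_index_jet. Qed.
Let Nj : jet 2 U N. Proof. by apply: jet_scaleB; exact: raise_index_jet. Qed.

Let dotA x u w : U x -> dot (A x [:: u]) w = D x [:: u; w].
Proof. by move=> Ux; rewrite raise_indexP. Qed.

Let A_below x0 : U x0 -> exists r c, [/\ 0 < r, 0 < c &
     forall x u, `|x - x0| < r -> c * `|u| <= `|A x [:: u]|].
Proof.
move=> Ux0; have [c [c0 Hc]] := D_coercive Ux0.
have [r [K [r0 K0 HK]]] := jet_lipschitz hdot hn Aj Uo (leqnn 1) Ux0.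
have below u : c * `|u| <= `|A x0 [:: u]|.
  have [->|u0] := eqVneq u 0; first by rewrite normr0 mulr0.
  have up : 0 < `|u| by rewrite normr_gt0.
  rewrite -(ler_pM2r up) -mulrA -expr2; apply: (le_trans (Hc u)).
  rewrite -dotA //; apply: (le_trans (ler_norm _)); exact: dotC.
pose r' := Num.min r (c / 2 / (K + 1)).
exists r', (c / 2); split.
- by rewrite lt_min r0 !divr_gt0 // ltr_wpDl.
- by rewrite divr_gt0.
move=> x u; rewrite lt_min => /andP[xr].
rewrite ltr_pdivlMr ?ltr_wpDl // => xc.
have x0r : `|x0 - x0| < r by rewrite subrr normr0.
have := HK x0 x x0r xr [:: u] erefl; rewrite big_cons big_nil mulr1.
have := below u; have := ler_normD (A x0 [:: u] - A x [:: u]) (A x [:: u]).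
rewrite subrK distrC.
have : K * `|x - x0| * `|u| <= c / 2 * `|u|.
  rewrite ler_wpM2r //; have := normr_ge0 (x - x0); lra.
by rewrite [`|x0 - x|]distrC; lra.
Qed.

Let A_surj x y : U x -> exists z, A x [:: z] = y.
Proof.
move=> Ux; have [c [c0 Hc]] := D_coercive Ux.
have D2 := Dj.1 2%N x (leqnn 2) Ux.
have [C [C0 HC]] := bml_bound D2.
have [||||z Hz] := @lax_milgram R H (fun u v => D x [:: u; v]) c C `|y| (dot y) _ c0 Hc.
- split=> [a u v w|u v]; last exact: D_sym.
  exact: (D2.1 [::] [:: w]).
- by move=> u v; have := HC [:: u; v] erefl; rewrite !big_cons big_nil mulr1 mulrA.
- by move=> a u v; rewrite (spDr hdot) (spZr hdot).
- exact: dotC.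
by exists z; apply: dot_inj => w; rewrite dotA.
Qed.

Let acc := acceleration A N.

Lemma acceleration_koszul x u w : U x ->
  D x [:: acc x u; w] = 2^-1 * D x [:: w; u; u] - D x [:: u; u; w].
Proof.
move=> Ux; rewrite -dotA // (solveP A_surj) // (spDl hdot) (spNl hdot) (spZl hdot).
by rewrite !raise_indexP.
Qed.

Theorem geodesic_bvp (x0 : H) (r : R) : U x0 -> 0 < r ->
  exists rho C : R, [/\ 0 < rho, 0 <= C & forall (x p : H) (tau : R),
    `|x - x0| <= rho -> `|p| <= rho -> 0 < tau <= 1 ->
    exists c c1 c2 : R -> H, [/\ c 0 = x, c tau = x + tau *: p,
      forall t, `|t| <= 2 -> [/\ U (c t), `|c t - x0| < r & `|c1 t - p| <= C * `|p| ^+ 2],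
      forall t, `|t| <= 2 -> [/\ has_deriv c t (c1 t), has_deriv c1 t (c2 t) &
        forall w, D (c t) [:: c2 t; w] =
          2^-1 * D (c t) [:: w; c1 t; c1 t] - D (c t) [:: c1 t; c1 t; w]] &
      (forall t, `|t| <= 2 -> D (c t) [:: c1 t; c1 t] = D x [:: c1 0; c1 0]) /\
      (forall k, Ck `]-2, 2[ k c)]].
Proof.
move=> Ux0 r0.
have [r1 [K [r10 K0 HU Hb Hl]]] := acceleration_bounds hdot hn Uo Aj A_below A_surj Nj Ux0.
pose r2 := Num.min r r1.
have r20 : 0 < r2 by rewrite lt_min r0.
have r2P x : `|x - x0| < r2 -> `|x - x0| < r /\ `|x - x0| < r1.
  by rewrite lt_min => /andP.
have [||rho [rho0 HB]] := @second_order_bvp R H dot hdot hn acc x0 r2 K K0 _ _ r20.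
- by move=> x v /r2P[_ /Hb].
- by move=> x y u v B /r2P[_ xr] /r2P[_ yr]; exact: Hl.
exists rho, (4 * (25 * K)); split=> //; first by rewrite !mulr_ge0 // ltW.
move=> x p tau xr pr tau01.
have [c [c1 [cx ctau Hc]]] := HB x p tau xr pr tau01.
exists c, c1, (fun t => acc (c t) (c1 t)).
have cU t : `|t| <= 2 -> U (c t) by move=> /Hc[/r2P[_ /HU]].
have Jin (t : R) : `]-2, 2[%classic t -> `|t| <= 2.
  by rewrite /= in_itv /= ler_norml => /andP[/ltW-> /ltW->].
have Jo : open (`]-2, 2[%classic : set R) by exact: interval_open.
split=> // [t t2|t t2|].
- by have [/r2P[cr _] _ _ cp] := Hc t t2; split=> //; [exact: cU|rewrite -[leRHS]mulrA].
- have [_ cd c1d _] := Hc t t2; split=> // w.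
  exact/acceleration_koszul/cU.
split.
  move=> t t2; rewrite -cx.
  pose e s : R := D (c s) [:: c1 s; c1 s].
  have ed s : -2 <= s <= 2 -> has_deriv (e : R -> R^o) s 0.
    rewrite -ler_norml => s2; have [_ cd c1d _] := Hc s s2.
    have := jet_curve Dj (leqnn 2) (cU s s2) cd
      (conj c1d (conj c1d I) : list_deriv s [:: c1; c1]
        [:: acc (c s) (c1 s); acc (c s) (c1 s)]) erefl.
    rewrite /= addr0 (D_sym (c1 s) (acc (c s) (c1 s)) (cU s s2)).
    rewrite acceleration_koszul; last exact: cU.
    set k3 := D (c s) [:: c1 s; c1 s; c1 s].
    rewrite (_ : _ + _ = 0 :> R) //; lra.
  apply: (deriv0_constant ed (s := 0) (t := t)); last by rewrite -ler_norml.
  by apply/andP; split; lra.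
suff : forall k, Ck `]-2, 2[ k c /\ Ck `]-2, 2[ k c1 by move=> h k; case: (h k).
elim=> //= k [ck c1k]; split.
  by exists c1; split=> // t /Jin/Hc[].
exists (fun t => acc (c t) (c1 t)); split; first by move=> t /Jin/Hc[].
apply: (Ck_solve Uo Aj A_below A_surj) => //; first by move=> t /Jin/cU.
apply: (@Ck_jet _ _ Jo _ _ 2 U N k 2 c [:: c1; c1]) => //.
by move=> t /Jin/cU.
Qed.

End GeodesicEquation.

Section ChartSemiconvexity.
Context (R : realType) (H : completeNormedModType R) (dot : {dot H for idfun}).
Hypothesis (hdot : hilbert_product dot).
Context (M : riemannian_manifold H) (i : rm_index M).

Let ds := dot_scalar_product dot.
Let U : set H := rm_chart i @` rm_dom i.
Let Uo : open U. Proof. exact: rm_image_open. Qed.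

Lemma chart_paramK x : U x -> rm_chart i (rm_param i x) = x.
Proof. by move=> [p pi <-]; rewrite rm_chartK. Qed.

Lemma param_dom x : U x -> rm_dom i (rm_param i x).
Proof. by move=> [p pi <-]; rewrite rm_chartK. Qed.

Section MetricJet.
Context (D : H -> seq H -> R^o) (Dj : jet 2 U D)
  (D_metric : forall (x : H) (w : seq H), U x -> size w = 2%N ->
     D x w = rm_metric i (rm_param i x) w`_0 w`_1).

Lemma local_metric_jet u v x : U x -> local_metric i u v x = D x [:: u; v].
Proof. by move=> Ux; rewrite D_metric. Qed.

Lemma metric_jet_sym x u v : U x -> D x [:: u; v] = D x [:: v; u].
Proof.
move=> Ux; rewrite !D_metric //=.
exact: (sp_sym (dot_scalar_product _)).
Qed.

Lemma metric_jet_coercive x : U x -> exists c : R, 0 < c /\ forall u : H,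
  c * `|u| ^+ 2 <= D x [:: u; u].
Proof.
move=> Ux; have [c [C [c0 Hc]]] := rm_metric_equivalent (param_dom Ux).
by exists c; split=> // u; rewrite D_metric //=; have /andP[] := Hc u.
Qed.

Lemma derive_line (E F : normedModType R) (g : E -> F) x u d :
  has_deriv (fun s : R => g (x + s *: u)) 0 d -> 'D_u g x = d.
Proof.
move=> /has_derivP[_ <-]; rewrite /derive.
suff -> : (fun h : R => h^-1 *: ((g \o shift x) (h *: u) - g x)) =
  (fun h : R => h^-1 *: (((fun s : R => g (x + s *: u)) \o shift 0) h%:A
     - g (x + 0 *: u))) by [].
apply/funext => h /=; congr (_ *: (g _ - g _)); last by lmodule R; ring.
by rewrite addr0 [h%:A]mulr1 addrC.
Qed.

Lemma derive_local_metric u v w x : U x ->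
  'D_u (local_metric i v w) x = D x [:: u; v; w].
Proof.
move=> Ux; apply: derive_line.
have Ux0 : U (x + 0 *: u) by rewrite scale0r addr0.
have := jet_curve_cst Dj (leqnn 2) Ux0 (has_deriv_affine x u 0) (erefl : size [:: v; w] = 2%N).
rewrite scale0r addr0; apply: has_deriv_ext.
have [r [K [r0 _ HU]]] := jet_bounded Dj Uo (leqnn 2) Ux.
near=> s; rewrite local_metric_jet //.
suff /HU[] : `|x + s *: u - x| < r by [].
rewrite (_ : _ - x = s *: u); last by lmodule R; ring.
rewrite normrZ.
apply: (@le_lt_trans _ _ (`|s| * (`|u| + 1))); first by rewrite ler_wpM2l // lerDl.
rewrite -ltr_pdivlMr ?ltr_wpDl // -[s]subr0.
by near: s; apply: near_lt_dist; rewrite divr_gt0 // ltr_wpDl.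
Unshelve. all: by end_near. Qed.

Lemma Ck_rescale (E : normedModType R) (J : set R) k (a : R) (phi : R -> E) :
  Ck J k phi -> Ck [set t | J (a * t)] k (fun t => phi (a * t)).
Proof.
elim: k phi => //= k IH phi [phi' [pd pk]].
exists (fun t => a *: phi' (a * t)); split; last exact/CkZ/IH.
by move=> t Jt; apply: has_deriv_rescale; exact: pd.
Qed.

Context (c c1 c2 : R -> H).
Hypotheses (cU : forall t : R, `|t| <= 2 -> U (c t))
  (cd : forall t, `|t| <= 2 -> [/\ has_deriv c t (c1 t), has_deriv c1 t (c2 t) &
        forall w, D (c t) [:: c2 t; w] =
          2^-1 * D (c t) [:: w; c1 t; c1 t] - D (c t) [:: c1 t; c1 t; w]])
  (ck : forall k, Ck `]-2, 2[ k c).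

Lemma rescaled_unit_geodesic (l : R) : 0 < l ->
  (forall t, `|t| <= 2 -> D (c t) [:: c1 t; c1 t] = l ^+ 2) ->
  unit_geodesic `]-2 * l, 2 * l[%classic (fun s => rm_param i (c (l^-1 * s))).
Proof.
move=> l0 speed t tI.
set J := `]-2 * l, 2 * l[%classic; have Jo : open (J : set R) by exact: interval_open.
have Jin (s : R) : J s -> `]-2, 2[%classic (l^-1 * s).
  by rewrite /J /= !in_itv /= ltr_pdivlMl // ltr_pdivrMl // ![l * _]mulrC.
have J2 (s : R) : J s -> `|l^-1 * s| <= 2.
  by move=> /Jin; rewrite /= in_itv /= ler_norml => /andP[/ltW-> /ltW->].
exists i, J; set sg := fun s => rm_param i (c (l^-1 * s)).
set ct : R -> H := rm_chart i \o sg; cbv zeta.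
have ctE (s : R) : J s -> ct s = c (l^-1 * s).
  by move=> Js; rewrite /ct /= /sg chart_paramK //; exact/cU/J2.
have ctd (s : R) : J s -> has_deriv ct s (l^-1 *: c1 (l^-1 * s)).
  move=> Js; have [h _ _] := cd (J2 s Js).
  apply: (has_deriv_ext _ (has_deriv_rescale h)).
  by near=> r; rewrite ctE //; near: r; exact: open_nbhs_nbhs.
have ctdd (s : R) : J s -> has_deriv (derive1 ct) s (l^-1 *: (l^-1 *: c2 (l^-1 * s))).
  move=> Js; have [_ h _] := cd (J2 s Js).
  apply: (has_deriv_ext _ (has_derivZ l^-1 (has_deriv_rescale h))).
  near=> r; apply/esym; apply: has_deriv1; apply: ctd.
  by near: r; exact: open_nbhs_nbhs.
split=> //.
- by move=> s Js; apply: param_dom; exact/cU/J2.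
- apply: (Ck_smooth Jo) => k.
  apply: (@Ck_ext _ _ Jo _ k (fun s => c (l^-1 * s))).
    by move=> s Js; rewrite ctE.
  have := @Ck_rescale H _ k l^-1 c (ck k).
  rewrite (_ : [set t | _] = J) //; apply/seteqP; split=> s /=; rewrite /J /= !in_itv /=;
  by rewrite ltr_pdivlMl // ltr_pdivrMl // ![l * _]mulrC.
- move=> s Js; have Us := cU (J2 s Js).
  rewrite (has_deriv1 (ctd s Js)) (has_deriv1 (ctdd s Js)) ctE //.
  set x := c _ in Us *; set u := c1 _; set a := c2 _.
  have D2 := Dj.1 2%N x (leqnn 2) Us; have D3 := Dj.1 3%N x isT Us.
  split; last first.
    rewrite local_metric_jet //.
    rewrite (@bmlZ _ _ _ 2 _ [::] [:: l^-1 *: u] _ _ D2) //=.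
    rewrite (@bmlZ _ _ _ 2 _ [:: u] [::] _ _ D2) //=.
    rewrite (speed _ (J2 s Js)) /GRing.scale /=; field.
    by rewrite gt_eqF.
  move=> w; rewrite local_metric_jet // !derive_local_metric //.
  have [_ _ h] := cd (J2 s Js).
  have eN : - (l^-1 *: (l^-1 *: a)) = (- l^-2) *: a by lmodule R; field; rewrite gt_eqF.
  rewrite eN (@bmlZ _ _ _ 2 _ [::] [:: w] _ _ D2) //= h -/x -/u.
  rewrite (@bmlZ _ _ _ 3 _ [::] [:: l^-1 *: u; w] _ _ D3) //=.
  rewrite (@bmlZ _ _ _ 3 _ [:: u] [:: w] _ _ D3) //=.
  rewrite (@bmlZ _ _ _ 3 _ [:: w] [:: l^-1 *: u] _ _ D3) //=.
  rewrite (@bmlZ _ _ _ 3 _ [:: w; u] [::] _ _ D3) //=.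
  by rewrite /GRing.scale /=; field; rewrite gt_eqF.
Unshelve. all: by end_near. Qed.

Context (f : M -> R) (f_convex : geodesically_convex f).

Lemma convex_along_geodesic (l0 : R) :
  (forall t, `|t| <= 2 -> D (c t) [:: c1 t; c1 t] = l0) ->
  forall s t (a : R), `|s| < 2 -> `|t| < 2 -> 0 <= a <= 1 ->
    f (rm_param i (c ((1 - a) * s + a * t))) <=
      (1 - a) * f (rm_param i (c s)) + a * f (rm_param i (c t)).
Proof.
move=> speed s t a s2 t2 /andP[a0 a1].
have z2 : `|0 : R| <= 2 by rewrite normr0.
have l0ge : 0 <= l0.
  have [k [k0 Hk]] := metric_jet_coercive (cU z2).
  by rewrite -(speed 0 z2); apply: le_trans (Hk _); rewrite mulr_ge0 ?exprn_ge0 // ltW.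
have [l00|l0n] := eqVneq l0 0.
  have c10 x : -2 <= x <= 2 -> `|c1 x| <= 0.
    rewrite -ler_norml => x2; have [k [k0 Hk]] := metric_jet_coercive (cU x2).
    have := Hk (c1 x); rewrite speed // l00 pmulr_rle0 // => h.
    rewrite normr_le0 -normr_eq0 -sqrf_eq0 eq_le h sqr_ge0 //.
  have cst x : `|x| < 2 -> c x = c 0.
    move=> x2; apply/eqP; rewrite -subr_eq0 -normr_le0 -[leRHS](mul0r `|x - 0|).
    apply: (mean_value ds hdot (c' := c1) (a := -2) (b := 2)) => //.
    - by move=> y; rewrite -ler_norml => /cd[].
    - by rewrite -ler_norml normr0.
    - by rewrite -ler_norml ltW.
  have cv : `|(1 - a) * s + a * t| < 2.
    apply: (le_lt_trans (ler_normD _ _)); rewrite !normrM (ger0_norm a0).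
    rewrite ger0_norm ?subr_ge0 //.
    have [->|an] := eqVneq a 1; first by rewrite subrr mul0r add0r mul1r.
    have : (1 - a) * `|s| < (1 - a) * 2.
      by rewrite ltr_pM2l // subr_gt0 lt_neqAle an.
    have : a * `|t| <= a * 2 by rewrite ler_wpM2l // ltW.
    by lra.
  by rewrite !cst // -mulrDl subrK mul1r.
have l0p : 0 < l0 by rewrite lt_neqAle eq_sym l0n.
pose l := Num.sqrt l0; have lp : 0 < l by rewrite sqrtr_gt0.
have := rescaled_unit_geodesic lp; rewrite /l sqr_sqrtr // => /(_ speed) ug.
have itvI (b d : R) : is_interval `]b, d[%classic by exact: interval_is_interval.
have /= := f_convex (itvI _ _) ug.
have a1' : 0 <= 1 - a by rewrite subr_ge0.
have a1'' : 1 - a <= 1 by rewrite gerBl.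
move=> /(_ (Itv01 a1' a1'') (l * s) (l * t)); rewrite -/l.
have inI x : `|x| < 2 -> l * x \in `]-2 * l, 2 * l[%classic.
  by rewrite inE /= in_itv /= ltr_norml ![_ * l]mulrC !ltr_pM2l.
move=> /(_ (inI _ s2) (inI _ t2)); rewrite convRE /= /unstable.onem subKr.
rewrite !mulKf ?gt_eqF // (_ : l^-1 * _ = (1 - a) * s + a * t) //.
by rewrite /conv /= /unstable.onem subKr /GRing.scale /=; field; rewrite gt_eqF.
Qed.

End MetricJet.

Context (f : M -> R) (f_convex : geodesically_convex f) (f_bounded : locally_bounded f).
Let g : H -> R := f \o rm_param i.

Lemma chart_geodesics (x0 : H) (r : R) : U x0 -> 0 < r ->
  exists rho C : R, [/\ 0 < rho, 0 <= C & forall (x p : H) (tau : R),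
    `|x - x0| <= rho -> `|p| <= rho -> 0 < tau <= 1 ->
    exists c c1 : R -> H, [/\ c 0 = x, c tau = x + tau *: p,
      forall t, `|t| <= 2 -> [/\ has_deriv c t (c1 t), `|c t - x0| < r
         & `|c1 t - p| <= C * `|p| ^+ 2] &
      forall s t (a : R), `|s| < 2 -> `|t| < 2 -> 0 <= a <= 1 ->
        g (c ((1 - a) * s + a * t)) <= (1 - a) * g (c s) + a * g (c t)]].
Proof.
move=> Ux0 r0; have [D [Dm Db Dd]] := rm_metric_smooth i.
have Dj : jet 2 U D by split.
have [rho [C [rho0 C0 HB]]] := geodesic_bvp ds hdot Uo Dj
  (fun x u v Ux => metric_jet_sym Dm u v Ux) (fun x Ux => metric_jet_coercive Dm Ux) Ux0 r0.
exists rho, C; split=> // x p tau xr pr tau01.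
have [c [c1 [c2 [cx ctau Hc cd [speed ck]]]]] := HB x p tau xr pr tau01.
exists c, c1; split=> // [t t2|].
  by have [? ? ?] := Hc t t2; have [? _ _] := cd t t2.
apply: (convex_along_geodesic Dj Dm _ cd ck f_convex speed).
by move=> t /Hc[].
Qed.

Lemma chart_bounded (x0 : H) : U x0 ->
  exists r K : R, 0 < r /\ forall x, `|x - x0| < r -> `|g x| <= K.
Proof.
move=> Ux0; have [p pd px0] := Ux0.
have /ex_bound[K HK] := f_bounded p.
have cp := rm_param_continuous pd; rewrite px0 in cp.
have E : rm_param i x0 = p by rewrite -px0 rm_chartK.
have : nbhs (rm_param i x0) [set x | `|f x| <= K] by rewrite E.
move=> /cp /nbhs_ballP[r /= r0 Hr]; exists r, K; split=> // x xr.
by apply: Hr; rewrite -ball_normE /= distrC.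
Qed.

Lemma chart_lipschitz (x0 : H) : U x0 ->
  exists r L : R, [/\ 0 < r, 0 <= L & forall x y, `|x - x0| < r -> `|y - x0| < r ->
    `|g x - g y| <= L * `|x - y|].
Proof.
move=> Ux0; have [r [K [r0 HK]]] := chart_bounded Ux0.
have [rho [C [rho0 C0 HB]]] := chart_geodesics Ux0 r0.
have K0 : 0 <= K.
  by apply: le_trans (normr_ge0 _) (HK x0 _); rewrite subrr normr0.
exists (rho / 2), (2 * K / rho); split; first by rewrite divr_gt0.
  by rewrite divr_ge0 ?mulr_ge0 // ltW.
suff W x y : `|x - x0| < rho / 2 -> `|y - x0| < rho / 2 ->
    g y - g x <= 2 * K / rho * `|y - x|.
  move=> x y xr yr; rewrite ler_norml; apply/andP; split.
    by rewrite lerNl opprB distrC; exact: W.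
  exact: W.
move=> xr yr; have [->|yx] := eqVneq y x; first by rewrite !subrr normr0 mulr0.
have d0 : 0 < `|y - x| by rewrite normr_gt0 subr_eq0.
have drho : `|y - x| <= rho.
  rewrite (_ : y - x = (y - x0) - (x - x0)); last by lmodule R; ring.
  by apply: (le_trans (ler_normB _ _)); lra.
pose tau := `|y - x| / rho.
have tau0 : 0 < tau by rewrite divr_gt0.
have tau1 : tau <= 1 by rewrite ler_pdivrMr // mul1r.
have [|||c [c1 [cx cy Hc cc]]] := HB x (tau^-1 *: (y - x)) tau.
- by rewrite ltW // (lt_trans xr) // ltr_pdivrMr // ltr_pMr // ltr1n.
- rewrite normrZ gtr0_norm ?invr_gt0 // /tau invf_div mulfVK ?gt_eqF //.
- by rewrite tau0.
move: cy; rewrite scalerA divff ?gt_eqF // scale1r addrC subrK => cy.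
have h0 : `|0 : R| < 2 by rewrite normr0.
have h1 : `|1 : R| < 2 by rewrite normr1 ltr1n.
have tau01 : 0 <= tau <= 1 by rewrite (ltW tau0).
have := cc 0 1 tau h0 h1 tau01.
rewrite mulr0 add0r mulr1 cx cy => h.
have [_ c1r _] := Hc 1 (ltW h1).
have := HK _ c1r; rewrite ler_norml => /andP[_ g1].
have xr' : `|x - x0| < r by have [_ + _] := Hc 0 (ltW h0); rewrite cx.
have := HK _ xr'; rewrite ler_norml => /andP[g0 _].
rewrite (_ : 2 * K / rho * _ = tau * (2 * K)); last by rewrite /tau; ring.
have : tau * (g (c 1) - g x) <= tau * (2 * K) by rewrite ler_wpM2l ?(ltW tau0) //; lra.
by lra.
Qed.

(* Comparison of the geodesic [c] from [x] to [y] with the segment: [c' - (y - x)]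
   is [O(|y - x|^2)], and the two curves agree at both end points. *)
Lemma chart_semiconvex (x0 : H) : U x0 ->
  exists r L C : R, [/\ 0 < r, 0 <= C,
    forall x, `|x - x0| < r -> U x,
    forall x y, `|x - x0| < r -> `|y - x0| < r -> `|g x - g y| <= L * `|x - y| &
    forall x y a, `|x - x0| < r -> `|y - x0| < r -> 0 <= a <= 1 ->
      g ((1 - a) *: x + a *: y) <=
        (1 - a) * g x + a * g y + C * (a * (1 - a)) * `|x - y| ^+ 2].
Proof.
move=> Ux0; have [r1 [L [r10 L0 HL]]] := chart_lipschitz Ux0.
have [r2 /= r20 HU] : nbhs_ball x0 U by apply/nbhs_ballP; exact: open_nbhs_nbhs.
have [rho [C [rho0 C0 HB]]] := chart_geodesics Ux0 r10.
pose r := Num.min (Num.min r1 r2) (rho / 2).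
have rP x : `|x - x0| < r -> [/\ `|x - x0| < r1, `|x - x0| < r2 & `|x - x0| < rho / 2].
  by rewrite !lt_min => /andP[/andP[-> ->] ->].
exists r, L, (2 * L * C); split.
- by rewrite !lt_min r10 r20 divr_gt0.
- by rewrite !mulr_ge0.
- by move=> x /rP[_ xr _]; apply: HU; rewrite -ball_normE /= distrC.
- by move=> x y /rP[xr _ _] /rP[yr _ _]; exact: HL.
move=> x y a xr yr /andP[a0 a1].
have [xr1 _ xrho] := rP x xr; have [yr1 _ yrho] := rP y yr.
pose p := y - x.
have pr : `|p| <= rho.
  rewrite (_ : p = (y - x0) - (x - x0)); last by rewrite /p; lmodule R; ring.
  by apply: (le_trans (ler_normB _ _)); lra.
have h01 : ((0 : R) < (1 : R)) && ((1 : R) <= 1) by rewrite ltr01 lexx.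
have xr' : `|x - x0| <= rho by lra.
have [c [c1 [cx cy Hc cc]]] := HB x p 1 xr' pr h01.
move: cy; rewrite scale1r addrC subrK => cy.
have two (t : R) : 0 <= t <= 1 -> `|t| < 2.
  by move=> /andP[t0 t1]; rewrite ger0_norm // (le_lt_trans t1) // ltr1n.
have a01 : 0 <= a <= 1 by rewrite a0.
have := cc 0 1 a; rewrite !two ?ler01 ?lexx // => /(_ isT isT a01).
rewrite mulr0 add0r mulr1 cx cy => h.
pose e t := c t - (x + t *: p).
have ed t : 0 <= t <= 1 -> has_deriv e t (c1 t - p).
  move=> /two/ltW/Hc[h1 _ _]; apply: has_derivB => //; exact: has_deriv_affine.
have eb t : 0 <= t <= 1 -> `|c1 t - p| <= C * `|p| ^+ 2 by move=> /two/ltW/Hc[].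
have MV := mean_value ds hdot ed eb.
have e0 : e 0 = 0 by rewrite /e cx scale0r addr0 subrr.
have e1 : e 1 = 0 by rewrite /e cy /p scale1r; lmodule R; ring.
have h0 : ((0 : R) <= (0 : R)) && ((0 : R) <= 1) by rewrite lexx ler01.
have h1 : ((0 : R) <= (1 : R)) && ((1 : R) <= 1) by rewrite ler01 lexx.
have := MV 0 a h0 a01; rewrite e0 !subr0 (ger0_norm a0) => ea0.
have := MV 1 a h1 a01; rewrite e1 subr0 [`|a - 1|]distrC ger0_norm ?subr_ge0 // => ea1.
have Cp : 0 <= C * `|p| ^+ 2 by rewrite mulr_ge0 ?exprn_ge0.
have ea : `|e a| <= 2 * (a * (1 - a)) * (C * `|p| ^+ 2).
  have [ah|ah] := lerP a 2^-1.
    apply: (le_trans ea0); rewrite mulrC ler_wpM2r //.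
    have : 0 <= a * (2^-1 - a) by rewrite mulr_ge0 // subr_ge0.
    by lra.
  apply: (le_trans ea1); rewrite mulrC ler_wpM2r //.
  have : 0 <= (1 - a) * (a - 2^-1) by rewrite mulr_ge0 // subr_ge0 // ltW.
  by lra.
have [_ car _] := Hc a (ltW (two a a01)).
have xa : (1 - a) *: x + a *: y = x + a *: p by rewrite /p; lmodule R; ring.
have xar : `|x + a *: p - x0| < r1.
  rewrite -xa (_ : _ - x0 = (1 - a) *: (x - x0) + a *: (y - x0)); last first.
    by lmodule R; ring.
  apply: (le_lt_trans (ler_normD _ _)); rewrite !normrZ (ger0_norm a0) ger0_norm ?subr_ge0 //.
  have m0 : Num.max `|x - x0| `|y - x0| < r1 by rewrite gt_max xr1 yr1.
  have g1 : (1 - a) * `|x - x0| <= (1 - a) * Num.max `|x - x0| `|y - x0|.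
    by rewrite ler_wpM2l ?subr_ge0 // le_max lexx.
  have g2 : a * `|y - x0| <= a * Num.max `|x - x0| `|y - x0|.
    by rewrite ler_wpM2l // le_max lexx orbT.
  by lra.
have := HL _ _ car xar; rewrite -/(e a) ler_norml => /andP[+ _].
rewrite xa => hl.
have : L * `|e a| <= L * (2 * (a * (1 - a)) * (C * `|p| ^+ 2)) by rewrite ler_wpM2l.
have -> : `|x - y| = `|p| by rewrite distrC.
by lra.
Qed.

End ChartSemiconvexity.

(** * Convex functions on a ball of a Hilbert space *)

Lemma frechet_differentiable (R : realType) (E F : normedModType R) (f : E -> F)
    (x : E) (phi : E -> F) (K : R) :
  (forall a u v, phi (a *: u + v) = a *: phi u + phi v) ->
  (forall u, `|phi u| <= K * `|u|) ->
  (forall e : R, 0 < e -> \forall y \near x,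
     `|f y - f x - phi (y - x)| <= e * `|y - x|) ->
  differentiable f x.
Proof.
move=> phiL phiK hf.
pose pm := GRing.isLinear.Build R E F *:%R phi phiL.
pose pl : {linear E -> F} := HB.pack phi pm.
have cpl : continuous pl.
  move=> y; apply/cvgrPdist_le => e e0; near=> z.
  have K1 : 0 < `|K| + 1 by rewrite ltr_wpDl.
  rewrite -linearB; apply: (le_trans (phiK _)).
  apply: (@le_trans _ _ ((`|K| + 1) * `|y - z|)).
    by rewrite ler_wpM2r // (le_trans (ler_norm _)) // lerDl.
  rewrite -ler_pdivlMl // distrC ltW //.
  by near: z; apply: near_lt_norm; rewrite mulr_gt0 // invr_gt0.
have hexp : f \o shift x = cst (f x) + pl +o_ (0 : E) id.
  apply/eqaddoP => e e0; have := hf e e0.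
  rewrite (near_shift 0) subr0; apply: filterS => y /=; rewrite addrK.
  rewrite (_ : (f \o shift x - (cst (f x) + pl)) y = f (y + x) - f x - phi y) //.
  by rewrite /= /cst !fctE /= opprD addrA.
have dE := diff_unique cpl hexp.
apply/diff_locallyP; rewrite dE; split=> //.
Unshelve. all: by end_near. Qed.

Section ConvexOnBall.
Context (R : realType) (H : completeNormedModType R) (x0 : H) (r L : R) (h : H -> R).
Hypotheses (L0 : 0 <= L)
  (h_lip : forall x y, `|x - x0| < r -> `|y - x0| < r -> `|h x - h y| <= L * `|x - y|).

(* For a convex function this amounts to Frechet differentiability at [x]. *)
Definition second_difference_small (x : H) : Prop :=
  forall e : R, 0 < e -> exists d : R, [/\ 0 < d, `|x - x0| + d < r &
    forall v, `|v| <= d -> h (x + v) + h (x - v) - 2 * h x <= e * d].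

Section Convex.
Hypothesis h_convex : forall x y a, `|x - x0| < r -> `|y - x0| < r -> 0 <= a <= 1 ->
  h ((1 - a) *: x + a *: y) <= (1 - a) * h x + a * h y.

Context (x : H) (s0 : R) (xs0 : `|x - x0| + s0 < r) (s00 : 0 < s0).

Let inball v : `|v| <= s0 -> `|x + v - x0| < r.
Proof.
move=> vs; rewrite addrAC; apply: le_lt_trans (ler_normD _ _) _.
by apply: le_lt_trans xs0; rewrite lerD2l.
Qed.

Let xball : `|x - x0| < r.
Proof. by have := @inball 0; rewrite addr0 normr0; apply; exact: ltW. Qed.

Let radial v t : `|v| <= s0 -> 0 <= t <= 1 ->
  h (x + t *: v) - h x <= t * (h (x + v) - h x).
Proof.
move=> vs t01; have := h_convex xball (inball vs) t01.
rewrite (_ : (1 - t) *: x + _ = x + t *: v); last by lmodule R; ring.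
by lra.
Qed.

Let quotients v := [set q | exists2 t, 0 < t /\ `|t *: v| <= s0
  & q = (h (x + t *: v) - h x) / t].

Definition slope v := inf (quotients v).

Let quot_lb v : lbound (quotients v) (- (L * `|v|)).
Proof.
move=> _ [t [t0 tv] ->]; rewrite ler_pdivlMr //.
have := h_lip (inball tv) xball; rewrite [x + _]addrC addrK normrZ gtr0_norm //.
by rewrite ler_norml => /andP[+ _]; lra.
Qed.

Let quot_inf v : has_inf (quotients v).
Proof.
split; last by exists (- (L * `|v|)); exact: quot_lb.
pose t := s0 / (`|v| + 1); have v1 : 0 < `|v| + 1 by rewrite ltr_wpDl.
have t0 : 0 < t by rewrite divr_gt0.
exists ((h (x + t *: v) - h x) / t), t => //; split=> //.
rewrite normrZ gtr0_norm // /t mulrAC ler_pdivrMr // ler_wpM2l ?(ltW s00) //.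
by rewrite lerDl.
Qed.

Lemma slope_le v t : 0 < t -> `|t *: v| <= s0 -> t * slope v <= h (x + t *: v) - h x.
Proof.
move=> t0 tv; rewrite mulrC -ler_pdivlMr //.
by apply: ge_inf; [exact: (quot_inf v).2|exists t].
Qed.

Hypothesis x_sd : second_difference_small x.

Let sd_radial e : 0 < e -> exists d : R, [/\ 0 < d, d <= s0 &
  forall v, `|v| <= d -> h (x + v) + h (x - v) - 2 * h x <= e * `|v|].
Proof.
move=> e0; have [d [d0 xd Hd]] := x_sd e0.
exists (Num.min d s0); split; first by rewrite lt_min d0.
  by rewrite ge_min lexx orbT.
move=> v; rewrite le_min => /andP[vd vs].
have [->|vn] := eqVneq v 0; first by rewrite addr0 subr0 normr0 mulr0; lra.
have vp : 0 < `|v| by rewrite normr_gt0.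
pose w := (d / `|v|) *: v.
have wd : `|w| = d by rewrite normrZ gtr0_norm ?divr_gt0 // divfK ?gt_eqF.
have wb u : `|u| = d -> `|x + u - x0| < r.
  move=> ud; rewrite addrAC; apply: le_lt_trans (ler_normD _ _) _.
  by rewrite ud.
pose t := `|v| / d.
have t01 : 0 <= t <= 1.
  by rewrite divr_ge0 ?(ltW d0) //= ler_pdivrMr // mul1r.
have vE : v = t *: w.
  rewrite /w /t scalerA (_ : _ * _ = 1) ?scale1r //.
  by field; rewrite !gt_eqF.
have c1 := h_convex xball (wb w wd) t01.
have wNd : `|- w| = d by rewrite normrN.
have c2 := h_convex xball (wb (- w) wNd) t01.
rewrite (_ : (1 - t) *: x + _ = x + v) in c1; last by rewrite vE; lmodule R; ring.
rewrite (_ : (1 - t) *: x + _ = x - v) in c2; last by rewrite vE; lmodule R; ring.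
have := Hd w; rewrite wd => /(_ (lexx _)) hw.
have [t0 _] := andP t01.
have : t * (h (x + w) + h (x - w) - 2 * h x) <= t * (e * d) by rewrite ler_wpM2l.
have -> : t * (e * d) = e * `|v| by rewrite /t; field; rewrite gt_eqF.
by lra.
Qed.

Let slope_approx e : 0 < e -> exists d : R, [/\ 0 < d, d <= s0 &
  forall v t, 0 < t -> `|t *: v| <= d ->
    h (x + t *: v) - h x <= t * slope v + e * (t * `|v|)].
Proof.
move=> e0; have [d [d0 ds Hd]] := sd_radial e0.
exists d; split=> // v t t0 tvd; have tvs := le_trans tvd ds.
have := Hd _ tvd; rewrite normrZ gtr0_norm // => hd.
suff : (h (x + t *: v) - h x) / t - e * `|v| <= slope v.
  rewrite lerBlDr ler_pdivrMr // => /le_trans; apply.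
  by rewrite le_eqVlt; apply/orP; left; apply/eqP; ring.
apply: lb_le_inf; first exact: (quot_inf v).1.
move=> _ [t1 [t10 t1v] ->].
rewrite lerBlDr ler_pdivrMr //.
have [tt|tt] := lerP t t1.
  have t01 : 0 <= t / t1 <= 1.
    by rewrite divr_ge0 ?(ltW t0) ?(ltW t10) //= ler_pdivrMr // mul1r.
  have := radial t1v t01; rewrite scalerA divfK ?gt_eqF // => /le_trans; apply.
  rewrite [leRHS](_ : _ = t / t1 * (h (x + t1 *: v) - h x) + e * `|v| * t); last by ring.
  by rewrite lerDl !mulr_ge0 // ltW.
have t01 : 0 <= t1 / t <= 1.
  by rewrite divr_ge0 ?(ltW t0) ?(ltW t10) //= ler_pdivrMr // mul1r ltW.
have tvNs : `|- (t *: v)| <= s0 by rewrite normrN.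
have := radial tvNs t01; rewrite scalerN scalerA divfK ?gt_eqF // => hr.
have t1Ns : `|- (t1 *: v)| <= s0 by rewrite normrN.
have half : ((0 : R) <= 2^-1) && ((2^-1 : R) <= 1) by apply/andP; split; lra.
have := h_convex (inball t1v) (inball t1Ns) half.
rewrite (_ : (1 - 2^-1) *: _ + _ = x); last by lmodule R; field.
move=> hm.
have hdt : t1 / t * (h (x + t *: v) + h (x - t *: v) - 2 * h x) <= t1 / t * (e * (t * `|v|)).
  by rewrite ler_wpM2l // divr_ge0 ?ltW.
have e1 : t1 / t * (e * (t * `|v|)) = e * `|v| * t1 by field; rewrite gt_eqF.
have hfin : t1 / t * (h (x + t *: v) - h x) <= h (x + t1 *: v) - h x + e * `|v| * t1.
  by lra.
have : t1 * (h (x + t *: v) - h x) <= (h (x + t1 *: v) - h x + e * `|v| * t1) * t.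
  by rewrite -ler_pdivrMr // mulrAC.
move=> hh; rewrite -(ler_pM2l t10); apply: (le_trans hh).
by rewrite le_eqVlt; apply/orP; left; apply/eqP; field; rewrite gt_eqF.
Qed.

Let slope_small v w : (forall e : R, 0 < e -> v <= w + e) -> v <= w.
Proof. by move=> vw; apply/ler_addgt0Pr. Qed.

Let small_time (d : R) (u v : H) : 0 < d -> exists t, [/\ 0 < t, `|t *: u| <= d & `|t *: v| <= d].
Proof.
move=> d0; have k0 : 0 < `|u| + `|v| + 1 by rewrite ltr_wpDl // addr_ge0.
exists (d / (`|u| + `|v| + 1)); split; first by rewrite divr_gt0.
- rewrite normrZ gtr0_norm ?divr_gt0 // mulrAC ler_pdivrMr // ler_wpM2l ?(ltW d0) //.
  by have := normr_ge0 v; lra.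
- rewrite normrZ gtr0_norm ?divr_gt0 // mulrAC ler_pdivrMr // ler_wpM2l ?(ltW d0) //.
  by have := normr_ge0 u; lra.
Qed.

Let slope_subadd u v : slope (u + v) <= slope u + slope v.
Proof.
apply: slope_small => e e0.
have k0 : 0 < `|u| + `|v| + 1 by rewrite ltr_wpDl // addr_ge0.
have ek : 0 < e / (`|u| + `|v| + 1) by rewrite divr_gt0.
have [d [d0 ds Hd]] := slope_approx ek.
have d2 : 0 < d / 2 by rewrite divr_gt0.
have [t [t0 tu' tv']] := small_time u v d2.
have tu : `|(2 * t) *: u| <= d by rewrite -scalerA normrZ ger0_norm //; lra.
have tv : `|(2 * t) *: v| <= d by rewrite -scalerA normrZ ger0_norm //; lra.
have t20 : 0 < 2 * t by rewrite mulr_gt0.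
have hu := Hd u (2 * t) t20 tu; have hv := Hd v (2 * t) t20 tv.
have half : ((0 : R) <= 2^-1) && ((2^-1 : R) <= 1) by apply/andP; split; lra.
have := h_convex (inball (le_trans tu ds)) (inball (le_trans tv ds)) half.
have E : (1 - 2^-1) *: (x + (2 * t) *: u) + 2^-1 *: (x + (2 * t) *: v) = x + t *: (u + v).
  by lmodule R; field.
rewrite E => hc.
have tuv : `|t *: (u + v)| <= s0.
  by rewrite scalerDr; apply: (le_trans (ler_normD _ _)); lra.
have hs := slope_le t0 tuv.
rewrite -(ler_pM2l t0); apply: (le_trans hs).
have h1 : e / (`|u| + `|v| + 1) * (`|u| + `|v|) <= e.
  by rewrite mulrAC ler_pdivrMr // ler_wpM2l ?(ltW e0) // lerDl.
have h2 : t * (e / (`|u| + `|v| + 1) * (`|u| + `|v|)) <= t * e by rewrite ler_pM2l.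
by lra.
Qed.

Let slope0 : slope 0 = 0.
Proof.
have t1 : `|1 *: (0 : H)| <= s0 by rewrite scaler0 normr0 ltW.
have := slope_le ltr01 t1; rewrite scaler0 addr0 subrr mul1r => h1.
apply/le_anti/andP; split=> //.
have [d [d0 ds Hd]] := slope_approx ltr01.
have := Hd 0 1 ltr01; rewrite scaler0 normr0 addr0 subrr => /(_ (ltW d0)).
by lra.
Qed.

Let slopeN v : slope (- v) = - slope v.
Proof.
apply/le_anti/andP; split; last first.
  by have := slope_subadd v (- v); rewrite subrr slope0; lra.
apply: slope_small => e e0.
have ek : 0 < e / (`|v| + 1) by rewrite divr_gt0 // ltr_wpDl.
have [d [d0 ds Hd]] := sd_radial ek.
have [t [t0 tv _]] := small_time v 0 d0.
have tNv : `|t *: - v| <= s0 by rewrite scalerN normrN (le_trans tv).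
have h1 := slope_le t0 (le_trans tv ds); have h2 := slope_le t0 tNv.
have h3 := Hd _ tv; rewrite normrZ gtr0_norm // in h3; rewrite scalerN in h2.
have h4 : e / (`|v| + 1) * `|v| <= e.
  by rewrite mulrAC ler_pdivrMr ?ltr_wpDl // ler_wpM2l ?(ltW e0) // lerDl.
have h5 : t * (e / (`|v| + 1) * `|v|) <= t * e by rewrite ler_pM2l.
by rewrite -(ler_pM2l t0); lra.
Qed.

Let slopeD u v : slope (u + v) = slope u + slope v.
Proof.
apply/le_anti/andP; split; first exact: slope_subadd.
have := slope_subadd (- u) (- v); rewrite -opprD !slopeN; lra.
Qed.

Let slope_pZ a v : 0 < a -> slope (a *: v) = a * slope v.
Proof.
suff W b w : 0 < b -> slope (b *: w) <= b * slope w.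
  move=> a0; apply/le_anti/andP; split; first exact: W.
  have ai : 0 < a^-1 by rewrite invr_gt0.
  have := W a^-1 (a *: v) ai; rewrite scalerA mulVf ?gt_eqF // scale1r.
  by rewrite -ler_pdivrMl // invrK.
move=> b0; apply: slope_small => e e0.
have ek : 0 < e / (b * `|w| + 1) by rewrite divr_gt0 // ltr_wpDl // mulr_ge0 // ltW.
have [d [d0 ds Hd]] := slope_approx ek.
have [t [t0 tw _]] := small_time (b *: w) 0 d0.
have h1 := slope_le t0 (le_trans tw ds).
have tb0 : 0 < t * b by rewrite mulr_gt0.
rewrite scalerA in tw h1; have h2 := Hd w (t * b) tb0 tw.
have bw : 0 <= b * `|w| by rewrite mulr_ge0 // ltW.
have h4 : e / (b * `|w| + 1) * (b * `|w|) <= e.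
  by rewrite mulrAC ler_pdivrMr ?ltr_wpDl // ler_wpM2l ?(ltW e0) // lerDl.
have h5 : t * (e / (b * `|w| + 1) * (b * `|w|)) <= t * e by rewrite ler_pM2l.
by rewrite -(ler_pM2l t0); lra.
Qed.

Lemma slope_linear a u v : slope (a *: u + v) = a * slope u + slope v.
Proof.
rewrite slopeD; congr (_ + _).
have [a0|a0|->] := ltgtP a 0; last by rewrite scale0r slope0 mul0r.
  have aN : 0 < - a by rewrite oppr_gt0.
  by have := slope_pZ u aN; rewrite scaleNr slopeN; lra.
exact: slope_pZ.
Qed.

Lemma slope_bound v : `|slope v| <= L * `|v|.
Proof.
have W u : slope u <= L * `|u|.
  have [t [t0 tu _]] := small_time u 0 s00.
  have := slope_le t0 tu.
  have := h_lip (inball tu) xball; rewrite [x + _]addrC addrK normrZ gtr0_norm //.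
  rewrite ler_norml => /andP[_ h1] h2.
  by rewrite -(ler_pM2l t0); lra.
rewrite ler_norml W andbT lerNl -slopeN -[`|v|]normrN; exact: W.
Qed.

Lemma convex_frechet e : 0 < e ->
  \forall y \near x, `|h y - h x - slope (y - x)| <= e * `|y - x|.
Proof.
move=> e0; have [d [d0 ds Hd]] := slope_approx e0.
near=> y.
have yd : `|1 *: (y - x)| <= d.
  by rewrite scale1r ltW //; near: y; exact: near_lt_norm.
have := Hd _ _ ltr01 yd; have := slope_le ltr01 (le_trans yd ds).
rewrite scale1r !mul1r [x + _]addrC subrK => h1 h2.
by rewrite ger0_norm; lra.
Unshelve. all: by end_near. Qed.

End Convex.

Context (dot : H -> H -> R).
Hypotheses (hdot : scalar_product dot) (hn : forall u, `|u| ^+ 2 = dot u u).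

Let parallelogram (z v : H) :
  `|z + v| ^+ 2 + `|z - v| ^+ 2 - 2 * `|z| ^+ 2 = 2 * `|v| ^+ 2.
Proof. by rewrite !hn !(spE hdot) (sp_sym hdot v z); ring. Qed.

Let G (n : nat) : set H := [set x | exists d eta : R, [/\ 0 < d, `|x - x0| + d < r,
  eta < d / n.+1%:R & forall v, `|v| <= d -> h (x + v) + h (x - v) - 2 * h x <= eta]].

Let G_open n : open (G n).
Proof.
rewrite openE => x [d [eta [d0 xd etad Hd]]].
have gap1 : 0 < r - (`|x - x0| + d) by rewrite subr_gt0.
have gap2 : 0 < (d / n.+1%:R - eta) / (4 * L + 1).
  by rewrite divr_gt0 ?subr_gt0 // ltr_wpDl // mulr_ge0.
rewrite /interior /=; near=> y.
have y1 : `|y - x| < r - (`|x - x0| + d) by near: y; exact: near_lt_norm.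
have y2 : `|y - x| < (d / n.+1%:R - eta) / (4 * L + 1) by near: y; exact: near_lt_norm.
have yd : `|y - x0| + d < r.
  have := ler_normD (y - x) (x - x0); rewrite subrKA => h1; lra.
exists d, (eta + 4 * L * `|y - x|); split=> //.
  have L1 : 0 < 4 * L + 1 by rewrite ltr_wpDl // mulr_ge0.
  move: y2; rewrite ltr_pdivlMr // mulrDr mulr1.
  have := normr_ge0 (y - x); move: (d / n.+1%:R) => q; lra.
move=> v vd.
have inb z u : `|z - x0| + d < r -> `|u| <= d -> `|z + u - x0| < r.
  move=> zd ud; rewrite addrAC; apply: le_lt_trans (ler_normD _ _) _.
  by apply: le_lt_trans zd; rewrite lerD2l.
have vNd : `|- v| <= d by rewrite normrN.
have d00 : `|0 : H| <= d by rewrite normr0 ltW.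
have := h_lip (inb y v yd vd) (inb x v xd vd).
have := h_lip (inb y (- v) yd vNd) (inb x (- v) xd vNd).
have := h_lip (inb y 0 yd d00) (inb x 0 xd d00).
rewrite !addr0 (_ : y + v - (x + v) = y - x); last by lmodule R; ring.
rewrite (_ : y - v - (x - v) = y - x); last by lmodule R; ring.
rewrite !ler_norml => /andP[? ?] /andP[? ?] /andP[? ?].
by have := Hd v vd; lra.
Unshelve. all: by end_near. Qed.

(* Witness: an almost maximizer of [h - lam |. - x1|^2] on the ball of radius [s]. *)
Let G_dense n x1 s : `|x1 - x0| < r -> 0 < s -> exists2 x, G n x & `|x - x1| < s.
Proof.
move=> x1r s'0; pose k : R := n.+1%:R^-1.
have k0 : 0 < k by rewrite invr_gt0 ltr0n.
wlog s1r : s s'0 / `|x1 - x0| + 2 * s < r.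
  move=> W; pose s1 := Num.min s ((r - `|x1 - x0|) / 4).
  have s10 : 0 < s1 by rewrite lt_min s'0 divr_gt0 // subr_gt0.
  have s14 : s1 <= (r - `|x1 - x0|) / 4 by rewrite ge_min lexx orbT.
  have gap : 0 < r - `|x1 - x0| by rewrite subr_gt0.
  have [|x Gx xs1] := W s1 s10; first by lra.
  by exists x => //; apply: (lt_le_trans xs1); rewrite ge_min lexx.
pose lam := 4 * (L * s + 1) / s ^+ 2.
have Ls : 0 <= L * s by rewrite mulr_ge0 // ltW.
have lam0 : 0 < lam.
  by rewrite divr_gt0 ?exprn_gt0 // mulr_gt0 // ltr_wpDl.
pose phi x := h x - lam * `|x - x1| ^+ 2.
pose d := Num.min (s / 2) (k / (8 * lam)).
have d0 : 0 < d by rewrite lt_min !divr_gt0 // mulr_gt0.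
pose eta := Num.min 2^-1 (k * d / 8).
have eta0 : 0 < eta by rewrite lt_min invr_gt0 ltr0n /= divr_gt0 // mulr_gt0.
have sball x : `|x - x1| <= s -> `|x - x0| < r.
  move=> xs; have := ler_normD (x - x1) (x1 - x0); rewrite subrKA => h1; lra.
have phi_ub x : `|x - x1| <= s -> phi x <= h x1 + L * s - lam * `|x - x1| ^+ 2.
  move=> xs; rewrite /phi lerD2r.
  have := h_lip (sball x xs) x1r; rewrite ler_norml => /andP[_ h1].
  have : L * `|x - x1| <= L * s by rewrite ler_wpM2l.
  by lra.
pose S := [set phi x | x in [set x | `|x - x1| <= s]].
have hS : has_sup S.
  split; first by exists (phi x1), x1 => //=; rewrite subrr normr0 ltW.
  exists (h x1 + L * s) => _ [x /= xs <-]; apply: (le_trans (phi_ub x xs)).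
  by rewrite gerBl mulr_ge0 ?exprn_ge0 // ltW.
have [_ [x /= xs <-] xeta] := sup_adherent eta0 hS.
have phi_le y : `|y - x1| <= s -> phi y <= phi x + eta.
  move=> ys; rewrite -lerBlDr ltW // (le_lt_trans _ xeta) // lerD2r.
  by apply: sup_upper_bound => //; exists y.
have xs2 : `|x - x1| < s / 2.
  rewrite ltNge; apply/negP => sx.
  have x11 : `|x1 - x1| <= s by rewrite subrr normr0 ltW.
  have := phi_le x1 x11; rewrite {1}/phi subrr normr0 expr0n mulr0 subr0.
  have := phi_ub x xs.
  have s2p : 0 <= s / 2 by rewrite divr_ge0 // ltW.
  have : (s / 2) ^+ 2 <= `|x - x1| ^+ 2 by rewrite ler_pXn2r // nnegrE.
  rewrite -(ler_pM2l lam0).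
  have -> : lam * (s / 2) ^+ 2 = L * s + 1 by rewrite /lam; field; rewrite gt_eqF.
  have : eta <= 2^-1 by rewrite ge_min lexx.
  by lra.
exists x; last by lra.
have ds : d <= s / 2 by rewrite ge_min lexx.
have dk : d <= k / (8 * lam) by rewrite ge_min lexx orbT.
have ek : eta <= k * d / 8 by rewrite ge_min lexx orbT.
have kd0 : 0 < k * d by rewrite mulr_gt0.
exists d, (k * d / 2); split=> //.
- have := ler_normD (x - x1) (x1 - x0); rewrite subrKA => h1; lra.
- by rewrite -[ltRHS]/(d * k) [ltRHS]mulrC; lra.
move=> v vd.
have near_x u : `|u| <= d -> `|x + u - x1| <= s.
  move=> ud; rewrite addrAC; apply: (le_trans (ler_normD _ _)); lra.
have vNd : `|- v| <= d by rewrite normrN.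
have h1 := phi_le _ (near_x v vd); have h2 := phi_le _ (near_x (- v) vNd).
have := parallelogram (x - x1) v.
rewrite -(addrAC x v) -(addrAC x (- v)) => P.
have {}P : lam * (`|x + v - x1| ^+ 2 + `|x - v - x1| ^+ 2 - 2 * `|x - x1| ^+ 2) =
  lam * (2 * `|v| ^+ 2) by rewrite P.
have vv : `|v| ^+ 2 <= d ^+ 2 by rewrite ler_pXn2r // nnegrE // ltW.
have lv : lam * `|v| ^+ 2 <= lam * d ^+ 2 by rewrite ler_pM2l.
have ld : lam * d ^+ 2 <= k * d / 8.
  rewrite expr2 mulrA [leRHS]mulrAC ler_pM2r //.
  have lam80 : 0 < 8 * lam by rewrite pmulr_rgt0.
  move: dk; rewrite !ler_pdivlMr // => dk.
  by rewrite (_ : lam * d * 8 = d * (8 * lam)) //; ring.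
by move: h1 h2; rewrite /phi; lra.
Qed.

Theorem generic_second_difference : 0 < r ->
  exists2 x, `|x - x0| < r & second_difference_small x.
Proof.
move=> r0.
pose O n := G n `|` [set x | r / 2 < `|x - x0|].
have OP n : open (O n) /\ dense (O n).
  split.
    apply: openU; first exact: G_open.
    rewrite openE => x /= xr; rewrite /interior /=.
    have gap : 0 < `|x - x0| - r / 2 by rewrite subr_gt0.
    near=> y; have yx : `|y - x| < `|x - x0| - r / 2 by near: y; exact: near_lt_norm.
    by have := ler_normD (x - y) (y - x0); rewrite subrKA [`|x - y|]distrC /=; lra.
  move=> W [y Wy] Wo.
  have [yr|yr] := ltP (r / 2) `|y - x0|; first by exists y; split=> //; right.
  have yr1 : `|y - x0| < r by lra.
  have /nbhs_ballP[s /= s0 Ws] : nbhs y W by exact: open_nbhs_nbhs.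
  have [x Gx xs] := G_dense n yr1 s0.
  by exists x; split; [apply: Ws; rewrite -ball_normE /= distrC|left].
have /(_ (ball x0 (r / 2))) := Baire OP.
case.
- by exists x0; apply: ballxx; rewrite divr_gt0.
- exact: ball_open.
move=> x [xb xO]; move: xb; rewrite -ball_normE /= distrC => xr.
exists x; first by lra.
move=> e e0.
have [n _ Hn] := near_infty_natSinv_lt (PosNum e0).
have /= ne := Hn n (leqnn n).
have [[d [eta [d0 xd etad Hd]]]|/=] := xO n I; last by rewrite ltNge ltW.
exists d; split=> // v vd; apply: (le_trans (Hd v vd)); apply: (le_trans (ltW etad)).
by rewrite mulrC ler_pM2r // ltW.
Unshelve. all: by end_near. Qed.

End ConvexOnBall.

(** * Null sets and kinks *)

Section NullSets.
Context (R : realType) (n : nat).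
Implicit Types (A E : set 'rV[R]_n) (a b x y : 'rV[R]_n).

Definition box_volume a b : R := \prod_(j < n) (b 0 j - a 0 j).

Lemma box_volume_ge0 a b : (forall j, a 0 j <= b 0 j) -> 0 <= box_volume a b.
Proof. by move=> ab; apply: prodr_ge0 => j _; rewrite subr_ge0. Qed.

Lemma lebesgue_null_countable A :
  (forall e : R, 0 < e -> exists (T : countType) (P : set T) (a b : T -> 'rV[R]_n),
    [/\ forall t j, a t 0 j <= b t 0 j,
      forall x, A x -> exists t, P t /\ forall j, a t 0 j <= x 0 j <= b t 0 j &
      (\esum_(t in P) (box_volume (a t) (b t))%:E <= e%:E)%E]) ->
  lebesgue_null A.
Proof.
move=> HA e e0; have [T [P [a [b [ab Aab vol]]]]] := HA e e0.
pose K m := if pickle_inv m is Some t then `[< P t >] else false.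
pose a' m := if pickle_inv m is Some t then a t else 0.
pose b' m := if pickle_inv m is Some t then b t else 0.
exists K, a', b'; split.
- by move=> k j; rewrite /a' /b'; case: pickle_inv => [t|]; rewrite ?ab ?lexx.
- move=> x /Aab[t [Pt xt]]; exists (pickle t).
    by rewrite /= /K pickleK_inv; apply/asboolP.
  by rewrite /= /a' /b' pickleK_inv.
- rewrite nneseries_esum; last first.
    move=> k _; rewrite lee_fin; apply: box_volume_ge0 => j.
    by rewrite /a' /b'; case: pickle_inv => [t|]; rewrite ?ab ?lexx.
  rewrite (_ : [set k | K k] = pickle @` P); last first.
    apply/seteqP; split=> [k /=|_ [t Pt <-]].
      rewrite /K; case Ek : (pickle_inv k) => [t|//] /asboolP Pt; exists t => //.
      by have := @pickle_invK T k; rewrite Ek.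
    by rewrite /= /K pickleK_inv; apply/asboolP.
  rewrite esum_image; last by move=> t t' _ _; apply: pcan_inj; exact: pickleK.
  apply: le_trans vol; apply: le_esum => t _.
  by rewrite /a' /b' pickleK_inv lexx.
Qed.

Lemma esum_finType_le (T : finType) (F : T -> R) : (forall t, 0 <= F t) ->
  (\esum_(t in [set: T]) (F t)%:E <= (\sum_t F t)%:E)%E.
Proof.
move=> F0; apply: ge_ereal_sup => _ [X [finX _] <-].
rewrite fsbig_finite // big_uniq ?finmap.fset_uniq //= sumEFin lee_fin.
rewrite big_mkcond /=; apply: ler_sum => t _.
by case: ifP.
Qed.

Lemma lebesgue_null_subset A E : A `<=` E -> lebesgue_null E -> lebesgue_null A.
Proof.
move=> AE nE e e0; have [K [a [b [ab Eab vol]]]] := nE e e0.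
by exists K, a, b; split=> // x /AE/Eab.
Qed.

Lemma lebesgue_null0 : lebesgue_null (set0 : set 'rV[R]_n).
Proof.
move=> e e0; exists pred0, (fun=> 0), (fun=> 0); split=> //.
by rewrite eseries_pred0 // lee_fin ltW.
Qed.

Lemma lebesgue_null_bigcup_nat (A : nat -> set 'rV[R]_n) :
  (forall k, lebesgue_null (A k)) -> lebesgue_null (\bigcup_k A k).
Proof.
move=> nA; apply: lebesgue_null_countable => e e0.
have ek k : 0 < e / (2 ^ k.+1)%:R by rewrite divr_gt0 // ltr0n expn_gt0.
have /choice[K HK] : forall k, exists K : pred nat, exists a b : nat -> 'rV[R]_n,
    [/\ forall k j, a k 0 j <= b k 0 j,
        A k `<=` \bigcup_(k in [set k | K k])
                   [set x | forall j, a k 0 j <= x 0 j <= b k 0 j]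
        & (\sum_(0 <= m <oo | K m) (box_volume (a m) (b m))%:E
             <= (e / (2 ^ k.+1)%:R)%:E)%E].
  by move=> k; exact: nA.
have /choice[a Ha] := HK; have /choice[b Hb] := Ha => {HK Ha}.
exists (nat * nat)%type, ([set: nat] `*`` (fun k => [set m | K k m])),
  (fun p => a p.1 p.2), (fun p => b p.1 p.2); split.
- by move=> [k m] j; have [ab _ _] := Hb k; exact: ab.
- move=> x [k _ Akx]; have [_ AK _] := Hb k.
  by have [m Km xm] := AK x Akx; exists (k, m).
rewrite -(esum_esum (a := fun k m => (box_volume (a k m) (b k m))%:E)); last first.
  move=> k m _ _; rewrite lee_fin; apply: box_volume_ge0 => j.
  by have [ab _ _] := Hb k; exact: ab.
have vol0 k m : (0 <= (box_volume (a k m) (b k m))%:E)%E.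
  rewrite lee_fin; apply: box_volume_ge0 => j.
  by have [ab _ _] := Hb k; exact: ab.
have := @epsilon_trick R (fun=> 0%E) e xpredT (fun=> lexx _) (ltW e0).
have -> : (\sum_(0 <= i <oo) (0 : \bar R))%E = 0%E by exact: eseries0.
rewrite add0e; apply: le_trans.
rewrite nneseries_esumT; last by move=> k; rewrite add0e lee_fin ltW.
apply: le_esum => k _; rewrite add0e; have [_ _] := Hb k; apply: le_trans.
by rewrite nneseries_esum.
Qed.

Lemma lebesgue_null_bigcup (I : countType) (A : I -> set 'rV[R]_n) :
  (forall k, lebesgue_null (A k)) -> lebesgue_null (\bigcup_k A k).
Proof.
move=> nA.
pose A' k := if pickle_inv k is Some t then A t else set0.
apply: (@lebesgue_null_subset _ (\bigcup_k A' k)).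
  by move=> x [t _ Atx]; exists (pickle t); rewrite ///A' pickleK_inv.
apply: lebesgue_null_bigcup_nat => k; rewrite /A'.
by case: pickle_inv => [t|]; [exact: nA|exact: lebesgue_null0].
Qed.

(* Cover by the boxes over the cells of a grid of step [2 rho / N] in the
   coordinates other than [j]. The boxes are indexed by functions on all the
   coordinates, those with [f j != 0] being degenerate. *)
Lemma lipschitz_graph_null (j : 'I_n) E x0 (rho Lam : R) : 0 < rho -> 0 <= Lam ->
  (forall x, E x -> forall i, `|x 0 i - x0 0 i| < rho) ->
  (forall x y d, E x -> E y -> 0 <= d ->
     (forall i, i != j -> `|x 0 i - y 0 i| <= d) -> `|x 0 j - y 0 j| <= Lam * d) ->
  lebesgue_null E.
Proof.
move=> rho0 Lam0 Erho cone; apply: lebesgue_null_countable => e e0.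
pose C := (2 * rho) ^+ n.-1 * (4 * Lam * rho).
have C0 : 0 <= C by rewrite /C mulr_ge0 ?exprn_ge0 // !mulr_ge0 // ltW.
have eC : 0 < e / (C + 1) by rewrite divr_gt0 // ltr_wpDl.
have [N _ HN] := near_infty_natSinv_lt (PosNum eC).
have /= {HN} NC := HN N (leqnn N).
pose step : R := 2 * rho / N.+1%:R.
have step0 : 0 < step by rewrite divr_gt0 ?mulr_gt0 // ltr0n.
pose low i (k : nat) : R := x0 0 i - rho + step * k%:R.
pose cell (f : {ffun 'I_n -> 'I_N.+1}) := [set x | E x /\ forall i, i != j ->
  low i (f i) <= x 0 i <= low i (f i) + step].
pose pt f := xget 0 (cell f).
pose side (i : 'I_n) (k : 'I_N.+1) : R :=
  if i == j then (if k == ord0 then 2 * (Lam * step) else 0) else step.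
have side0 i k : 0 <= side i k.
  rewrite /side; case: ifP => _; last exact: ltW.
  by case: ifP => // _; rewrite !mulr_ge0 // ltW.
pose a (f : {ffun 'I_n -> 'I_N.+1}) : 'rV[R]_n :=
  \row_i (if i == j then pt f 0 j - side i (f i) / 2 else low i (f i)).
pose b f : 'rV[R]_n := \row_i (a f 0 i + side i (f i)).
exists {ffun 'I_n -> 'I_N.+1}, [set: {ffun 'I_n -> 'I_N.+1}], a, b; split.
- by move=> f i; rewrite [b f 0 i]mxE lerDl.
- move=> x Ex.
  have /choice[g gP] : forall i, exists k : 'I_N.+1, low i k <= x 0 i <= low i k + step.
    move=> i; have := Erho x Ex i; rewrite ltr_norml => /andP[xl xu].
    pose y := (x 0 i - x0 0 i + rho) / step.
    have y0 : 0 <= y by rewrite divr_ge0 ?(ltW step0) //; lra.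
    have /andP[k1 k2] := truncn_itv y0.
    have kN : (Num.truncn y < N.+1)%N.
      rewrite -(ltr_nat R); apply: (le_lt_trans k1).
      rewrite ltr_pdivrMr // /step mulrC divfK ?pnatr_eq0 //; lra.
    exists (Ordinal kN); rewrite /low /=.
    move: k1 k2; rewrite ler_pdivlMr // ltr_pdivrMr // -natr1 => k1 k2.
    by apply/andP; split; lra.
  pose f : {ffun 'I_n -> 'I_N.+1} := [ffun i => if i == j then ord0 else g i].
  have cx : cell f x.
    by split=> // i ij; rewrite ffunE (negbTE ij); exact: gP.
  have [Ept ptf] : cell f (pt f) by apply: (@xgetPex _ 0 (cell f)); exists x.
  exists f; split=> // i; rewrite [b f 0 i]mxE [a f 0 i]mxE.
  have [->|ij] := eqVneq i j.
    have -> : side j (f j) = 2 * (Lam * step) by rewrite /side eqxx ffunE eqxx eqxx.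
    have : `|x 0 j - pt f 0 j| <= Lam * step.
      apply: cone => //; first exact: ltW.
      move=> i' i'j; have := cx.2 i' i'j; have := ptf i' i'j.
      by rewrite ler_norml => /andP[? ?] /andP[? ?]; apply/andP; split; lra.
    by rewrite ler_norml => /andP[? ?]; apply/andP; split; lra.
  by rewrite /side (negbTE ij); exact: cx.2.
apply: le_trans (esum_finType_le _) _.
  by move=> f; apply: box_volume_ge0 => i; rewrite [b f 0 i]mxE lerDl.
rewrite lee_fin.
rewrite (eq_bigr (fun f : {ffun 'I_n -> 'I_N.+1} => \prod_i side i (f i))); last first.
  by move=> f _; apply: eq_bigr => i _; rewrite [b f 0 i]mxE addrAC subrr add0r.
rewrite -(bigA_distr_bigA side) (bigD1 j) //=.
have -> : \sum_k side j k = 2 * (Lam * step).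
  rewrite (bigD1 ord0) //= big1 ?addr0; first by rewrite /side !eqxx.
  by move=> k k0; rewrite /side eqxx (negbTE k0).
rewrite (eq_bigr (fun=> 2 * rho)); last first.
  move=> i ij; rewrite (eq_bigr (fun=> step)).
    by rewrite sumr_const card_ord -[step *+ _]mulr_natr divfK // pnatr_eq0.
  by move=> k _; rewrite /side (negbTE ij).
rewrite prodr_const (_ : #|_| = n.-1); last first.
  by rewrite cardC1 card_ord.
rewrite [leLHS](_ : _ = C * N.+1%:R^-1); last first.
  by rewrite /C /step; move: (N.+1%:R^-1) (_ ^+ _) => q p; ring.
have : C * N.+1%:R^-1 <= C * (e / (C + 1)) by rewrite ler_wpM2l // ltW.
move=> /le_trans; apply.
rewrite mulrA ler_pdivrMr ?ltr_wpDl // mulrC ler_pM2l // lerDl //.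
Qed.

End NullSets.

Section Kinks.
Context (R : realType) (n : nat) (k : 'rV[R]_n -> R) (c0 : 'rV[R]_n) (rho L : R).
Implicit Types (x y : 'rV[R]_n).

Definition in_cube x : Prop := forall i, `|x 0 i - c0 0 i| < rho.

Hypotheses (rho0 : 0 < rho) (L0 : 0 <= L)
  (k_lip : forall x y d, in_cube x -> in_cube y -> 0 <= d ->
     (forall i, `|x 0 i - y 0 i| <= d) -> `|k x - k y| <= L * d)
  (k_convex : forall x y a, in_cube x -> in_cube y -> 0 <= a <= 1 ->
     k ((1 - a) *: x + a *: y) <= (1 - a) * k x + a * k y).

Definition smooth_along (j : 'I_n) x : Prop := forall e : R, 0 < e ->
  exists t, [/\ 0 < t, in_cube (x + t *: 'e_j), in_cube (x - t *: 'e_j) &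
    k (x + t *: 'e_j) + k (x - t *: 'e_j) - 2 * k x <= e * t].

(* The right slope at [x] is at least [q] and the left slope is smaller by the
   fixed amount [m.+1%:R^-1]. *)
Definition kink_set (j : 'I_n) (q : rat) (m : nat) : set 'rV[R]_n :=
  [set x | [/\ in_cube x,
    forall t, 0 < t -> in_cube (x + t *: 'e_j) -> k x + ratr q * t <= k (x + t *: 'e_j) &
    forall t, 0 < t -> in_cube (x - t *: 'e_j) ->
      k x + (m.+1%:R^-1 - ratr q) * t <= k (x - t *: 'e_j)]].

Lemma shift_coord j x t i :
  (x + t *: 'e_j) 0 i = if i == j then x 0 j + t else x 0 i.
Proof.
rewrite !mxE eqxx /=; case: (eqVneq i j) => [->|ij]; first by rewrite mulr1.
by rewrite mulr0 addr0.
Qed.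

Lemma in_cube_between x y a : in_cube x -> in_cube y -> 0 <= a <= 1 ->
  in_cube ((1 - a) *: x + a *: y).
Proof.
move=> Bx By /andP[a0 a1] i; rewrite !mxE.
have := Bx i; have := By i; rewrite !ltr_norml => /andP[? ?] /andP[? ?].
have [->|an] := eqVneq a 1; first by rewrite subrr mul0r add0r mul1r; apply/andP; split.
have a1' : 0 < 1 - a by rewrite subr_gt0 lt_neqAle an.
have h1 : (1 - a) * (- rho) < (1 - a) * (x 0 i - c0 0 i) by rewrite ltr_pM2l.
have h2 : (1 - a) * (x 0 i - c0 0 i) < (1 - a) * rho by rewrite ltr_pM2l.
have h3 : a * (- rho) <= a * (y 0 i - c0 0 i) by rewrite ler_wpM2l // ltW.
have h4 : a * (y 0 i - c0 0 i) <= a * rho by rewrite ler_wpM2l // ltW.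
by apply/andP; split; lra.
Qed.

Let radial x v s t : in_cube x -> in_cube (x + t *: v) -> 0 < s -> s <= t ->
  in_cube (x + s *: v) /\ k (x + s *: v) - k x <= s / t * (k (x + t *: v) - k x).
Proof.
move=> Bx Bt s0 st; have t0 : 0 < t by exact: lt_le_trans st.
have a01 : 0 <= s / t <= 1.
  by rewrite divr_ge0 ?(ltW s0) ?(ltW t0) //= ler_pdivrMr // mul1r.
have E : (1 - s / t) *: x + (s / t) *: (x + t *: v) = x + s *: v.
  by lmodule R; field; rewrite gt_eqF.
split; first by rewrite -E; exact: in_cube_between.
by have := k_convex Bx Bt a01; rewrite E; lra.
Qed.

Let radialN x j s t : in_cube x -> in_cube (x - t *: 'e_j) -> 0 < s -> s <= t ->
  in_cube (x - s *: 'e_j) /\ k (x - s *: 'e_j) - k x <= s / t * (k (x - t *: 'e_j) - k x).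
Proof.
by move=> Bx Bt s0 st; have := @radial x (- 'e_j) s t Bx; rewrite !scalerN; apply.
Qed.

Lemma kinkP j x : in_cube x -> ~ smooth_along j x -> exists q m, kink_set j q m x.
Proof.
move=> Bx /existsNP[e /not_implyP[e0 ns]].
have {}ns t : 0 < t -> in_cube (x + t *: 'e_j) -> in_cube (x - t *: 'e_j) ->
    e * t < k (x + t *: 'e_j) + k (x - t *: 'e_j) - 2 * k x.
  move=> t0 B1 B2; rewrite ltNge; apply/negP => h; apply: ns; exists t; split=> //.
pose S := [set s | exists2 t, 0 < t /\ in_cube (x + t *: 'e_j) &
  s = (k (x + t *: 'e_j) - k x) / t].
have S_lb : lbound S (- L).
  move=> _ [t [t0 Bt] ->]; rewrite ler_pdivlMr //.
  have := @k_lip (x + t *: 'e_j) x t Bt Bx (ltW t0).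
  rewrite ler_norml => /(_ _)/andP[|h _]; last by lra.
  move=> i; rewrite shift_coord; case: eqVneq => [->|_].
    by rewrite addrC addKr ger0_norm // ltW.
  by rewrite subrr normr0 ltW.
have hS : has_inf S.
  split; last by exists (- L).
  pose t := (rho - `|x 0 j - c0 0 j|) / 2.
  have gap : 0 < rho - `|x 0 j - c0 0 j| by rewrite subr_gt0.
  have t0 : 0 < t by rewrite divr_gt0.
  exists ((k (x + t *: 'e_j) - k x) / t), t => //; split=> // i.
  rewrite shift_coord; case: eqVneq => [->|_]; last exact: Bx.
  rewrite addrAC; apply: (le_lt_trans (ler_normD _ _)).
  by rewrite (gtr0_norm t0) /t; lra.
set p := inf S.
have pS t : 0 < t -> in_cube (x + t *: 'e_j) -> p * t <= k (x + t *: 'e_j) - k x.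
  by move=> t0 Bt; rewrite -ler_pdivlMr //; apply: ge_inf; [exact: hS.2|exists t].
have [q] : exists q : rat, ratr q \in `]p - e / 2, p[.
  by apply: rat_in_itvoo; rewrite gtrBl divr_gt0.
rewrite in_itv /= => /andP[q1 q2].
have e2 : 0 < e / 2 by rewrite divr_gt0.
have [m _ Hm] := near_infty_natSinv_lt (PosNum e2).
have /= {}Hm := Hm m (leqnn m).
exists q, m; split=> // [t t0 Bt|t t0 Bt].
  have := pS t t0 Bt; have : ratr q * t <= p * t by rewrite ler_wpM2r // ltW.
  by lra.
move: (m.+1%:R^-1) Hm => im Hm.
have slack : 0 < (e - p) - (im - ratr q) by lra.
have [_ [t' [t'0 Bt'] ->] Ht'] := inf_adherent slack hS.
have s0 : 0 < Num.min t t' by rewrite lt_min t0.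
have st : Num.min t t' <= t by rewrite ge_min lexx.
have st' : Num.min t t' <= t' by rewrite ge_min lexx orbT.
move: (Num.min t t') s0 st st' => s s0 st st'.
have [B1 h1] := radial Bx Bt' s0 st'; have [B2 h2] := radialN Bx Bt s0 st.
have h3 := ns s s0 B1 B2.
have h4 : s / t' * (k (x + t' *: 'e_j) - k x) <= s * (e - (im - ratr q)).
  rewrite (_ : s / t' * _ = s * ((k (x + t' *: 'e_j) - k x) / t')); last by ring.
  by rewrite ler_wpM2l ?(ltW s0) // ltW // (lt_le_trans Ht') // -/p; lra.
have h5 : s * (im - ratr q) <= s / t * (k (x - t *: 'e_j) - k x) by lra.
have h6 : s * ((im - ratr q) * t) <= s * (k (x - t *: 'e_j) - k x).
  have := ler_wpM2r (ltW t0) h5.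
  rewrite (_ : s / t * _ * t = s * (k (x - t *: 'e_j) - k x)); last first.
    by field; rewrite gt_eqF.
  by rewrite mulrA.
by move: h6; rewrite ler_pM2l //; lra.
Qed.

Lemma kink_cone j q m x y d : kink_set j q m x -> kink_set j q m y -> 0 <= d ->
  (forall i, i != j -> `|x 0 i - y 0 i| <= d) ->
  `|x 0 j - y 0 j| <= 2 * L * m.+1%:R * d.
Proof.
wlog xy : x y / x 0 j < y 0 j.
  move=> W Ex Ey d0 xyd; have [xy|yx|->] := ltgtP (x 0 j) (y 0 j).
  - exact: W.
  - by rewrite distrC; apply: W => // i ij; rewrite distrC xyd.
  - by rewrite subrr normr0 !mulr_ge0 // ltW.
move=> [Bx Rx _] [By _ Ly] d0 xyd.
pose t := y 0 j - x 0 j; have t0 : 0 < t by rewrite subr_gt0.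
have B1 : in_cube (x + t *: 'e_j).
  move=> i; rewrite shift_coord; case: eqVneq => [->|_]; last exact: Bx.
  by rewrite /t (addrC (x 0 j)) subrK; exact: By.
have B2 : in_cube (y - t *: 'e_j).
  move=> i; rewrite -scaleNr shift_coord; case: eqVneq => [->|_]; last exact: By.
  by rewrite /t opprB (addrC (y 0 j)) subrK; exact: Bx.
have h1 := Rx t t0 B1; have h2 := Ly t t0 B2.
have := @k_lip _ _ d B1 By d0; rewrite ler_norml => /(_ _)/andP[|_ h3].
  move=> i; rewrite shift_coord; case: eqVneq => [->|ij]; last exact: xyd.
  by rewrite /t (addrC (x 0 j)) subrK subrr normr0.
have := @k_lip _ _ d B2 Bx d0; rewrite ler_norml => /(_ _)/andP[|_ h4].
  move=> i; rewrite -scaleNr shift_coord; case: eqVneq => [->|ij].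
    by rewrite /t opprB (addrC (y 0 j)) subrK subrr normr0.
  by rewrite distrC; exact: xyd.
have m0 : 0 < m.+1%:R :> R by rewrite ltr0n.
have {}h2 : k y + (m.+1%:R^-1 - ratr q) * t <= k (y - t *: 'e_j) by [].
have h5 : m.+1%:R^-1 * t <= 2 * L * d by move: (m.+1%:R^-1) h2 => im h2; lra.
rewrite distrC -/t gtr0_norm //.
by rewrite mulrAC mulrC -ler_pdivrMl.
Qed.

Lemma kinks_null :
  lebesgue_null [set x | in_cube x /\ exists j, ~ smooth_along j x].
Proof.
apply: (@lebesgue_null_subset _ _ _ (\bigcup_(p : 'I_n * rat * nat) kink_set p.1.1 p.1.2 p.2)).
  move=> x [Bx [j nj]]; have [q [m xE]] := kinkP Bx nj.
  by exists (j, q, m).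
apply: lebesgue_null_bigcup => -[[j q] m] /=.
apply: (@lipschitz_graph_null _ _ j _ c0 rho (2 * L * m.+1%:R)) => //.
- by rewrite !mulr_ge0.
- by move=> x [Bx _ _]; exact: Bx.
- by move=> x y d Ex Ey; exact: (kink_cone Ex Ey).
Qed.

End Kinks.

Section SmoothDirections.
Context (R : realType) (H : completeNormedModType R) (x0 : H) (r : R) (h : H -> R).
Hypothesis h_convex : forall x y a, `|x - x0| < r -> `|y - x0| < r -> 0 <= a <= 1 ->
  h ((1 - a) *: x + a *: y) <= (1 - a) * h x + a * h y.
Context (n : nat) (b : 'I_n -> H) (x : H).
Hypothesis xr : `|x - x0| < r.

Let ball v := `|x + v - x0| < r /\ `|x - v - x0| < r.
Let Delta v := h (x + v) + h (x - v) - 2 * h x.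

Let ball_small v : `|v| <= (r - `|x - x0|) / 2 -> ball v.
Proof.
move=> vs; have gap : 0 < r - `|x - x0| by rewrite subr_gt0.
split; rewrite addrAC; apply: le_lt_trans (ler_normD _ _) _; rewrite ?normrN; lra.
Qed.

Let Delta_radial v a : ball v -> 0 <= a <= 1 -> Delta (a *: v) <= a * Delta v.
Proof.
move=> [vp vm] a01; have := h_convex xr vp a01; have := h_convex xr vm a01.
rewrite (_ : (1 - a) *: x + a *: (x - v) = x - a *: v); last by lmodule R; ring.
rewrite (_ : (1 - a) *: x + a *: (x + v) = x + a *: v); last by lmodule R; ring.
by rewrite /Delta; lra.
Qed.

Let DeltaN v : Delta (- v) = Delta v.
Proof. by rewrite /Delta opprK; ring. Qed.

Let Delta_half u v : ball (2 *: u) -> ball (2 *: v) ->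
  Delta (u + v) <= 2^-1 * (Delta (2 *: u) + Delta (2 *: v)).
Proof.
move=> [up um] [vp vm].
have half : ((0 : R) <= 2^-1) && ((2^-1 : R) <= 1) by apply/andP; split; lra.
have := h_convex up vp half; have := h_convex um vm half.
rewrite (_ : (1 - 2^-1) *: (x - _) + _ = x - (u + v)); last by lmodule R; field.
rewrite (_ : (1 - 2^-1) *: (x + _) + _ = x + (u + v)); last by lmodule R; field.
by rewrite /Delta; lra.
Qed.

Hypothesis b_smooth : forall j e, 0 < e -> exists t, [/\ 0 < t,
  `|x + t *: b j - x0| < r, `|x - t *: b j - x0| < r &
  h (x + t *: b j) + h (x - t *: b j) - 2 * h x <= e * t].

Let combination_small (s : seq 'I_n) (e kap : R) : 0 < e -> 0 < kap ->
  exists d, 0 < d /\ forall sig (v : 'I_n -> R), 0 <= sig <= d ->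
    (forall i, `|v i| <= sig) ->
    `|\sum_(i <- s) v i *: b i| <= kap /\ Delta (\sum_(i <- s) v i *: b i) <= e * sig.
Proof.
elim: s e kap => [|j s IH] e kap e0 kap0.
  exists 1; split=> // sig v /andP[sig0 _] _; rewrite big_nil normr0; split; first exact: ltW.
  by rewrite /Delta addr0 subr0 (_ : _ - _ = 0) ?mulr_ge0 ?(ltW e0) //; ring.
have gap : 0 < r - `|x - x0| by rewrite subr_gt0.
pose kap' := Num.min kap ((r - `|x - x0|) / 2).
have kap'0 : 0 < kap' by rewrite lt_min kap0 divr_gt0.
have kk : kap' <= kap by rewrite ge_min lexx.
have kg : kap' <= (r - `|x - x0|) / 2 by rewrite ge_min lexx orbT.
have e20 : 0 < e / 2 by rewrite divr_gt0.
have [d1 [d10 Hd1]] := IH (e / 2) kap' e20 kap'0.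
have [t [t0 tp tm Ht]] := b_smooth j e20.
have bj0 : 0 < `|b j| + 1 by rewrite ltr_wpDl.
pose d := Num.min (d1 / 2) (Num.min (t / 2) (kap' / 2 / (`|b j| + 1))).
have dd1 : d <= d1 / 2 by rewrite ge_min lexx.
have dt : d <= t / 2 by rewrite !ge_min lexx orbT.
have db : d <= kap' / 2 / (`|b j| + 1) by rewrite !ge_min lexx !orbT.
exists d; split; first by rewrite !lt_min !divr_gt0.
move=> sig v /andP[sig0 sigd] vs; rewrite big_cons.
set u := v j *: b j; set w := \sum_(i <- s) _.
have twow : 2 *: w = \sum_(i <- s) (2 * v i) *: b i.
  by rewrite scaler_sumr; apply: eq_bigr => i _; rewrite scalerA.
have sig2 : 0 <= 2 * sig <= d1 by apply/andP; split; lra.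
have v2 i : `|2 * v i| <= 2 * sig.
  by rewrite normrM ger0_norm // ler_pM2l.
have [w1 w2] := Hd1 (2 * sig) (fun i => 2 * v i) sig2 v2.
rewrite -twow in w1 w2.
have uk : `|2 *: u| <= kap'.
  rewrite /u scalerA normrZ.
  apply: (@le_trans _ _ (2 * sig * (`|b j| + 1))).
    by apply: ler_pM => //; rewrite ?v2 // lerDl.
  move: db; rewrite ler_pdivlMr // => db.
  by have := ler_wpM2r (ltW bj0) sigd; lra.
have Du : Delta (2 *: u) <= e / 2 * (2 * sig).
  have a01 : 0 <= `|2 * v j| / t <= 1.
    rewrite divr_ge0 ?(ltW t0) //= ler_pdivrMr // mul1r.
    by apply: (le_trans (v2 j)); lra.
  have tb : ball (t *: b j) by [].
  have := Delta_radial tb a01.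
  have -> : Delta ((`|2 * v j| / t) *: (t *: b j)) = Delta (2 *: u).
    rewrite scalerA divfK ?gt_eqF // /u scalerA.
    by case: (ger0P (2 * v j)) => _; rewrite ?scaleNr ?DeltaN.
  move=> /le_trans; apply.
  apply: (@le_trans _ _ (`|2 * v j| / t * (e / 2 * t))).
    by rewrite ler_wpM2l //; have /andP[] := a01.
  rewrite [leLHS](_ : _ = e / 2 * `|2 * v j|); last by field; rewrite gt_eqF.
  by rewrite ler_wpM2l ?(ltW e20).
have uw : 2 * `|u| + 2 * `|w| <= 2 * kap'.
  by move: uk w1; rewrite !normrZ ger0_norm //; lra.
split; first by apply: (le_trans (ler_normD _ _)); lra.
have bu : ball (2 *: u) by apply: ball_small; lra.
have bw : ball (2 *: w) by apply: ball_small; lra.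
by apply: (le_trans (Delta_half bu bw)); lra.
Qed.

Lemma smooth_directions (A : R) : 0 <= A ->
  (forall v, exists2 a : 'I_n -> R, v = \sum_i a i *: b i & forall i, `|a i| <= A * `|v|) ->
  second_difference_small x0 r h x.
Proof.
move=> A0 Hb e e0; have A1 : 0 < A + 1 by rewrite ltr_wpDl.
have eA : 0 < e / (A + 1) by rewrite divr_gt0.
have [d [d0 Hd]] := combination_small (index_enum 'I_n) eA ltr01.
have gap : 0 < r - `|x - x0| by rewrite subr_gt0.
pose d' := Num.min (d / (A + 1)) ((r - `|x - x0|) / 2).
have d'0 : 0 < d' by rewrite lt_min !divr_gt0.
have d'g : d' <= (r - `|x - x0|) / 2 by rewrite ge_min lexx orbT.
have d'd : (A + 1) * d' <= d by rewrite -ler_pdivlMl // mulrC ge_min lexx.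
exists d'; split=> //; first by lra.
move=> v vd; have [a va Ha] := Hb v.
have sig : 0 <= (A + 1) * d' <= d by rewrite d'd mulr_ge0 // ltW.
have as_ i : `|a i| <= (A + 1) * d'.
  apply: (le_trans (Ha i)); apply: ler_pM => //; by rewrite lerDl.
have [_] := Hd _ _ sig as_; rewrite -va /Delta => /le_trans; apply.
by rewrite mulrA divfK // gt_eqF.
Qed.

End SmoothDirections.

(** * Convex functions on a manifold *)

Section FrechetCalculus.
Context (R : realType) (E F : normedModType R).

Lemma differentiable_frechet (f : E -> F) x (e : R) : differentiable f x -> 0 < e ->
  \forall y \near x, `|f y - f x - 'd f x (y - x)| <= e * `|y - x|.
Proof.
move=> /diff_locally /eqaddoP fx e0; have := fx e e0.
rewrite [in X in _ -> X](near_shift 0) subr0; apply: filterS => y /=; rewrite addrK.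
rewrite (_ : (f \o shift x - (cst (f x) + 'd f x)) y = f (y + x) - f x - 'd f x y) //.
by rewrite /= /cst !fctE /= opprD addrA.
Qed.

Lemma differentiable_near (f g : E -> F) x :
  (\forall y \near x, f y = g y) -> differentiable f x -> differentiable g x.
Proof.
move=> fg df; have fgx := nbhs_singleton fg.
have [C [_ HC]] := (linear_boundedP ('d f x)).1
  ((linear_bounded_continuous ('d f x)).2 (diff_continuous df)).
have K1 : C < C + 1 by rewrite ltrDl.
apply: (@frechet_differentiable _ _ _ g x ('d f x) (C + 1)).
- by move=> a u v; rewrite linearP.
- exact: HC K1.
- move=> e e0; have := differentiable_frechet df e0.
  by rewrite -fgx; apply: filterS2 fg => y ->.
Qed.

Lemma smooth_on_differentiable (W : set E) (f : E -> F) x : open W -> W x ->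
  smooth_on W f -> differentiable f x.
Proof.
move=> Wo Wx [D [Df Dm De]].
have [lin [C HC]] := Dm 1%N x isT Wx.
apply: (@frechet_differentiable _ _ _ f x (fun v => D x [:: v]) C).
- by move=> a u v; exact: (lin [::] [::]).
- by move=> u; have := HC [:: u] erefl; rewrite big_seq1.
- move=> e e0; have : \forall y \near x, W y by exact: open_nbhs_nbhs.
  apply: filterS2 (De 0%N x e isT Wx e0) => y /(_ [::] erefl) + Wy.
  by rewrite (Df y [::]) // (Df x [::]) // big_nil mulr1.
Qed.

End FrechetCalculus.

Section LinearCoordinates.
Context (R : realType) (H : completeNormedModType R) (n : nat) (L : {linear 'rV[R]_n -> H}).
Implicit Types z : 'rV[R]_n.

Lemma linear_rV_sum z : L z = \sum_j z 0 j *: L 'e_j.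
Proof.
rewrite [in LHS](row_sum_delta z) linear_sum.
by apply: eq_bigr => j _; rewrite linearZ.
Qed.

Lemma linear_rV_bound z (d : R) : (forall j, `|z 0 j| <= d) ->
  `|L z| <= (\sum_j `|L 'e_j|) * d.
Proof.
move=> zd; rewrite linear_rV_sum mulr_suml; apply: (le_trans (ler_norm_sum _ _ _)).
by apply: ler_sum => j _; rewrite normrZ mulrC ler_wpM2l.
Qed.

Lemma coord_le_norm (z : 'rV[R]_n) j : `|z 0 j| <= `|z|.
Proof. by rewrite [leRHS]/Num.norm /= mx_normrE; apply/bigmax_geP; right => /=; exists (0, j). Qed.

Lemma linear_rV_coercive : injective L ->
  exists2 A : R, 0 <= A & forall z j, `|z 0 j| <= A * `|L z|.
Proof.
move=> Linj; pose S : set 'rV[R]_n := [set z | `|z| = 1].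
have [c c0 Hc] : exists2 c : R, 0 < c & forall z, `|z| = 1 -> c <= `|L z|.
  have [S0|S0] := pselect (S !=set0); last first.
    by exists 1 => // z z1; case: S0; exists z.
  have cS : compact S.
    apply: bounded_closed_compact.
      by exists 1; split=> // x x1 z /= ->; exact: ltW.
    rewrite (_ : S = (fun z : 'rV[R]_n => `|z|) @^-1` [set 1]) //.
    by apply: preimage_closed; [move=> z _; exact: norm_continuous|exact: closed_eq].
  have cL : continuous (fun z => `|L z|).
    have Lc : continuous L.
      apply/linear_bounded_continuous/linear_boundedP.
      exists (\sum_j `|L 'e_j|); split=> [|K LK z]; first exact: num_real.
      apply: (le_trans (linear_rV_bound (coord_le_norm z))).
      by rewrite ler_wpM2r // ltW.
    by move=> z; apply: continuous_comp; [exact: Lc|exact: norm_continuous].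
  have [z zS zmin] := EVT_min_rV S0 cS (continuous_subspaceT cL).
  exists `|L z| => [|y y1]; last by apply: zmin; rewrite inE.
  rewrite normr_gt0; apply/eqP => Lz0; move: zS; rewrite inE /S /=.
  rewrite (_ : z = 0) ?normr0; last by apply: Linj; rewrite Lz0 linear0.
  by move=> /esym/eqP; rewrite oner_eq0.
exists c^-1 => [|z j]; first by rewrite invr_ge0 ltW.
apply: (le_trans (coord_le_norm z j)).
have [->|z0] := eqVneq z 0; first by rewrite normr0 mulr_ge0 // invr_ge0 ltW.
have nz : 0 < `|z| by rewrite normr_gt0.
have := Hc (`|z|^-1 *: z); rewrite linearZ /= !normrZ gtr0_norm ?invr_gt0 //.
rewrite mulVf ?gt_eqF // => /(_ erefl) h.
by rewrite ler_pdivlMl // mulrC -ler_pdivlMl.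
Qed.

Lemma lebesgue_null_local (A : set 'rV[R]_n) :
  (forall z, A z -> exists2 eps : R, 0 < eps & forall c0 rho, 0 < rho <= eps ->
     in_cube c0 rho z -> lebesgue_null (A `&` [set y | in_cube c0 rho y])) ->
  lebesgue_null A.
Proof.
move=> Aloc.
pose cube (t : 'rV[rat]_n * nat) := A `&` [set y | in_cube (map_mx ratr t.1) t.2.+1%:R^-1 y].
apply: (@lebesgue_null_subset _ _ _
  (\bigcup_t [set z | cube t z /\ lebesgue_null (cube t)])); last first.
  apply: lebesgue_null_bigcup => t; have [nt|nt] := pselect (lebesgue_null (cube t)).
    by apply: lebesgue_null_subset nt => z [].
  by apply: lebesgue_null_subset (@lebesgue_null0 R n) => z [].
move=> z Az; have [eps eps0 Heps] := Aloc z Az.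
have [m _ Hm] := near_infty_natSinv_lt (PosNum eps0).
have /= {}Hm := Hm m (leqnn m).
have rho0 : 0 < m.+1%:R^-1 :> R by rewrite invr_gt0 ltr0n.
have /choice[q Hq] : forall j, exists q : rat, `|z 0 j - ratr q| < m.+1%:R^-1 :> R.
  move=> j; have [q] : exists q : rat, ratr q \in `]z 0 j - m.+1%:R^-1, z 0 j[.
    by apply: rat_in_itvoo; rewrite gtrBl.
  rewrite in_itv /= => /andP[q1 q2]; exists q.
  by rewrite gtr0_norm ?subr_gt0 // ltrBlDr -ltrBlDl.
have zc : in_cube (map_mx ratr (\row_j q j)) m.+1%:R^-1 z by move=> j; rewrite !mxE.
exists (\row_j q j, m) => //; split; first by split.
by apply: Heps zc; rewrite rho0 ltW.
Qed.

End LinearCoordinates.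

Section Differentiability.
Context (R : realType) (H : completeNormedModType R) (dot : {dot H for idfun}).
Hypothesis (hdot : hilbert_product dot).
Let ds := dot_scalar_product dot.

Lemma second_difference_differentiable (g : H -> R) (x0 : H) (r L C : R) (x : H) :
  0 <= C ->
  (forall x y, `|x - x0| < r -> `|y - x0| < r ->
     `|(g x + C * dot x x) - (g y + C * dot y y)| <= L * `|x - y|) ->
  (forall x y a, `|x - x0| < r -> `|y - x0| < r -> 0 <= a <= 1 ->
     g ((1 - a) *: x + a *: y) + C * dot ((1 - a) *: x + a *: y) ((1 - a) *: x + a *: y) <=
       (1 - a) * (g x + C * dot x x) + a * (g y + C * dot y y)) ->
  `|x - x0| < r -> second_difference_small x0 r (fun x => g x + C * dot x x) x ->
  differentiable (g : H -> R^o) x.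
Proof.
move=> C0 lip cvx xr sd; pose h x := g x + C * dot x x.
pose s0 := (r - `|x - x0|) / 2.
have gap : 0 < r - `|x - x0| by rewrite subr_gt0.
have s00 : 0 < s0 by rewrite divr_gt0.
have xs0 : `|x - x0| + s0 < r by rewrite /s0; lra.
have lin := slope_linear (h := h) lip cvx xs0 s00 sd.
have bnd := slope_bound (h := h) lip cvx xs0 s00 sd.
have est := convex_frechet (h := h) lip cvx xs0 s00 sd.
apply: (@frechet_differentiable _ _ R^o _ _
  (fun v => slope h x s0 v - 2 * C * dot x v) (L + 2 * C * `|x|)).
- by move=> a u v; rewrite lin !(spE ds) /GRing.scale /=; ring.
- move=> u; apply: (le_trans (ler_normB _ _)); rewrite [leRHS]mulrDl lerD //.
  by rewrite -[leRHS]mulrA normrM ger0_norm ?mulr_ge0 // ler_wpM2l ?mulr_ge0 // (dot_le ds hdot).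
- move=> e e0; have e20 : 0 < e / 2 by rewrite divr_gt0.
  have C1 : 0 < C + 1 by rewrite ltr_wpDl.
  have eC : 0 < e / 2 / (C + 1) by rewrite divr_gt0.
  apply: filterS2 (near_lt_norm x eC) (est _ e20) => y yx Hy.
  rewrite (_ : g y - g x - _ = (h y - h x - slope h x s0 (y - x)) -
    C * dot (y - x) (y - x)); last first.
    by rewrite /h !(spE ds) (sp_sym ds y x); ring.
  apply: (le_trans (ler_normB _ _)).
  rewrite -hdot normrM (ger0_norm C0) ger0_norm ?sqr_ge0 //.
  move: yx; rewrite ltr_pdivlMr // => yx; have y0 := normr_ge0 (y - x).
  by move: Hy; nra.
Qed.

Context (M : riemannian_manifold H).

Lemma frechet_chart_change (f : M -> R) (i : rm_index M) (p : M) : rm_dom i p ->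
  differentiable (f \o rm_param i : H -> R^o) (rm_chart i p) ->
  frechet_differentiable_at f p.
Proof.
move=> pi df j pj; pose W := rm_chart j @` (rm_dom j `&` rm_dom i).
have Wo : open W.
  rewrite openE => _ [q [qj qi] <-]; rewrite /interior.
  have U1 : \forall y \near rm_chart j q, (rm_chart j @` rm_dom j) y.
    by apply: open_nbhs_nbhs; split; [exact: rm_image_open|exists q].
  have U2 : \forall y \near rm_chart j q, rm_dom i (rm_param j y).
    apply: (rm_param_continuous qj); rewrite (rm_chartK qj).
    by apply: open_nbhs_nbhs; split=> //; exact: rm_dom_open.
  apply: filterS2 U1 U2 => y Uy yi; exists (rm_param j y); last exact: chart_paramK.
  by split=> //; exact: param_dom.
have Wp : W (rm_chart j p) by exists p.
have dt : differentiable (rm_chart i \o rm_param j) (rm_chart j p).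
  exact: smooth_on_differentiable Wo Wp (rm_transition_smooth j i).
apply: (@differentiable_near _ _ _ ((f \o rm_param i) \o (rm_chart i \o rm_param j) : H -> R^o)).
  apply: filterS (open_nbhs_nbhs (conj Wo Wp)) => _ [q [qj qi] <-].
  by rewrite /= (rm_chartK qj) (rm_chartK qi).
apply: differentiable_comp => //.
by rewrite /= (rm_chartK pj).
Qed.

Context (f : M -> R) (f_convex : geodesically_convex f) (f_bounded : locally_bounded f).

Lemma chart_convexify (i : rm_index M) (x0 : H) : (rm_chart i @` rm_dom i) x0 ->
  exists r L C : R, let h x := f (rm_param i x) + C * dot x x in
  [/\ 0 < r /\ 0 <= L,
    forall x, `|x - x0| < r -> (rm_chart i @` rm_dom i) x,
    forall x y, `|x - x0| < r -> `|y - x0| < r -> `|h x - h y| <= L * `|x - y|,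
    forall x y a, `|x - x0| < r -> `|y - x0| < r -> 0 <= a <= 1 ->
      h ((1 - a) *: x + a *: y) <= (1 - a) * h x + a * h y &
    forall x, `|x - x0| < r -> second_difference_small x0 r h x ->
      frechet_differentiable_at f (rm_param i x)].
Proof.
move=> Ux0; have [r [L [C [r0 C0 rU lip cvx]]]] := chart_semiconvex hdot f_convex f_bounded Ux0.
pose L' := `|L| + 2 * C * (`|x0| + r); pose h x := f (rm_param i x) + C * dot x x.
have hlip x y : `|x - x0| < r -> `|y - x0| < r -> `|h x - h y| <= L' * `|x - y|.
  move=> xr yr.
  rewrite (_ : h x - h y = (f (rm_param i x) - f (rm_param i y)) +
    C * (dot x (x - y) + dot y (x - y))); last first.
    by rewrite /h !(spE ds) (sp_sym ds y x); ring.
  apply: (le_trans (ler_normD _ _)); rewrite /L' mulrDl lerD //.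
    by apply: (le_trans (lip x y xr yr)); rewrite ler_wpM2r // ler_norm.
  rewrite normrM (ger0_norm C0) -!mulrA [leRHS]mulrCA ler_wpM2l //.
  apply: (le_trans (ler_normD _ _)).
  apply: (le_trans (lerD (dot_le ds hdot _ _) (dot_le ds hdot _ _))).
  rewrite -mulrDl mulrA ler_wpM2r //.
  have small z : `|z - x0| < r -> `|z| <= `|x0| + r.
    move=> zr; rewrite (_ : z = x0 + (z - x0)); last by rewrite addrC subrK.
    by apply: (le_trans (ler_normD _ _)); rewrite lerD2l ltW.
  by have := small x xr; have := small y yr; lra.
have hcvx x y a : `|x - x0| < r -> `|y - x0| < r -> 0 <= a <= 1 ->
    h ((1 - a) *: x + a *: y) <= (1 - a) * h x + a * h y.
  move=> xr yr a01; have := cvx x y a xr yr a01.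
  rewrite hdot /h !(spE ds) (sp_sym ds y x) /=; lra.
exists r, L', C; split=> //.
  by split=> //; rewrite addr_ge0 // !mulr_ge0 // addr_ge0 // ltW.
move=> x xr sd; have Ux := rU x xr.
apply: (@frechet_chart_change f i _ (param_dom Ux)); rewrite (chart_paramK Ux).
exact: (@second_difference_differentiable (f \o rm_param i) x0 r L' C).
Qed.

Lemma frechet_dense : dense [set p : M | frechet_differentiable_at f p].
Proof.
move=> O [p Op] Oo; have [i pi] := rm_cover p.
have Ux0 : (rm_chart i @` rm_dom i) (rm_chart i p) by exists p.
have [r [L [C [[r0 L0] rU lip cvx sdd]]]] := chart_convexify Ux0.
have [r1 /= r10 Hr1] : nbhs_ball (rm_chart i p) (fun y => O (rm_param i y)).
  apply/nbhs_ballP; apply: (rm_param_continuous pi); rewrite (rm_chartK pi).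
  exact: open_nbhs_nbhs.
have r20 : 0 < Num.min r r1 by rewrite lt_min r0.
have [|x] := generic_second_difference (x0 := rm_chart i p) (r := Num.min r r1)
  (h := fun x => f (rm_param i x) + C * dot x x) L0 _ ds hdot r20.
  by move=> x y; rewrite !lt_min => /andP[xr _] /andP[yr _]; exact: lip.
rewrite lt_min => /andP[xr xr1] sd; exists (rm_param i x); split.
  by apply: Hr1; rewrite -ball_normE /= distrC.
apply: sdd => // e e0; have [d [d0 dr Hd]] := sd e e0; exists d; split=> //.
by rewrite (lt_le_trans dr) // ge_min lexx.
Qed.

Lemma frechet_null (n : nat) (L : {linear 'rV[R]_n -> H}) : bijective L ->
  measure_zero L (~` [set p : M | frechet_differentiable_at f p]).
Proof.
move=> Lbij i; have [A A0 HA] := linear_rV_coercive (bij_inj Lbij).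
have [Li LiK LK] := Lbij.
apply: lebesgue_null_local => z [p [pi nfp] zp].
have Ux0 : (rm_chart i @` rm_dom i) (L z) by exists p.
have [r [Lh [C [[r0 Lh0] rU lip cvx sdd]]]] := chart_convexify Ux0.
set h := fun x => f (rm_param i x) + C * dot x x in lip cvx sdd.
pose K : R := \sum_j `|L 'e_j|; have K0 : 0 <= K by rewrite sumr_ge0.
have K1 : 0 < 2 * (K + 1) by rewrite mulr_gt0 // ltr_wpDl.
exists (r / (2 * (K + 1))); first by rewrite divr_gt0.
move=> c0 rho /andP[rho0]; rewrite ler_pdivlMr // => rhor zc.
have cr y : in_cube c0 rho y -> `|L y - L z| < r.
  move=> yc; rewrite -linearB.
  apply: (@le_lt_trans _ _ (K * (2 * rho))); last by lra.
  apply: linear_rV_bound => j; rewrite !mxE.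
  have := yc j; have := zc j; rewrite !ltr_norml ler_norml => /andP[? ?] /andP[? ?].
  by apply/andP; split; lra.
apply: lebesgue_null_subset (@kinks_null _ _ (h \o L) c0 rho (Lh * K) _ _ _ _) => //.
- move=> y [[q [qi nfq] yq] yc]; split=> //; apply: contrapT => /forallNP sm.
  apply: nfq; rewrite -(rm_chartK qi) yq; apply: sdd; first exact: cr.
  apply: (smooth_directions (b := fun j => L 'e_j) cvx (cr y yc) _ A0).
    move=> j e e0; have /contrapT/(_ e e0)[t [t0 c1 c2 Ht]] := sm j.
    have E1 : L (y + t *: 'e_j) = L y + t *: L 'e_j by rewrite linearD linearZ.
    have E2 : L (y - t *: 'e_j) = L y - t *: L 'e_j by rewrite linearB linearZ.
    by exists t; rewrite -E1 -E2; split=> //; exact: cr.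
  move=> v; exists (fun j => Li v 0 j); first by rewrite -linear_rV_sum LK.
  by move=> j; rewrite -[in leRHS](LK v).
- by rewrite mulr_ge0.
- move=> x y d xc yc d0 xyd; apply: (le_trans (lip _ _ (cr x xc) (cr y yc))).
  rewrite -linearB -mulrA ler_wpM2l //; apply: linear_rV_bound => j.
  by rewrite !mxE.
- move=> x y a xc yc a01; rewrite /= linearD !linearZ; apply: cvx => //; exact: cr.
Qed.

End Differentiability.

Theorem corollary5p8 (R : realType) (H : completeNormedModType R)
    (dot : {dot H for idfun}) (hdot : hilbert_product dot)
    (M : riemannian_manifold H) (f : M -> R)
    (f_convex : geodesically_convex f) (f_bounded : locally_bounded f) :
  dense [set p : M | frechet_differentiable_at f p] /\
  (forall (n : nat) (L : {linear 'rV[R]_n -> H}), bijective L ->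
     measure_zero L (~` [set p : M | frechet_differentiable_at f p])).
Proof.
split=> [|n L Lbij]; first by have := @frechet_dense _ _ _ hdot _ _ f_convex f_bounded.
by have := @frechet_null _ _ _ hdot _ _ f_convex f_bounded _ _ Lbij.
Qed.
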